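(* There exists a countable CW complex $M$ such that the class of metrizable compacta $\{X : M\in \mathrm{AE}(X)\}$ has a universal space, but the extension type $[M]$ of $M$ does not contain a finitely dominated complex.
   Context: All spaces are Tychonoff and all maps are continuous. For spaces $X$ and $L$, the notation $L\in \mathrm{AE}(X)$ means that every map $f\colon A\to L$ defined on a closed subspace $A$ of $X$ admits an extension $\bar f\colon X\to L$ over $X$. For CW complexes $L$ and $K$, write $L\le K$ if for each space $X$ the condition $L\in \mathrm{AE}(X)$ implies $K\in \mathrm{AE}(X)$. This is a preorder on the class of CW complexes; the equivalence class of $L$ under the equivalence relation it generates ($L\le K$ and $K\le L$) is called the extension type of $L$ and is denoted $[L]$. A universal space for a class of metrizable compacta is a member of the class into which every member of the class embeds topologically. A CW complex is finitely dominated if it is homotopy dominated by a finite CW complex, i.e. it is a homotopy retract of a finite CW complex. *)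

(* Defs.v *)
From HB Require Import structures.
From mathcomp Require Import all_boot all_order all_algebra.
From mathcomp Require Import all_classical all_reals all_analysis.

Set Implicit Arguments.
Unset Strict Implicit.
Unset Printing Implicit Defensive.

Import Order.TTheory GRing.Theory Num.Theory.
Import numFieldNormedType.Exports.

Local Open Scope classical_set_scope.
Local Open Scope ring_scope.

(* Tychonoff = completely regular and Hausdorff.  Every quantification over
   "all spaces" below is guarded by this predicate; metrizable spaces and CW
   complexes satisfy it automatically. *)
Definition tychonoff_space (X : topologicalType) : Prop :=
  completely_regular_space X /\ hausdorff_space X.

Definition embedding (X Y : topologicalType) (f : X -> Y) : Prop :=
  [/\ continuous f, injective f
    & forall U : set X, open U -> exists2 V : set Y, open V & f @^-1` V = U].

Definition homeomorphic (X Y : topologicalType) : Prop :=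
  exists (f : X -> Y) (g : Y -> X),
    [/\ continuous f, continuous g, cancel f g & cancel g f].

(* L \in AE(X).  The partial map f lives on the subtype A (with its subspace
   topology) and not on X, so that the definition is also right for empty L:
   the empty map into an empty L extends over X only if X is empty. *)
Definition absolute_extensor (L X : topologicalType) : Prop :=
  forall A : set X, closed A -> forall f : A -> L, continuous f ->
    exists2 g : X -> L, continuous g & forall a : A, g (set_val a) = f a.

Section EuclideanBalls.
Variables (R : realType) (n : nat).

(* The norm of 'rV[R]_n in the library is the sup norm, hence the explicit sum
   of squares.  For n = 0 both balls are the single point of 'rV[R]_0 and the
   sphere is empty. *)
Definition normsq (x : 'rV[R]_n) : R := \sum_(i < n) x ord0 i ^+ 2.
Definition closed_disk : set 'rV[R]_n := [set x | normsq x <= 1].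
Definition open_disk : set 'rV[R]_n := [set x | normsq x < 1].
Definition unit_sphere : set 'rV[R]_n := [set x | normsq x = 1].

End EuclideanBalls.

(* A CW complex in Whitehead's sense: a Hausdorff space with characteristic maps
   of cells.  Only the values of [cw_char c] on the closed disk matter.
   [cw_boundary] contains closure-finiteness (C), [cw_weak] is the weak
   topology (W); the converse of [cw_weak] follows from [cw_cont]. *)
Record CWcomplex (R : realType) := {
  cw_space :> topologicalType;
  cw_hausdorff : hausdorff_space cw_space;
  cw_cell : Type;
  cw_dim : cw_cell -> nat;
  cw_char : forall c : cw_cell, 'rV[R]_(cw_dim c) -> cw_space;
  cw_cont : forall c : cw_cell,
    {within @closed_disk R (cw_dim c), continuous (@cw_char c)};
  cw_homeo : forall c : cw_cell,
    embedding (sigL (@open_disk R (cw_dim c)) (@cw_char c));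
  cw_disjoint :
    trivIset [set: cw_cell] (fun c => @cw_char c @` @open_disk R (cw_dim c));
  cw_cover :
    \bigcup_(c in [set: cw_cell]) (@cw_char c @` @open_disk R (cw_dim c))
      = [set: cw_space];
  cw_boundary : forall c : cw_cell, exists F : set cw_cell,
    [/\ finite_set F,
        (forall d, F d -> (cw_dim d < cw_dim c)%N)
      & @cw_char c @` @unit_sphere R (cw_dim c)
          `<=` \bigcup_(d in F) (@cw_char d @` @open_disk R (cw_dim d))];
  cw_weak : forall A : set cw_space,
    (forall c : cw_cell,
       closed (@closed_disk R (cw_dim c) `&` @cw_char c @^-1` A)) ->
    closed A
}.

Definition countable_cw (R : realType) (K : CWcomplex R) : Prop :=
  countable [set: cw_cell K].

Definition finite_cw (R : realType) (K : CWcomplex R) : Prop :=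
  finite_set [set: cw_cell K].

Definition homotopic (R : realType) (X Y : topologicalType) (f g : X -> Y)
    : Prop :=
  exists H : X * R -> Y,
    [/\ {within [set: X] `*` `[0, 1], continuous H},
        (forall x, H (x, 0) = f x)
      & (forall x, H (x, 1) = g x)].

Definition homotopy_dominated (R : realType) (K F : topologicalType) : Prop :=
  exists (s : K -> F) (r : F -> K),
    [/\ continuous s, continuous r & homotopic R (r \o s) id].

Definition finitely_dominated (R : realType) (K : CWcomplex R) : Prop :=
  exists2 F : CWcomplex R, finite_cw F & homotopy_dominated R K F.

Definition ext_le (R : realType) (L K : CWcomplex R) : Prop :=
  forall X : topologicalType, tychonoff_space X ->
    absolute_extensor L X -> absolute_extensor K X.

(* [extension_type L K] : K belongs to the extension type of L.  This is a
   predicate and not a [set] because CWcomplex R is too large for [set]. *)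
Definition extension_type (R : realType) (L K : CWcomplex R) : Prop :=
  ext_le L K /\ ext_le K L.

Definition metrizable (R : realType) (X : topologicalType) : Prop :=
  exists Y : metricType R, homeomorphic X Y.

Definition metrizable_compactum (R : realType) (X : topologicalType) : Prop :=
  metrizable R X /\ compact [set: X].

Definition universal_space (C : topologicalType -> Prop) (U : topologicalType)
    : Prop :=
  C U /\ forall X : topologicalType, C X -> exists f : X -> U, embedding f.

(* Main.v *)
(* Let P_q be the pseudo-projective plane of degree q, a disk whose boundary is
   wrapped q times around a circle, and let M be a ray with P_(n+1) attached at
   the integer n.  For compact X, M is in AE(X) if and only if all the P_q are.

   Universal space.  Formal terms are built from base functions by rational
   lattice-linear operations and by formal solutions of all extension problems
   into the P_q.  The valuations of the terms that respect these operations form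
   a compact space U.  By Stone-Weierstrass a map from a closed subset of U to
   P_q is approximated by a term, and the formal solution of the corresponding
   problem yields an extension over U, so that P_q is in AE(U).  Conversely, if
   all the P_q are in AE(X), solving the extension problems one term at a time
   maps X to U with arbitrary base coordinates.  With countably many base
   functions, U is metrizable and universal.

   Finite domination.  Let K in [M] be dominated by a finite complex F.  Take for
   base functions all maps from F to [0, 1].  Since K is in AE(U), the
   domination map F -> K, viewed on the valuations with base coordinates in F,
   extends over a neighbourhood of U, and hence over the valuations satisfying
   finitely many constraints.  Thus for some m, K is in AE(X) as soon as P_q is
   for all q <= m.  Let p > m be prime, and let X be the space of valuations with
   one base function, with values in the disk, and with the extension problems
   for q < p only.  Then K, M and P_p are in AE(X), so the map from the boundary
   circle of the disk to the core circle of P_p, defined on part of X, extends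
   over X, and this extension persists under finitely many constraints.
   The generator of H^1(P_p; Z/p) pulls back to a class over the corresponding
   finite stage, which is obtained from the disk by adding coordinates one by
   one; the fibres are points or spaces P_q with q < p, which are connected and
   Z/p-acyclic, so the class descends to the disk.  It is then trivial on the
   boundary circle, which is a contradiction. *)
From HB Require Import structures.
Require Import Defs.
From mathcomp Require Import all_boot all_order all_algebra.
From mathcomp Require Import all_classical all_reals all_analysis.
From mathcomp Require Import ring lra.

Set Implicit Arguments.
Unset Strict Implicit.
Unset Printing Implicit Defensive.

Import Order.TTheory GRing.Theory Num.Theory.
Import numFieldNormedType.Exports.

Local Open Scope classical_set_scope.
Local Open Scope ring_scope.

(** * Topological preliminaries *)

Section Topology.

(** The obstacle is that infinitely many degrees have to be played off against a complex that sees
    only finitely many. Every passage from infinitely many conditions to finitely many is a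
    compactness argument: valuations are cut out of a compact product by closed constraints, and a
    map into a neighbourhood retract, once extended, stays defined where finitely many constraints
    hold. The P_q are such retracts, and so are finite subcomplexes, which contain every compact
    subset of a CW complex. Primes enter because q is invertible in Z/p for q < p, which makes P_q
    acyclic mod p, while P_p carries a class mod p that is nonzero on its core circle. The finite
    stages are compacta without cell structure, hence Alexander-Spanier cochains; only degree 1
    occurs, so that fibres need only be connected and have no first cohomology. M is a comb and not
    a wedge, so that the weak topology is a subspace topology. Extension types are tested on all
    Tychonoff spaces, hence valuations with uncountably many base functions are admissible;
    countability matters for the universal space only. *)

Lemma withinP (X Y : topologicalType) (A : set X) (f : X -> Y) :
  {within A, continuous f} <->
  (forall x, A x -> forall W, nbhs (f x) W -> \forall y \near x, A y -> W (f y)).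
Proof.
rewrite subspace_continuousP; split => h x Ax W nW; exact: (h x Ax W nW).
Qed.

Lemma within_closedP (X Y : topologicalType) (A : set X) (f : X -> Y) :
  closed A ->
  {within A, continuous f} <->
  (forall C, closed C -> closed (A `&` f @^-1` C)).
Proof.
move=> cA; rewrite continuous_closedP; split => h C cC; have := h C cC.
  by rewrite -(closed_setSI _ cA).
by rewrite -(closed_setSI _ cA).
Qed.

Lemma open_from_near (T : topologicalType) (A : set T) :
  (forall x, A x -> \forall y \near x, A y) -> open A.
Proof. by rewrite openE. Qed.

Lemma near_open (X : topologicalType) (x : X) (P : X -> Prop) :
  (\forall y \near x, P y) ->
  exists V : set X, [/\ open V, V x & forall y, V y -> P y].
Proof.
move=> nP; exists (interior P); split => //; first exact: open_interior.
exact: interior_subset.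
Qed.

Lemma within_comp (X Y Z : topologicalType) (A : set X) (B : set Y)
    (f : X -> Y) (g : Y -> Z) :
  {within A, continuous f} -> f @` A `<=` B -> {within B, continuous g} ->
  {within A, continuous (fun x => g (f x))}.
Proof.
move=> /withinP cf fAB /withinP cg; apply/withinP => x Ax W nW.
have Bfx : B (f x) by apply: fAB; exists x.
have := cf x Ax _ (cg _ Bfx _ nW).
by apply: filterS => y /[swap] Ay /(_ Ay); apply; apply: fAB; exists y.
Qed.

Lemma within_comp_cts (X Y Z : topologicalType) (A : set X)
    (f : X -> Y) (g : Y -> Z) :
  {within A, continuous f} -> continuous g ->
  {within A, continuous (fun x => g (f x))}.
Proof.
move=> cf cg; apply: (within_comp (B := setT) cf) => //.
exact: continuous_subspaceT.
Qed.

Lemma compact_within_image (X Y : topologicalType) (D : set X) (f : X -> Y) :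
  {within D, continuous f} -> compact D -> compact (f @` D).
Proof. exact: continuous_compact. Qed.

(** On a compact set [q] sends closed subsets to compact, hence closed, sets, so the image of [D]
    carries the quotient topology. With [u] a left inverse of an injective [q] this also inverts
    embeddings of compacta. *)
Lemma quotient_continuous (X Y Z : topologicalType) (D : set X) (q : X -> Y)
    (u : Y -> Z) :
  compact D -> hausdorff_space Y ->
  {within D, continuous q} -> {within D, continuous (u \o q)} ->
  {within q @` D, continuous u}.
Proof.
move=> cD hY cq cuq.
have cqD : closed (q @` D).
  exact/(compact_closed hY)/compact_within_image.
apply/within_closedP => // C cC.
suff -> : q @` D `&` u @^-1` C = q @` (D `&` (u \o q) @^-1` C).
  apply: (compact_closed hY); apply: compact_within_image.
    by apply: continuous_subspaceW cq => x [].
  have /continuous_closedP/(_ _ cC)/closed_subspaceP[V cV VE] := cuq.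
  by rewrite setIC -VE setIC; exact: compact_closedI.
apply/seteqP; split => [y [[x Dx <-] Cu]|y [x [Dx Cu] <-]]; last first.
  by split => //; exists x.
by exists x.
Qed.

(** The index type has no decidable equality, so finite subfamilies are lists with [List.In]. The
    near-covering form of compactness is applied to the filter of lists ordered by inclusion. *)
Lemma compact_finite_subcover (X : topologicalType) (C : set X) (I : Type)
    (O : I -> set X) :
  compact C -> (forall i, open (O i)) -> (forall x, C x -> exists i, O i x) ->
  exists l : seq I, forall x, C x -> exists2 i, List.In i l & O i x.
Proof.
move=> /compact_near_coveringP cC oO cO.
pose above (l0 : seq I) := [set l : seq I | forall i, List.In i l0 -> List.In i l].
have FF : Filter (filter_from [set: seq I] above).
  apply: filter_from_filter; first by exists [::].
  move=> l0 l1 _ _; exists (l0 ++ l1) => // l h; split => i il; apply: h.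
    by apply: List.in_or_app; left.
  by apply: List.in_or_app; right.
have [x Cx|l _ h] := cC _ _ (fun l x => exists2 i, List.In i l & O i x) FF.
  have [i Oi] := cO x Cx.
  exists (O i, above [:: i]) => /=.
    split; last by exists [:: i].
    by apply: open_nbhs_nbhs; split.
  by move=> [y l] /= [Oy la]; exists i => //; apply: la; left.
by exists l => x Cx; exact: h Cx.
Qed.

Lemma compact_setType (X : topologicalType) (A : set X) :
  compact A -> compact [set: set_type A].
Proof.
move=> cA F PF _.
have [x [Ax clx]] : A `&` cluster (set_val @ F) !=set0.
  by apply: cA; rewrite nbhs_simpl/=; apply: filterS filterT => a _; exact: set_valP.
 exists (SigSub (mem_set Ax) : set_type A); split => //.
move=> P Q FP [W [[W' oW' <-] W'x] WQ].
have nW' : nbhs x W' by apply: open_nbhs_nbhs; split.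
have FvP : (set_val @ F) (set_val @` P).
  by rewrite nbhs_simpl/=; apply: filterS FP => z Pz; exists z.
have [y [[z Pz <-] W'z]] := clx _ _ FvP nW'.
by exists z; split => //; exact: WQ.
Qed.

Lemma hausdorff_setType (X : topologicalType) (A : set X) :
  hausdorff_space X -> hausdorff_space (set_type A).
Proof.
move=> hX x y cl; apply: val_inj; apply: hX => P Q nP nQ.
have [] := cl (set_val @^-1` P) (set_val @^-1` Q).
- exact: (@initial_continuous A X set_val x _ nP).
- exact: (@initial_continuous A X set_val y _ nQ).
by move=> z [Pz Qz]; exists (set_val z).
Qed.

Lemma continuous_setType (X Y : topologicalType) (B : set Y) (f : X -> set_type B) :
  continuous (set_val \o f) -> continuous f.
Proof.
move=> cf x W [V [[V' oV' <-] V'x] VW].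
have nV : nbhs ((set_val \o f) x) V' by apply: open_nbhs_nbhs.
have := cf x V' nV; rewrite !nbhs_simpl/=; apply: filterS => z Vz; exact: VW.
Qed.

Lemma compact_hausdorff_tychonoff (R : realType) (X : topologicalType) :
  compact [set: X] -> hausdorff_space X -> tychonoff_space X.
Proof.
move=> cX hX; split => //; apply: (@normal_completely_regular R).
  exact: compact_normal.
exact: hausdorff_accessible.
Qed.

Lemma connected_locally_constant (X : topologicalType) (T : Type) (A : set X)
    (f : X -> T) :
  connected A ->
  (forall x, A x -> \forall y \near x, A y -> f y = f x) ->
  forall x y, A x -> A y -> f x = f y.
Proof.
move=> cA lc x y Ax Ay.
have locopen (Q : T -> Prop) : exists2 C, open C & [set z | A z /\ Q (f z)] = A `&` C.
  exists (interior [set z | A z -> Q (f z)]); first exact: open_interior.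
  apply/seteqP; split => z [Az].
    move=> Qz; split => //; rewrite /interior/=.
    by apply: filterS (lc z Az) => w fw Aw; rewrite (fw Aw).
  by move=> /nbhs_singleton/(_ Az).
have : [set z | A z /\ f z = f x] = A.
  apply: cA; first by exists x.
    exact: (locopen (fun t => t = f x)).
  have [C oC CE] := locopen (fun t => t <> f x).
  exists (~` C); first exact: open_closedC.
  apply/seteqP; split => z [Az].
    by move=> fz; split => // Cz; have : (A `&` C) z by []; rewrite -CE => -[].
  move=> nCz; split => //; apply: contrapT => fz; apply: nCz.
  by have : [set z | A z /\ f z <> f x] z by []; rewrite CE => -[].
by move=> /seteqP[_ /(_ y Ay)[_ ->]].
Qed.

End Topology.

(** * Tietze extension into normed spaces *)

Section Tietze.
Variable R : realType.

Lemma cvg_rV (T : Type) (F : set_system T) (FF : Filter F) n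
    (f : T -> 'rV[R]_n) (a : 'rV[R]_n) :
  (forall i, (fun x => f x ord0 i) @ F --> a ord0 i) -> f @ F --> a.
Proof.
move=> h; apply/cvgrPdist_lt => e e0.
have : \forall x \near F, forall i, `|a ord0 i - f x ord0 i| < e.
  apply: filter_forall => i.
  by move/cvgrPdist_lt : (h i) => /(_ e e0).
apply: filterS => x hx.
suff : ball a e (f x) by rewrite mx_norm_ball.
by split => // i j; rewrite (ord1 i) /ball/=; exact: hx.
Qed.

Lemma within_cvgP (X Y : topologicalType) (A : set X) (f : X -> Y) :
  {within A, continuous f} <->
  (forall x, A x -> f @ within A (nbhs x) --> f x).
Proof. exact: subspace_continuousP. Qed.

Lemma fst_cts (X Y : topologicalType) : continuous (@fst X Y).
Proof. by move=> [a b]; exact: cvg_fst. Qed.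

Lemma snd_cts (X Y : topologicalType) : continuous (@snd X Y).
Proof. by move=> [a b]; exact: cvg_snd. Qed.

(** A property of the target, so that it can be carried along while the ambient space of a
    neighbourhood retract grows with each cell. The maps to be extended have relatively compact
    images, whence the bound. *)
Definition tietze (E : normedModType R) :=
  forall (X : topologicalType), normal_space X ->
  forall (A : set X) (f : X -> E), closed A -> {within A, continuous f} ->
  (exists M, forall x, A x -> `|f x| <= M) ->
  exists2 g : X -> E, continuous g & forall x, A x -> g x = f x.

Lemma tietze_R : tietze R.
Proof.
move=> X nX A f cA cf [M fM].
have M0 : 0 < `|M| + 1 by rewrite ltr_wpDl.
have fM' x : A x -> `|f x| <= `|M| + 1.
  move=> Ax; apply: (le_trans (fM x Ax)).
  by rewrite (le_trans (ler_norm M))// lerDl.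
have [g [gf cg _]] := continuous_bounded_extension nX cA M0 cf fM'.
by exists g => // x Ax; rewrite gf//; exact: mem_set.
Qed.

Lemma tietze_clamp (X : topologicalType) (A : set X) (f : X -> R) :
  normal_space X -> closed A -> {within A, continuous f} ->
  (forall x, A x -> 0 <= f x <= 1) ->
  exists g : X -> R, [/\ continuous g, forall x, A x -> g x = f x &
    forall x, 0 <= g x <= 1].
Proof.
move=> nX cA cf f01.
have [|g cg gf] := tietze_R nX cA cf.
  by exists 1 => x /f01/andP[f0 f1]; rewrite ger0_norm.
exists (fun x => Num.min 1 (Num.max 0 (g x))); split => [x|x Ax|x].
- apply: (@continuous_min R X (fun=> 1) (fun y => Num.max 0 (g y)) x).
    exact: cvg_cst.
  by apply: (@continuous_max R X (fun=> 0) g x); [exact: cvg_cst|exact: cg].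
- have /andP[f0 f1] := f01 x Ax; rewrite gf//.
  by rewrite (max_idPr f0) (min_idPr f1).
- by rewrite le_min ler01 le_max lexx/= ge_min lexx.
Qed.

Lemma tietze_prod (E F : normedModType R) : tietze E -> tietze F ->
  tietze (E * F)%type.
Proof.
move=> tE tF X nX A f cA cf [M fM].
have [] := tE X nX A (fst \o f) cA.
- apply/within_cvgP => x Ax; apply: cvg_comp; last exact: fst_cts.
  exact: ((within_cvgP _ _).1 cf x Ax).
- by exists M => x Ax; apply: le_trans (fM x Ax); rewrite prod_normE /= le_max lexx.
move=> g1 cg1 g1f; have [] := tF X nX A (snd \o f) cA.
- apply/within_cvgP => x Ax; apply: cvg_comp; last exact: snd_cts.
  exact: ((within_cvgP _ _).1 cf x Ax).
- by exists M => x Ax; apply: le_trans (fM x Ax); rewrite prod_normE /= le_max lexx orbT.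
move=> g2 cg2 g2f; exists (fun x => (g1 x, g2 x)).
  by move=> x; apply: cvg_pair; [exact: cg1|exact: cg2].
by move=> x Ax; rewrite g1f// g2f//=; case: (f x).
Qed.

Lemma ler_coord_norm n (v : 'rV[R]_n) i : `|v ord0 i| <= `|v|.
Proof.
rewrite [leRHS]mx_normrE; exact: (@le_bigmax _ _ _ 0 (fun ij => `|v ij.1 ij.2|) (ord0, i)).
Qed.

Lemma tietze_rV n : tietze 'rV[R]_n.
Proof.
move=> X nX A f cA cf [M fM].
have h i : exists g : X -> R, continuous g /\ forall x, A x -> g x = f x ord0 i.
  have [] := @tietze_R X nX A (fun x => f x ord0 i) cA.
  - apply/within_cvgP => x Ax.
    apply: (@cvg_comp _ _ _ f (fun v : 'rV[R]_n => v ord0 i)).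
      exact: ((within_cvgP _ _).1 cf x Ax).
    exact: coord_continuous.
  - by exists M => x Ax; apply: le_trans (fM x Ax); exact: ler_coord_norm.
  - by move=> g cg gf; exists g.
have [g gP] := choice h.
exists (fun x => \row_i g i x) => [x|x Ax]; last first.
  by apply/rowP => i; rewrite mxE (gP i).2.
apply: cvg_rV => i; rewrite mxE; under eq_fun do rewrite mxE.
exact: ((gP i).1 x).
Qed.

End Tietze.

(** * Continuity of compound expressions at a point *)

Section Continuity.
Context {R : realType} {T : topologicalType}.
Implicit Types (E F : normedModType R) (x : T).

Lemma for_cst (Y : topologicalType) (c : Y) x : {for x, continuous (fun _ : T => c)}.
Proof. exact: cst_continuous. Qed.

Lemma for_id x : {for x, continuous (fun y : T => y)}.
Proof. exact: cvg_id. Qed.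

Lemma for_pair (Y Z : topologicalType) (f : T -> Y) (g : T -> Z) x :
  {for x, continuous f} -> {for x, continuous g} ->
  {for x, continuous (fun y => (f y, g y))}.
Proof. by move=> cf cg; exact: cvg_pair. Qed.

Lemma for_comp (Y Z : topologicalType) (f : T -> Y) (g : Y -> Z) x :
  {for x, continuous f} -> {for f x, continuous g} ->
  {for x, continuous (fun y => g (f y))}.
Proof. exact: continuous_comp. Qed.

Lemma for_fst (Y Z : topologicalType) (f : T -> Y * Z) x :
  {for x, continuous f} -> {for x, continuous (fun y => (f y).1)}.
Proof. by move=> cf; apply: (for_comp cf); exact: fst_cts. Qed.

Lemma for_snd (Y Z : topologicalType) (f : T -> Y * Z) x :
  {for x, continuous f} -> {for x, continuous (fun y => (f y).2)}.
Proof. by move=> cf; apply: (for_comp cf); exact: snd_cts. Qed.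

Lemma for_add E (f g : T -> E) x :
  {for x, continuous f} -> {for x, continuous g} ->
  {for x, continuous (fun y => f y + g y)}.
Proof. by move=> cf cg; exact: cvgD. Qed.

Lemma for_sub E (f g : T -> E) x :
  {for x, continuous f} -> {for x, continuous g} ->
  {for x, continuous (fun y => f y - g y)}.
Proof. by move=> cf cg; exact: cvgB. Qed.

Lemma for_opp E (f : T -> E) x :
  {for x, continuous f} -> {for x, continuous (fun y => - f y)}.
Proof. by move=> cf; exact: cvgN. Qed.

Lemma for_scale E (s : T -> R) (f : T -> E) x :
  {for x, continuous s} -> {for x, continuous f} ->
  {for x, continuous (fun y => s y *: f y)}.
Proof. by move=> cf cg; exact: cvgZ. Qed.

Lemma for_mul (f g : T -> R) x :
  {for x, continuous f} -> {for x, continuous g} ->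
  {for x, continuous (fun y => f y * g y)}.
Proof. by move=> cf cg; exact: cvgM. Qed.

Lemma for_inv (f : T -> R) x : f x != 0 ->
  {for x, continuous f} -> {for x, continuous (fun y => (f y)^-1)}.
Proof. by move=> fx cf; exact: cvgV. Qed.

Lemma for_norm E (f : T -> E) x :
  {for x, continuous f} -> {for x, continuous (fun y => `|f y|)}.
Proof. by move=> cf; exact: cvg_norm. Qed.

Lemma for_max (f g : T -> R) x :
  {for x, continuous f} -> {for x, continuous g} ->
  {for x, continuous (fun y => Num.max (f y) (g y))}.
Proof. exact: continuous_max. Qed.

Lemma for_min (f g : T -> R) x :
  {for x, continuous f} -> {for x, continuous g} ->
  {for x, continuous (fun y => Num.min (f y) (g y))}.
Proof. exact: continuous_min. Qed.

Lemma for_sqrt (f : T -> R) x :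
  {for x, continuous f} -> {for x, continuous (fun y => Num.sqrt (f y))}.
Proof. by move=> cf; apply: (for_comp cf); exact: sqrt_continuous. Qed.

Lemma for_coord n (f : T -> 'rV[R]_n) i x :
  {for x, continuous f} -> {for x, continuous (fun y => f y ord0 i)}.
Proof. by move=> cf; apply: (for_comp cf (g := fun v : 'rV[R]_n => v ord0 i)); exact: coord_continuous. Qed.

Lemma for_rV n (f : T -> 'rV[R]_n) x :
  (forall i, {for x, continuous (fun y => f y ord0 i)}) -> {for x, continuous f}.
Proof. by move=> cf; apply: cvg_rV => i; exact: cf. Qed.

Lemma near_lt (f g : T -> R) x :
  {for x, continuous f} -> {for x, continuous g} -> f x < g x ->
  \forall y \near x, f y < g y.
Proof.
move=> cf cg fg; have c : {for x, continuous (fun y => g y - f y)} by exact: for_sub.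
have : \forall y \near x, 0 < g y - f y.
  by apply: (@cvgr_gt R T (nbhs x) _ _ _ c); rewrite subr_gt0.
by apply: filterS => y; rewrite subr_gt0.
Qed.

End Continuity.

Lemma open_ltr_fun (R : realType) (T : topologicalType) (f g : T -> R) :
  continuous f -> continuous g -> open [set x | f x < g x].
Proof.
move=> cf cg; apply: open_from_near => x fg.
by apply: near_lt => //; [exact: cf|exact: cg].
Qed.

Lemma continuous_sum_for (R : realType) (E : normedModType R) (T : topologicalType)
    (I : Type) (r : seq I) (f : I -> T -> E) (x : T) :
  (forall i, {for x, continuous (f i)}) ->
  {for x, continuous (fun y => \sum_(i <- r) f i y)}.
Proof.
move=> cf; elim: r => [|i r IH].
  rewrite (_ : (fun _ => _) = fun=> 0); first exact: cvg_cst.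
  by apply/funext => y; rewrite big_nil.
rewrite (_ : (fun _ => _) = fun y => f i y + \sum_(j <- r) f j y).
  by apply: continuousD; [exact: cf|exact: IH].
by apply/funext => y; rewrite big_cons.
Qed.

(** * Euclidean balls and the radial projection *)

Section NormSq.
Variables (R : realType) (n : nat).
Implicit Types v : 'rV[R]_n.

Lemma normsq_ge0 v : 0 <= normsq v.
Proof. by apply: sumr_ge0 => i _; exact: sqr_ge0. Qed.

Lemma normsqZ (a : R) v : normsq (a *: v) = a ^+ 2 * normsq v.
Proof. by rewrite /normsq mulr_sumr; apply: eq_bigr => i _; rewrite mxE exprMn. Qed.

Lemma normsq0 : normsq (0 : 'rV[R]_n) = 0.
Proof. by rewrite /normsq big1// => i _; rewrite mxE expr0n. Qed.

Lemma normsq_continuous : continuous (@normsq R n).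
Proof.
move=> v; apply: continuous_sum_for => i.
exact: (@continuousM R 'rV[R]_n (fun w => w ord0 i) (fun w => w ord0 i) v
  (@coord_continuous R 1 n ord0 i v) (@coord_continuous R 1 n ord0 i v)).
Qed.

Lemma coord_le_normsq v i : v ord0 i ^+ 2 <= normsq v.
Proof.
rewrite /normsq (bigD1 i)//= lerDl.
by apply: sumr_ge0 => j _; exact: sqr_ge0.
Qed.

Lemma normsq_ball_compact (r : R) : compact [set v : 'rV[R]_n | normsq v <= r].
Proof.
apply: bounded_closed_compact.
  exists (1 + `|r|); split => [|M rM v /= vr]; first exact: num_real.
  have M0 : 0 <= M by rewrite (le_trans _ (ltW rM))// addr_ge0.
  rewrite [leLHS]mx_normrE; apply/bigmax_leP; split => // -[i j] _ /=.
  rewrite (ord1 i); have := le_trans (coord_le_normsq v j) vr.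
  rewrite -real_normK ?num_real// => h.
  rewrite leNgt; apply/negP => Mv.
  have h1 : 1 + `|r| < `|v ord0 j| by exact: lt_trans Mv.
  have : 1 + `|r| < `|v ord0 j| ^+ 2.
    apply: (lt_le_trans h1); rewrite expr2 ler_peMl//.
    by apply/ltW/(le_lt_trans _ h1); rewrite lerDl.
  move=> /lt_le_trans/(_ h); rewrite ltNge => /negP; apply.
  by rewrite (le_trans (ler_norm r))// lerDr.
apply: (@closed_comp _ _ (@normsq R n) [set x | x <= r]); last exact: closed_le.
by move=> x _; exact: normsq_continuous.
Qed.

Lemma closed_disk_compact : compact (@closed_disk R n).
Proof. exact: normsq_ball_compact. Qed.

Lemma unit_sphere_closed : closed (@unit_sphere R n).
Proof.
apply: (@closed_comp _ _ (@normsq R n) [set x | x = 1]); last exact: closed_eq.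
by move=> x _; exact: normsq_continuous.
Qed.

Lemma sphere_sub_disk : @unit_sphere R n `<=` @closed_disk R n.
Proof. by move=> v; rewrite /unit_sphere /closed_disk/= => ->. Qed.

Lemma open_sub_disk : @open_disk R n `<=` @closed_disk R n.
Proof. by move=> v; exact: ltW. Qed.

Lemma disk_split : @closed_disk R n = @open_disk R n `|` @unit_sphere R n.
Proof.
apply/seteqP; split => v; rewrite /closed_disk /open_disk /unit_sphere/=.
  by rewrite le_eqVlt => /orP[/eqP|]; [right|left].
by case=> [/ltW|->].
Qed.

(** The radial retraction onto the closed disk. Composing with it turns maps that matter only on the
    disk into maps defined and continuous everywhere. *)
Definition disk_proj v : 'rV[R]_n := (Num.max 1 (Num.sqrt (normsq v)))^-1 *: v.

Let max_gt0 v : 0 < Num.max 1 (Num.sqrt (normsq v)) :> R.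
Proof. by rewrite lt_max ltr01. Qed.

Lemma disk_proj_in v : closed_disk (disk_proj v).
Proof.
rewrite /closed_disk/= /disk_proj normsqZ exprVn mulrC ler_pdivrMr ?exprn_gt0// mul1r.
rewrite -[leLHS](sqr_sqrtr (normsq_ge0 v)).
by rewrite ler_pXn2r// ?nnegrE ?sqrtr_ge0// ?(ltW (max_gt0 _))// le_max lexx orbT.
Qed.

Lemma disk_proj_id v : closed_disk v -> disk_proj v = v.
Proof.
rewrite /closed_disk/= => v1; rewrite /disk_proj max_l ?invr1 ?scale1r//.
by rewrite -[leRHS]sqrtr1 ler_wsqrtr.
Qed.

Lemma disk_proj_sphere v : 1 <= normsq v -> unit_sphere (disk_proj v).
Proof.
move=> v1; have v1' : 1 <= Num.sqrt (normsq v) by rewrite -[leLHS]sqrtr1 ler_wsqrtr.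
rewrite /unit_sphere/= /disk_proj normsqZ max_r// exprVn sqr_sqrtr ?normsq_ge0//.
by rewrite mulVf// gt_eqF// (lt_le_trans ltr01).
Qed.

Lemma disk_proj_scale (a : R) v : 1 <= a -> unit_sphere v -> disk_proj (a *: v) = v.
Proof.
rewrite /unit_sphere/= => a1 v1; have a0 : 0 < a by exact: lt_le_trans a1.
rewrite /disk_proj normsqZ v1 mulr1 sqrtr_sqr ger0_norm ?ltW// max_r//.
by rewrite scalerA mulVf ?scale1r// gt_eqF.
Qed.

Lemma disk_proj_continuous : continuous disk_proj.
Proof.
move=> v.
apply: (@continuousZ R _ _ (fun w : 'rV[R]_n => (Num.max 1 (Num.sqrt (normsq w)))^-1) id v); last exact: cvg_id.
apply: continuousV; first by rewrite gt_eqF// max_gt0.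
apply: (@continuous_max R 'rV[R]_n (fun=> 1) (fun w => Num.sqrt (normsq w)) v).
  exact: cst_continuous.
apply: (@continuous_comp 'rV[R]_n R R (@normsq R n) Num.sqrt).
  exact: normsq_continuous.
exact: sqrt_continuous.
Qed.

End NormSq.

(** * Finite subcomplexes as neighbourhood retracts *)

Section AttachCell.
Variables (R : realType).

(** [Y] is a retract of an open subset of a normed space with the Tietze property; for compact [Y]
    this yields neighbourhood extensions of maps from closed subsets of normal spaces. [E] is
    existential because attaching a cell adds coordinates. *)
Definition nbhd_retract (K : topologicalType) (Y : set K) :=
  exists (E : normedModType R) (k : K -> E) (r : E -> K) (O : set E),
    [/\ tietze E, {within Y, continuous k}, open O, k @` Y `<=` O &
      [/\ forall a, O a -> {for a, continuous r},
          forall a, O a -> Y (r a) & forall y, Y y -> r (k y) = y]].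

Variables (K : topologicalType) (n : nat) (chi : 'rV[R]_n -> K) (Y : set K).
Hypothesis hK : hausdorff_space K.
Hypothesis cchi : {within @closed_disk R n, continuous chi}.
Hypothesis chi_inj : forall v w, open_disk v -> open_disk w -> chi v = chi w -> v = w.
Hypothesis chiY : chi @` @unit_sphere R n `<=` Y.
Hypothesis chi_disj : forall v, open_disk v -> ~ Y (chi v).
Hypothesis cY : compact Y.

Let D := @closed_disk R n.
Let S := chi @` @open_disk R n `|` Y.

Let SE : S = chi @` D `|` Y.
Proof.
rewrite /S /D disk_split image_setU; apply/seteqP; split => x.
  by case=> ?; [left; left|right].
by case=> [[?|/chiY ?]|?]; [left|right|right].
Qed.

Lemma attach_compact : compact S.
Proof.
rewrite SE; apply: compactU => //; apply: compact_within_image cchi _.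
exact: closed_disk_compact.
Qed.

Section WithE.
Variables (E : normedModType R) (k : K -> E) (r : E -> K) (O : set E).
Hypothesis tE : tietze E.
Hypothesis ck : {within Y, continuous k}.
Hypothesis oO : open O.
Hypothesis kO : k @` Y `<=` O.
Hypothesis cr : forall a, O a -> {for a, continuous r}.
Hypothesis rY : forall a, O a -> Y (r a).
Hypothesis rk : forall y, Y y -> r (k y) = y.

Variable h : 'rV[R]_n -> E.
Hypothesis ch : continuous h.
Hypothesis hE : forall v, unit_sphere v -> h v = k (chi v).

Let T := (E * 'rV[R]_n * R)%type.

Let cell_coord (x : K) : 'rV[R]_n := xget 0 [set v | open_disk v /\ chi v = x].

(** On the cell the coordinates are an extension [h] of [k \o chi] from the sphere, the point [v]
    scaled by its depth, and the depth. The last two vanish on the boundary, which matches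
    [(k x, 0, 0)] on [Y]; inside the cell their quotient recovers [v]. *)
Let k' (x : K) : T :=
  if pselect (Y x) then (k x, 0, 0) else
  let v := cell_coord x in (h v, (1 - normsq v) *: v, 1 - normsq v).

Let k'_chi v : D v -> k' (chi v) = (h v, (1 - normsq v) *: v, 1 - normsq v).
Proof.
rewrite /D disk_split => -[ov|sv].
  rewrite /k'; case: pselect => [Yv|nY]; first by case: (chi_disj ov Yv).
  have -> : cell_coord (chi v) = v; last by [].
  rewrite /cell_coord; case: xgetP => [w _ [ow /chi_inj]|/(_ v)]; first exact.
  by case.
rewrite /k'; case: pselect => [Yv|nY]; last by case: nY; apply: chiY; exists v.
by have := sv; rewrite /unit_sphere/= => ->; rewrite subrr scale0r hE.
Qed.

Let k'Y x : Y x -> k' x = (k x, 0, 0).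
Proof. by rewrite /k'; case: pselect. Qed.

Let ck' : {within S, continuous k'}.
Proof.
rewrite SE; apply: withinU_continuous.
- apply: (compact_closed hK); apply: (compact_within_image cchi).
  exact: closed_disk_compact.
- exact: (compact_closed hK).
- apply: quotient_continuous => //; first exact: closed_disk_compact.
  apply: (@subspace_eq_continuous _ _ _
    (fun v => (h v, (1 - normsq v) *: v, 1 - normsq v) : T)).
    by move=> v /set_mem Dv; exact/esym/k'_chi.
  apply: continuous_subspaceT => v.
  have c1 : {for v, continuous (fun w : 'rV[R]_n => 1 - normsq w)}.
    by apply: for_sub; [exact: for_cst|exact: normsq_continuous].
  apply: (for_pair _ c1); apply: for_pair; first exact: ch.
  by apply: (for_scale c1); exact: for_id.
- apply: (@subspace_eq_continuous _ _ _ (fun x => (k x, 0, 0) : T)).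
    by move=> v /set_mem Yv; exact/esym/k'Y.
  apply: (within_comp_cts (g := fun a : E => (a, 0, 0) : T) ck) => a.
  apply: for_pair; last exact: for_cst.
  by apply: for_pair; [exact: for_id|exact: for_cst].
Qed.

(* A point [(a, w, s)] of [T] should be [k' (chi v)] with [v = yy p = w / |s|].
   [ee] is its distance to that point relative to the depth [|s|]: for small
   [ee] the point is sent into the cell, moved outwards as [ee] grows, and it
   reaches the boundary at [ee = 1]; from there on it is moved back to [r a]. *)
Let yy (p : T) : 'rV[R]_n := `|p.2|^-1 *: p.1.2.
Let ee (p : T) : R :=
  (`|p.1.1 - h (yy p)| + `|normsq (yy p) - (1 - `|p.2|)|) / `|p.2|.
Let zz (p : T) : 'rV[R]_n := disk_proj ((1 + ee p) *: yy p).
Let ll (p : T) : E := p.1.1 + Num.max 0 (2 - ee p) *: (h (zz p) - p.1.1).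

Let r' (p : T) : K :=
  if p.2 == 0 then r p.1.1 else if ee p <= 1 then chi (zz p) else r (ll p).

Let r'k' x : S x -> r' (k' x) = x.
Proof.
case=> [[v ov <-]|Yx]; last by rewrite k'Y// /r'/= eqxx rk.
have Dv : D v by exact: open_sub_disk.
have s0 : 0 < 1 - normsq v by rewrite subr_gt0.
have yE : yy (k' (chi v)) = v.
  by rewrite k'_chi// /yy/= scalerA (ger0_norm (ltW s0)) mulVf ?scale1r// gt_eqF.
have eE : ee (k' (chi v)) = 0.
  rewrite /ee yE k'_chi//= subrr normr0 add0r (ger0_norm (ltW s0)).
  by rewrite subKr subrr normr0 mul0r.
rewrite /r' eE ler01 /zz eE yE addr0 scale1r disk_proj_id//.
by rewrite k'_chi//= gt_eqF.
Qed.

Let fst1_cts (p : T) : {for p, continuous (fun q : T => q.1.1)}.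
Proof. by apply/for_fst/for_fst/for_id. Qed.

Let snd1_cts (p : T) : {for p, continuous (fun q : T => q.1.2)}.
Proof. by apply/for_snd/for_fst/for_id. Qed.

Let ss_cts (p : T) : {for p, continuous (fun q : T => `|q.2|)}.
Proof. by apply/for_norm/for_snd/for_id. Qed.

Let yy_cts (p : T) : p.2 != 0 -> {for p, continuous yy}.
Proof.
move=> p0; apply: for_scale; last exact: snd1_cts.
by apply: for_inv; [rewrite normr_eq0|exact: ss_cts].
Qed.

Let ee_cts (p : T) : p.2 != 0 -> {for p, continuous ee}.
Proof.
move=> p0; apply: for_mul; last by apply: for_inv; [rewrite normr_eq0|exact: ss_cts].
have cy := yy_cts p0.
apply: for_add; apply: for_norm; apply: for_sub.
- exact: fst1_cts.
- by apply: (for_comp cy); exact: ch.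
- by apply: (for_comp cy); exact: normsq_continuous.
- by apply: for_sub; [exact: for_cst|exact: ss_cts].
Qed.

Let zz_cts (p : T) : p.2 != 0 -> {for p, continuous zz}.
Proof.
move=> p0.
apply: (for_comp (f := fun q => (1 + ee q) *: yy q) (g := @disk_proj R n)); last first.
  exact: disk_proj_continuous.
apply: for_scale; last exact: yy_cts.
by apply: for_add; [exact: for_cst|exact: ee_cts].
Qed.

Let ll_cts (p : T) : p.2 != 0 -> {for p, continuous ll}.
Proof.
move=> p0; apply: for_add; first exact: fst1_cts.
apply: for_scale.
  apply: for_max; first exact: for_cst.
  by apply: for_sub; [exact: for_cst|exact: ee_cts].
apply: for_sub; last exact: fst1_cts.
by apply: (for_comp (zz_cts p0)); exact: ch.
Qed.

Let chizz_cts (p : T) : p.2 != 0 -> {for p, continuous (fun q => chi (zz q))}.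
Proof.
move=> p0 W /= nW; have := (withinP _ _).1 cchi (zz p) (disk_proj_in _) W nW.
move=> /(zz_cts p0); rewrite !nbhs_simpl/=.
by apply: filterS => q; apply; exact: disk_proj_in.
Qed.

Let near_neq0 (p : T) : p.2 != 0 -> \forall q \near p, q.2 != 0.
Proof.
move=> p0; have : \forall q \near p, 0 < `|q.2|.
  by apply: near_lt; [exact: for_cst|exact: ss_cts|rewrite normr_gt0].
by apply: filterS => q; rewrite normr_gt0.
Qed.

Let good (p : T) := {for p, continuous r'} /\ S (r' p).

Let good_in (p : T) : p.2 != 0 -> ee p < 1 -> good p.
Proof.
move=> p0 e1; split; last first.
  rewrite /r' (negbTE p0) (ltW e1) SE; left.
  by exists (zz p) => //; exact: disk_proj_in.
move=> W; rewrite {1}/r' (negbTE p0) (ltW e1) => /(chizz_cts p0).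
rewrite !nbhs_simpl/= => nW.
have near_e : \forall q \near p, ee q < 1.
  by apply: near_lt; [exact: ee_cts|exact: for_cst|].
near=> q; rewrite /= /r'.
have -> : (q.2 == 0) = false by apply/negbTE; near: q; exact: near_neq0.
have -> : ee q <= 1 by apply: ltW; near: q.
by near: q.
Unshelve. all: by end_near. Qed.

Let good_out (p : T) : p.2 != 0 -> `|p.2| < 8^-1 -> 1 <= ee p -> O (ll p) -> good p.
Proof.
move=> p0 p8 e1 Ol; split; last first.
  rewrite /r' (negbTE p0) SE; case: ifPn => _.
    by left; exists (zz p) => //; exact: disk_proj_in.
  by right; exact: rY.
have s0 : 0 < `|p.2| by rewrite normr_gt0.
have rl : {for p, continuous (fun q => r (ll q))}.
  by apply: (for_comp (ll_cts p0)); exact: cr.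
move=> W nW; rewrite nbhs_simpl/=.
have nrl : \forall q \near p, W (r (ll q)).
  apply: rl; move: nW; rewrite /r' (negbTE p0); case: ifPn => // e1'.
  have {e1 e1'}e1 : ee p = 1 by apply/eqP; rewrite eq_le e1' e1.
  (* For [ee p = 1] and depth below 1/8, [normsq (yy p)] exceeds 3/4, so the doubled vector lies
     outside the disk and projects to the sphere. There [ll p] is [h (zz p)], and [r] maps it to
     [chi (zz p)]: the two formulas for [r'] agree. *)
  have zS : unit_sphere (zz p).
    apply: disk_proj_sphere; rewrite normsqZ e1.
    have : `|normsq (yy p) - (1 - `|p.2|)| <= `|p.2|.
      move: e1; rewrite /ee => /(congr1 (fun x => x * `|p.2|)).
      rewrite mul1r mulfVK ?gt_eqF// => eS.
      by rewrite -[leRHS]eS lerDr.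
    rewrite ler_norml => /andP[h1 _]; lra.
  have -> : r (ll p) = chi (zz p); last by [].
  rewrite /ll e1 (_ : 2 - 1 = 1); last by ring.
  rewrite max_r// scale1r addrCA subrr addr0 hE// rk//.
  by apply: chiY; exists (zz p).
have near_0 := near_neq0 p0.
have [e1'|e1'] := ltP 1 (ee p).
  have near_e : \forall q \near p, 1 < ee q.
    by apply: near_lt; [exact: for_cst|exact: ee_cts|].
  near=> q; rewrite /= /r'.
  have -> : (q.2 == 0) = false by apply/negbTE; near: q.
  have -> : (ee q <= 1) = false by apply/negbTE; rewrite -ltNge; near: q.
  by near: q.
have nchi : \forall q \near p, W (chi (zz q)).
  by apply: chizz_cts => //; move: nW; rewrite /r' (negbTE p0) e1'.
near=> q; rewrite /= /r'.
have -> : (q.2 == 0) = false by apply/negbTE; near: q.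
by case: ifPn => _; near: q.
Unshelve. all: by end_near. Qed.

(** As the depth tends to 0, [yy q] need not converge. The bound on [ee q] keeps the pair of [yy q]
    and [1 + ee q] in a compact set, and a limit [(v, m)] compatible with the estimates has [v] on
    the sphere and [h v = p.1.1], hence [chi v = r p.1.1]. A covering argument over the possible
    limits replaces convergence. *)
Let near_boundary (p : T) B W : p.2 = 0 -> O p.1.1 ->
  nbhs p.1.1 B -> nbhs (r p.1.1) W ->
  \forall q \near p, q.2 != 0 -> ee q <= 2 -> B (h (zz q)) /\ W (chi (zz q)).
Proof.
move=> p0 Op nB nW.
have /compact_near_coveringP/near_covering_withinP cov :
    compact ([set v : 'rV[R]_n | normsq v <= 2] `*` `[1, 3 : R]%classic).
  by apply: compact_setX; [exact: normsq_ball_compact|exact: segment_compact].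
pose P (q : T) (x : 'rV[R]_n * R) :=
  q.2 != 0 -> `|q.1.1 - h x.1| <= 2 * `|q.2| ->
  `|normsq x.1 - (1 - `|q.2|)| <= 2 * `|q.2| ->
  B (h (disk_proj (x.2 *: x.1))) /\ W (chi (disk_proj (x.2 *: x.1))).
have key : forall x, ([set v : 'rV[R]_n | normsq v <= 2] `*` `[1, 3 : R]%classic) x ->
    \forall x' \near x & q \near p,
      ([set v : 'rV[R]_n | normsq v <= 2] `*` `[1, 3 : R]%classic) x' -> P q x'.
  move=> [v m] [/= v2 m13].
  have cfar (f : ('rV[R]_n * R) * T -> R) : {for ((v, m), p), continuous f} ->
      0 < f ((v, m), p) ->
      (forall x q, 0 < f (x, q) -> P q x) ->
      \forall x' \near (v, m) & q \near p,
      ([set v : 'rV[R]_n | normsq v <= 2] `*` `[1, 3 : R]%classic) x' -> P q x'.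
    move=> cf f0 fP.
    have : \forall z \near ((v, m), p), 0 < f z.
      by apply: near_lt; [exact: for_cst|exact: cf|].
    by apply: filterS => -[x q] /= fxq _; exact: fP.
  have c1 : {for ((v, m), p), continuous (fun z : ('rV[R]_n * R) * T => z.1.1)}.
    exact/for_fst/for_fst/for_id.
  have c3 : {for ((v, m), p), continuous (fun z : ('rV[R]_n * R) * T => z.2.1.1)}.
    exact/for_fst/for_fst/for_snd/for_id.
  have c4 : {for ((v, m), p), continuous (fun z : ('rV[R]_n * R) * T => 2 * `|z.2.2|)}.
    by apply: for_mul; [exact: for_cst|exact/for_norm/for_snd/for_snd/for_id].
  have [nv|nv] := eqVneq (normsq v) 1; last first.
    apply: (cfar (fun z => `|normsq z.1.1 - (1 - `|z.2.2|)| - 2 * `|z.2.2|)).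
    - apply: (for_sub _ c4); apply: for_norm; apply: for_sub.
        by apply: (for_comp c1); exact: normsq_continuous.
      by apply: for_sub; [exact: for_cst|exact/for_norm/for_snd/for_snd/for_id].
    - by rewrite /= p0 normr0 mulr0 !subr0 normr_gt0 subr_eq0.
    - by move=> x q /=; rewrite subr_gt0 ltNge => /negP.
  have [hv|hv] := eqVneq (p.1.1) (h v); last first.
    apply: (cfar (fun z => `|z.2.1.1 - h z.1.1| - 2 * `|z.2.2|)).
    - apply: (for_sub _ c4); apply: for_norm; apply: for_sub; first exact: c3.
      by apply: (for_comp c1); exact: ch.
    - by rewrite /= p0 normr0 mulr0 !subr0 normr_gt0 subr_eq0.
    - by move=> x q /=; rewrite subr_gt0 ltNge => /negP.
  have vS : unit_sphere v by [].
  have m1 : 1 <= m by move: m13; rewrite in_itv/= => /andP[].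
  have cz : {for (v, m), continuous (fun x : 'rV[R]_n * R => disk_proj (x.2 *: x.1))}.
    apply: (for_comp (Y := 'rV[R]_n) (f := fun x : 'rV[R]_n * R => x.2 *: x.1)); last first.
      exact: disk_proj_continuous.
    by apply: for_scale; [exact/for_snd/for_id|exact/for_fst/for_id].
  have dE : disk_proj (m *: v) = v by exact: disk_proj_scale.
  have nB' : \forall x \near (v, m), B (h (disk_proj (x.2 *: x.1))).
    have chz : {for (v, m), continuous (fun x : 'rV[R]_n * R => h (disk_proj (x.2 *: x.1)))}.
      by apply: (for_comp cz); exact: ch.
    have := chz B; rewrite /continuous_at /= dE -hv => /(_ nB).
    by rewrite nbhs_simpl.
  have nW' : \forall x \near (v, m), W (chi (disk_proj (x.2 *: x.1))).
    have Dv : D v by exact: sphere_sub_disk.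
    have := (withinP _ _).1 cchi v Dv W.
    have -> : chi v = r p.1.1 by rewrite hv hE// rk//; apply: chiY; exists v.
    move=> /(_ nW); have := cz; rewrite /prop_for /continuous_at /= dE => cz' /cz'.
    rewrite nbhs_simpl/=.
    by apply: filterS => x; apply; exact: disk_proj_in.
  near=> x q.
  have h1 : B (h (disk_proj (x.2 *: x.1))) by near: x.
  have h2 : W (chi (disk_proj (x.2 *: x.1))) by near: x.
  by move=> _ _ _ _.
have covP := cov _ _ P (nbhs_filter p) key.
have near8 : \forall q \near p, `|q.2| < 8^-1.
  by apply: near_lt; [exact: ss_cts|exact: for_cst|rewrite p0 normr0 invr_gt0].
near=> q => q0 e2.
have s0 : 0 < `|q.2| by rewrite normr_gt0.
have : `|q.1.1 - h (yy q)| + `|normsq (yy q) - (1 - `|q.2|)| <= 2 * `|q.2|.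
  by move: e2; rewrite /ee ler_pdivrMr.
have := normr_ge0 (q.1.1 - h (yy q)).
have := normr_ge0 (normsq (yy q) - (1 - `|q.2|)).
move=> g1 g2 g3.
have q8 : `|q.2| < 8^-1 by near: q.
have : P q (yy q, 1 + ee q).
  have : [set v : 'rV[R]_n | normsq v <= 2] `*` `[1, 3 : R]%classic `<=` P q.
    by near: q; exact: covP.
  apply; split => /=; last first.
    rewrite in_itv/=; apply/andP; split; last by lra.
    by rewrite lerDl divr_ge0// addr_ge0.
  have : `|normsq (yy q) - (1 - `|q.2|)| <= 2 * `|q.2| by lra.
  by rewrite ler_norml => /andP[_ ?]; lra.
apply => //=; lra.
Unshelve. all: by end_near. Qed.

(** Balls are convex: [ll q] lies on the segment from [q.1.1] to [h (zz q)], and it is [q.1.1]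
    itself as soon as [ee q >= 2]. *)
Let near_bd_lerp (p : T) (B : set E) : p.2 = 0 -> O p.1.1 -> nbhs p.1.1 B ->
  \forall q \near p, q.2 != 0 -> 1 <= ee q -> B (ll q).
Proof.
move=> p0 Op /nbhs_ballP[e /= e0 eB].
have nb : nbhs p.1.1 (ball p.1.1 e) by exact: nbhsx_ballx.
have h1 := near_boundary p0 Op nb filterT.
have h2 : \forall q \near p, ball p.1.1 e q.1.1 by exact: (fst1_cts nb).
near=> q => q0 e1; apply: eB.
have hq : ball p.1.1 e q.1.1 by near: q.
have [e2|e2] := leP 2 (ee q).
  by rewrite /ll max_l ?subr_le0// scale0r addr0.
have bz : ball p.1.1 e (h (zz q)).
  have : q.2 != 0 -> ee q <= 2 -> ball p.1.1 e (h (zz q)) /\ setT (chi (zz q)).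
    by near: q; exact: h1.
  by move=> /(_ q0 (ltW e2))[].
move: hq bz; rewrite -!ball_normE /ball_/= => hq bz.
rewrite /ll max_r ?subr_ge0 ?ltW//; set t := 2 - ee q.
have t01 : 0 <= t <= 1 by rewrite /t; apply/andP; split; lra.
clearbody t.
have -> : p.1.1 - (q.1.1 + t *: (h (zz q) - q.1.1)) =
    (1 - t) *: (p.1.1 - q.1.1) + t *: (p.1.1 - h (zz q)).
  move: (p.1.1) (q.1.1) (h (zz q)) => a b c.
  rewrite opprD addrA -scalerN opprB scalerBl scale1r -[RHS]addrA; congr (_ + _).
  by rewrite [RHS]addrC -scalerBr opprB [in RHS]addrC addrA subrK.
apply: (le_lt_trans (ler_normD _ _)); rewrite !normrZ.
move/andP: t01 => [t0 t1].
rewrite (ger0_norm t0) ger0_norm ?subr_ge0//.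
have hM : (1 - t) * `|p.1.1 - q.1.1| <= (1 - t) * Num.max `|p.1.1 - q.1.1| `|p.1.1 - h (zz q)|.
  by rewrite ler_wpM2l ?subr_ge0// le_max lexx.
have hM' : t * `|p.1.1 - h (zz q)| <= t * Num.max `|p.1.1 - q.1.1| `|p.1.1 - h (zz q)|.
  by rewrite ler_wpM2l// le_max lexx orbT.
apply: (le_lt_trans (lerD hM hM')); rewrite -mulrDl subrK mul1r.
by rewrite gt_max hq.
Unshelve. all: by end_near. Qed.

Let good_bd (p : T) : p.2 = 0 -> O p.1.1 -> good p.
Proof.
move=> p0 Op; have r'p : r' p = r p.1.1 by rewrite /r' p0 eqxx.
split; last by rewrite r'p; right; exact: rY.
move=> W; rewrite r'p => nW; rewrite nbhs_simpl/=.
have nrW := cr Op nW; rewrite nbhs_simpl/= in nrW.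
have h1 := near_boundary p0 Op nrW nW.
have h2 := near_bd_lerp p0 Op nrW.
have h3 : \forall q \near p, W (r q.1.1) by exact: (fst1_cts nrW).
near=> q; rewrite /= /r'; case: ifPn => q0; first by near: q.
case: ifPn => e1.
  have : q.2 != 0 -> ee q <= 2 -> W (r (h (zz q))) /\ W (chi (zz q)).
    by near: q; exact: h1.
  by move=> /(_ q0)[]//; rewrite (le_trans e1)// ler1n.
have : q.2 != 0 -> 1 <= ee q -> W (r (ll q)) by near: q; exact: h2.
by apply => //; rewrite ltW// ltNge.
Unshelve. all: by end_near. Qed.

Lemma attach_nbhd_retract_aux : nbhd_retract S.
Proof.
(* The open set is simply the interior of the set of good points; what has to be seen is that all
   points near the image of [k'] are good. *)
exists (E * 'rV[R]_n * R)%type, k', r', (interior [set p | good p]); split.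
- by apply: tietze_prod; [apply: tietze_prod => //; exact: tietze_rV|exact: tietze_R].
- exact: ck'.
- exact: open_interior.
- move=> _ [x Sx <-]; rewrite /interior/=; case: Sx => [[v ov <-]|Yx].
    have Dv : D v by exact: open_sub_disk.
    have s0 : 0 < 1 - normsq v by rewrite subr_gt0.
    have p0 : (k' (chi v)).2 != 0 by rewrite k'_chi//= gt_eqF.
    have eE : ee (k' (chi v)) = 0.
      have yE : yy (k' (chi v)) = v.
        by rewrite k'_chi// /yy/= scalerA (ger0_norm (ltW s0)) mulVf ?scale1r// gt_eqF.
      rewrite /ee yE k'_chi//= subrr normr0 add0r (ger0_norm (ltW s0)).
      by rewrite subKr subrr normr0 mul0r.
    have n1 : \forall q \near k' (chi v), ee q < 1.
      by apply: near_lt; [exact: ee_cts|exact: for_cst|rewrite eE].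
    have n2 := near_neq0 p0.
    by near=> q; apply: good_in; near: q.
  have p0 : (k' x).2 = 0 by rewrite k'Y.
  have Op : O (k' x).1.1 by rewrite k'Y//=; apply: kO; exists x.
  have nO : nbhs (k' x).1.1 O by exact: open_nbhs_nbhs.
  have n1 : \forall q \near k' x, O q.1.1 by exact: (fst1_cts nO).
  have n2 := near_bd_lerp p0 Op nO.
  have n3 : \forall q \near k' x, `|q.2| < 8^-1.
    by apply: near_lt; [exact: ss_cts|exact: for_cst|rewrite p0 normr0 invr_gt0].
  near=> q; have [q0|q0] := eqVneq q.2 0; first by apply: good_bd => //; near: q.
  have [e1|e1] := ltP (ee q) 1; first exact: good_in.
  apply: good_out => //; first by near: q.
  have : q.2 != 0 -> 1 <= ee q -> O (ll q) by near: q; exact: n2.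
  exact.
- split=> [a /nbhs_singleton[]//|a /nbhs_singleton[]//|].
  exact: r'k'.
Unshelve. all: by end_near. Qed.

End WithE.

Lemma attach_nbhd_retract : nbhd_retract Y -> nbhd_retract S.
Proof.
case=> E [k [r [U [tE ck oO kO [cr rY rk]]]]].
have cks : {within @unit_sphere R n, continuous (k \o chi)}.
  apply/within_cvgP => v Sv.
  have Yv : Y (chi v) by apply: chiY; exists v.
  move=> W nW; have := (withinP _ _).1 ck (chi v) Yv W nW.
  move=> /((withinP _ _).1 cchi v (sphere_sub_disk Sv)).
  rewrite !nbhs_simpl/=; apply: filterS => w /[swap] Sw /(_ (sphere_sub_disk Sw)).
  by apply; apply: chiY; exists w.
have cpt : compact ((k \o chi) @` @unit_sphere R n).
  apply: compact_within_image => //.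
  apply: subclosed_compact (@closed_disk_compact R n) _.
    exact: unit_sphere_closed.
  exact: sphere_sub_disk.
have [M [_ /(_ (M + 1))]] := compact_bounded cpt.
rewrite ltrDl ltr01 => /(_ erefl) bM.
have bk : exists N, forall v : 'rV[R]_n, unit_sphere v -> `|(k \o chi) v| <= N.
  by exists (M + 1) => v Sv; apply: bM; exists v.
have [h ch hE] := tE _ (@pseudometric_normal R 'rV[R]_n) _ _ (@unit_sphere_closed R n) cks bk.
exact: (attach_nbhd_retract_aux tE ck oO kO cr rY rk ch).
Qed.

End AttachCell.

(** Tietze extends [k \o f] into the normed space, and [r] brings the extension back to [Y] where it
    stays in the open set. *)
Lemma nbhd_retract_extend (R : realType) (K : topologicalType) (Y : set K)
    (X : topologicalType) (A : set X) (f : X -> K) :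
  nbhd_retract R Y -> compact Y -> normal_space X -> closed A ->
  {within A, continuous f} -> f @` A `<=` Y ->
  exists (g : X -> K) (U : set X),
    [/\ open U, A `<=` U, (forall x, U x -> {for x, continuous g}),
        g @` U `<=` Y & forall x, A x -> g x = f x].
Proof.
move=> [E [k [r [V [tE ck oV kV [cr rY rk]]]]]] cpt nX cA cf fA.
have ckf : {within A, continuous (fun x => k (f x))} by exact: (within_comp cf fA ck).
have [M [_ /(_ (M + 1))]] := compact_bounded (compact_within_image ck cpt).
rewrite ltrDl ltr01 => /(_ erefl) bM.
have bk : exists N, forall x, A x -> `|k (f x)| <= N.
  exists (M + 1) => x Ax; apply: bM; exists (f x) => //.
  by apply: fA; exists x.
have [h ch hE] := tE _ nX _ _ cA ckf bk.
exists (fun x => r (h x)), (h @^-1` V); split.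
- by apply: open_comp => // x _; exact: ch.
- by move=> x Ax; rewrite /= hE//; apply: kV; exists (f x) => //; apply: fA; exists x.
- by move=> x Vx; apply: (for_comp (ch x)); exact: cr.
- by move=> _ [x Vx <-]; exact: rY.
- by move=> x Ax; rewrite hE// rk//; apply: fA; exists x.
Qed.

(** * Compact subsets of CW complexes *)

Section Subcomplexes.
Variables (R : realType) (K : CWcomplex R).
Implicit Types (c d : cw_cell K) (s : seq (cw_cell K)).

Definition ocell c : set K := @cw_char R K c @` @open_disk R (cw_dim c).
Definition ccell c : set K := @cw_char R K c @` @closed_disk R (cw_dim c).

Definition carrier s : set K := [set x | exists2 c, List.In c s & ocell c x].

(* The head of the list is the cell attached last. *)
Fixpoint buildable s : Prop :=
  if s is c :: s' then
    [/\ ~ List.In c s',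
        @cw_char R K c @` @unit_sphere R (cw_dim c) `<=` carrier s' &
        buildable s']
  else True.

Lemma carrier_nil : carrier [::] = set0.
Proof. by apply/seteqP; split => x // [c []]. Qed.

Lemma carrier_cons c s : carrier (c :: s) = ocell c `|` carrier s.
Proof.
apply/seteqP; split => x.
  by case=> d [<-|ds] dx; [left|right; exists d].
by case=> [cx|[d ds dx]]; [exists c => //; left|exists d => //; right].
Qed.

Lemma ocell_disj c d x : ocell c x -> ocell d x -> c = d.
Proof.
move=> cx dx; apply: (@cw_disjoint R K c d) => //.
by exists x.
Qed.

Lemma ocell_cover (x : K) : exists c, ocell c x.
Proof.
have : [set: K] x by [].
by rewrite -cw_cover => -[c _ cx]; exists c.
Qed.

Lemma char_inj c v w : open_disk v -> open_disk w ->
  @cw_char R K c v = @cw_char R K c w -> v = w.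
Proof.
move=> ov ow e; have [_ inj _] := @cw_homeo R K c.
have := inj (SigSub (mem_set ov)) (SigSub (mem_set ow)) e.
by move=> /(congr1 val).
Qed.

Lemma ccell_compact c : compact (ccell c).
Proof.
by apply: compact_within_image; [exact: cw_cont|exact: closed_disk_compact].
Qed.

Lemma buildable_retract (x0 : K) s : buildable s ->
  compact (carrier s) /\ nbhd_retract R (carrier s).
Proof.
elim: s => [_|c s IH [cs cb /IH[cpt ret]]].
  rewrite carrier_nil; split; first exact: compact0.
  exists (R : normedModType R), (fun=> 0), (fun=> x0), set0; split => //.
  - exact: tietze_R.
  - exact: continuous_subspace0.
  - by move=> x [y []].
rewrite carrier_cons.
have disj v : open_disk v -> ~ carrier s (@cw_char R K c v).
  move=> ov [d ds dv]; apply: cs.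
  by rewrite (@ocell_disj c d (@cw_char R K c v))//; exists v.
split.
  by apply: attach_compact => //; exact: cw_cont.
apply: attach_nbhd_retract => //.
- exact: cw_hausdorff.
- exact: cw_cont.
- exact: char_inj.
Qed.

(** Induction on the dimension: the boundary of [c] is covered by finitely many cells of lower
    dimension, which are attached first. *)
Lemma buildable_cell c s : buildable s ->
  exists s', [/\ buildable s', (forall d, List.In d s -> List.In d s') & List.In c s'].
Proof.
move: {2}(cw_dim c).+1 (ltnSn (cw_dim c)) => m.
elim: m c s => // m IH c s cm bs.
have [cs|cs] := pselect (List.In c s); first by exists s.
have [F [fF Fdim Fb]] := cw_boundary c.
have [l lF] : exists l : seq (cw_cell K), forall d, F d <-> List.In d l.
  have /finite_seqP[l lF] := fF : finite_set (F : set {classic cw_cell K}).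
  exists l => d; rewrite lF /=; elim: l {lF} => //= e l <-.
  rewrite inE; split => [/orP[/eqP ->|]|[->|->]]; [by left|by right|by rewrite eqxx|by rewrite orbT].
have [t [bt st lt]] : exists t, [/\ buildable t,
    (forall d, List.In d s -> List.In d t) & (forall d, List.In d l -> List.In d t)].
  have {lF}: forall d, List.In d l -> (cw_dim d < m)%N.
    by move=> d /lF /Fdim dc; rewrite (leq_trans dc).
  elim: l => [_|d l IHl dm]; first by exists s; split.
  have [|t [bt st lt]] := IHl; first by move=> e el; apply: dm; right.
  have [t' [bt' tt' dt']] := IH d t (dm d (or_introl erefl)) bt.
  exists t'; split => // [e es|e [<-//|el]]; first exact/tt'/st.
  exact/tt'/lt.
have [ct|ct] := pselect (List.In c t); first by exists t.
exists (c :: t); split => [|d ds|]; [|by right; exact: st|by left].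
split => // x /Fb[d Fd dx]; exists d => //.
exact/lt/lF.
Qed.

Lemma buildable_cells (l : seq (cw_cell K)) :
  exists2 s, buildable s & forall d, List.In d l -> List.In d s.
Proof.
elim: l => [|c l [s bs ls]]; first by exists [::].
have [t [bt st ct]] := buildable_cell c bs.
by exists t => // d [<-//|dl]; exact/st/ls.
Qed.

(** Choose a point of [C] in each open cell that [C] meets. All sets of chosen points are closed, so
    the complements of all chosen points but one form an open cover of [C], and a finite subcover
    leaves only finitely many cells. *)
Lemma compact_sub_carrier (C : set K) : compact C ->
  exists2 s, buildable s & C `<=` carrier s.
Proof.
move=> cC.
suff [l Cl] : exists l : seq (cw_cell K), C `<=` carrier l.
  have [s bs ls] := buildable_cells l; exists s => // x /Cl[c cl cx].
  by exists c => //; exact: ls.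
pose met := [set c | exists x, C x /\ ocell c x].
have /choice[pt ptP] : forall c, exists x, met c -> C x /\ ocell c x.
  move=> c; have [[x xP]|nc] := pselect (met c); first by exists x.
  by exists (@cw_char R K c 0).
have pt_inj c d : met c -> met d -> pt c = pt d -> c = d.
  move=> /ptP[_ cc] /ptP[_ dd] e; apply: (@ocell_disj c d (pt c)) => //.
  by rewrite e.
(* By closure-finiteness a closed cell contains only finitely many chosen points, so the weak
   topology makes every set of them closed. *)
have closedQ (Q : set (cw_cell K)) : closed [set pt c | c in met `&` Q].
  apply: cw_weak => c.
  have [F [fF _ Fb]] := cw_boundary c.
  have fin : finite_set [set pt d | d in met `&` (F `|` [set c])].
    apply: finite_image; apply: finite_setIr; rewrite finite_setU; split; first exact: fF.
    exact: finite_set1.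
  set A := [set pt c | c in met `&` Q].
  have ccl : closed (A `&` ccell c).
    apply: (compact_closed (@cw_hausdorff R K)); apply: finite_compact.
    apply: sub_finite_set fin => x [[d [md Qd] <-] [v Dv ve]].
    exists d => //; split => //; have [_ dd] := ptP d md.
    move: Dv; rewrite disk_split => -[ov|sv].
      by right; apply: (@ocell_disj d c (pt d)) => //; exists v.
    left; have : (\bigcup_(d in F) ocell d) (pt d) by apply: Fb; exists v.
    by case=> e Fe ee; rewrite (@ocell_disj d e (pt d)).
  have cD : closed (@closed_disk R (cw_dim c)).
    by apply: (compact_closed (@norm_hausdorff _ _)); exact: closed_disk_compact.
  have := (within_closedP _ cD).1 (@cw_cont R K c) _ ccl.
  rewrite (_ : _ `&` _ = closed_disk (n := cw_dim c) `&` @cw_char R K c @^-1` A)//.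
  apply/seteqP; split => v [Dv]; first by case.
  by move=> Av; split => //; split => //; exists v.
have [[c0 mc0]|nm] := pselect (exists c, met c); last first.
  exists [::] => x Cx; exfalso; apply: nm.
  by have [c cx] := ocell_cover x; exists c, x.
have [||l Cl] := @compact_finite_subcover _ C _
  (fun c => ~` [set pt d | d in met `&` [set d | d <> c]]) cC.
- by move=> c; apply: closed_openC; exact: closedQ.
- move=> x Cx; have [[c mc ptx]|nx] := pselect (exists2 c, met c & pt c = x).
    exists c => -[d [md dc] dx]; apply: dc; apply: pt_inj => //.
    by rewrite dx.
  by exists c0 => -[d [md _] dx]; apply: nx; exists d.
exists l => x Cx; have [c cx] := ocell_cover x; exists c => //.
have mc : met c by exists x.
have [|d dl nd] := Cl (pt c); first by have [] := ptP c mc.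
suff -> : c = d by [].
by apply: contrapT => cd; apply: nd; exists c.
Qed.

Lemma carrier_extend s (X : topologicalType) (A : set X) (f : X -> K) :
  buildable s -> normal_space X -> closed A -> {within A, continuous f} ->
  f @` A `<=` carrier s ->
  exists (g : X -> K) (U : set X),
    [/\ open U, A `<=` U, (forall x, U x -> {for x, continuous g}),
        g @` U `<=` carrier s & forall x, A x -> g x = f x].
Proof.
move=> bs nX cA cf fA.
have [[x0 _]|nX0] := pselect (exists x : X, True); last first.
  exists f, setT; split => //; first exact: openT.
  - by move=> x _; exfalso; apply: nX0; exists x.
  - by move=> y [x _ _]; exfalso; apply: nX0; exists x.
have [cpt nr] := buildable_retract (f x0) bs.
exact: nbhd_retract_extend nr cpt nX cA cf fA.
Qed.

Lemma compact_extend (X : topologicalType) (A : set X) (f : X -> K) :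
  normal_space X -> closed A -> compact A -> {within A, continuous f} ->
  exists (g : X -> K) (U : set X),
    [/\ open U, A `<=` U, (forall x, U x -> {for x, continuous g}) &
        forall x, A x -> g x = f x].
Proof.
move=> nX clA cA cf.
have [s bs fs] := compact_sub_carrier (compact_within_image cf cA).
have [g [U [oU AU cg _ gf]]] := carrier_extend bs nX clA cf fs.
by exists g, U.
Qed.

End Subcomplexes.

(** * Absolute extensors and homotopy extension *)

Section AbsoluteExtensors.

Lemma AE_extend (L X : topologicalType) (A : set X) (f : X -> L) :
  absolute_extensor L X -> closed A -> {within A, continuous f} ->
  exists2 g : X -> L, continuous g & forall x, A x -> g x = f x.
Proof.
move=> ae cA cf; have [g cg gf] := ae A cA (sigL A f) ((subspace_sigL_continuousP _ _).1 cf).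
exists g => // x Ax; exact: (gf (SigSub (mem_set Ax))).
Qed.

Lemma AE_intro (L X : topologicalType) : (exists l : L, True) ->
  (forall (A : set X) (f : X -> L), closed A -> {within A, continuous f} ->
    exists2 g : X -> L, continuous g & forall x, A x -> g x = f x) ->
  absolute_extensor L X.
Proof.
move=> [l _] ext A cA f cf.
have [g cg gf] := ext A (valL_ l f) cA ((subspace_valL_continuousP' _ l f).2 cf).
exists g => // a; rewrite gf; last exact: set_valP.
by have := congr1 (fun h => h a) (valLK l f).
Qed.

(** Extending the empty map over a nonempty space produces a point of [L]. *)
Lemma AE_closed_image (L : topologicalType) (X : topologicalType) :
  absolute_extensor L X -> (exists x : X, True) -> exists l : L, True.
Proof.
move=> ae [x _].
have [|g _ _] := ae set0 closed0 (fun a => False_rect L (set_valP a)).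
  by move=> a; case: (set_valP a).
by exists (g x).
Qed.

Definition unit_interval (R : realType) := set_type `[0, 1 : R]%classic.

Lemma unit_interval_compact (R : realType) : compact [set: unit_interval R].
Proof. by apply: compact_setType; exact: segment_compact. Qed.

Lemma unit_interval_hausdorff (R : realType) : hausdorff_space (unit_interval R).
Proof. by apply: hausdorff_setType; exact: Rhausdorff. Qed.

Lemma hausdorff_prod (X Y : topologicalType) :
  hausdorff_space X -> hausdorff_space Y -> hausdorff_space (X * Y)%type.
Proof.
move=> hX hY [a b] [c d] cl; congr pair.
  apply: hX => P Q nP nQ.
  have [] := cl (fst @^-1` P) (fst @^-1` Q).
  - exact: (@fst_cts _ _ (a, b) P nP).
  - exact: (@fst_cts _ _ (c, d) Q nQ).
  by move=> [x y] [Px Qx]; exists x.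
apply: hY => P Q nP nQ.
have [] := cl (snd @^-1` P) (snd @^-1` Q).
- exact: (@snd_cts _ _ (a, b) P nP).
- exact: (@snd_cts _ _ (c, d) Q nQ).
by move=> [x y] [Px Qx]; exists y.
Qed.

(** Borsuk's argument. On the part of [X * I] over [A] and at time 0 the homotopy and [u] fit
    together; compactness extends this map to a neighbourhood. A Urysohn function supplies a time
    for each point, 1 on [A] and 0 where the neighbourhood does not contain the whole vertical
    segment. *)
Lemma homotopy_extension (R : realType) (K : CWcomplex R) (X : topologicalType)
    (A : set X) (f u : X -> K) (H : K * R -> K) :
  compact [set: X] -> hausdorff_space X -> closed A ->
  {within A, continuous f} -> continuous u ->
  {within [set: K] `*` `[0, 1], continuous H} ->
  (forall x, A x -> H (f x, 0) = u x) -> (forall k, H (k, 1) = k) ->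
  exists2 g : X -> K, continuous g & forall x, A x -> g x = f x.
Proof.
move=> cX hX cA cf cu cH H0 H1.
pose I := unit_interval R.
pose Z := (X * I)%type.
have cZ : compact [set: Z].
  by rewrite -setXTT; apply: compact_setX => //; exact: unit_interval_compact.
have hZ : hausdorff_space Z by apply: hausdorff_prod => //; exact: unit_interval_hausdorff.
have nZ : normal_space Z by exact: compact_normal.
have nX : normal_space X by exact: compact_normal.
have m01 (t : R) : 0 <= t <= 1 -> t \in `[0, 1 : R]%classic.
  by move=> ht; apply/mem_set; rewrite /= in_itv.
have t01 (t : I) : 0 <= set_val t <= 1.
  by have := set_valP t; rewrite /= in_itv.
have cval : continuous (set_val : I -> R) by exact: initial_continuous.
pose F (z : Z) := if pselect (A z.1) then H (f z.1, set_val z.2) else u z.1.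
pose E1 := [set z : Z | A z.1]; pose E0 := [set z : Z | set_val z.2 = 0 :> R].
have cE1 : closed E1 by apply: (@closed_comp Z X fst A) => // z _; exact: fst_cts.
have cE0 : closed E0.
  apply: (@closed_comp Z R (fun z => set_val z.2) [set t | t = 0]); last exact: closed_eq.
  by move=> z _; apply: (for_comp (f := snd)); [exact: snd_cts|exact: cval].
have cF : {within E1 `|` E0, continuous F}.
  apply: withinU_continuous => //.
    have c1 : {within E1, continuous (fun z : Z => (f z.1, set_val z.2))}.
      apply/withinP => z Az W [[P Q] /= [nP nQ] PQW].
      have n1 := (withinP _ _).1 cf z.1 Az P nP.
      have n2 : \forall w \near z, A w.1 -> P (f w.1) by exact: (@fst_cts _ _ z _ n1).
      have n3 : \forall w \near z, Q (set_val w.2).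
        exact: (for_comp (f := snd) (@snd_cts _ _ z) (cval z.2) nQ).
      by apply: filterS2 n2 n3 => w Pw Qw Aw; apply: PQW; split => //=; exact: Pw.
    apply: (@subspace_eq_continuous _ _ _ (fun z : Z => H (f z.1, set_val z.2))).
      by move=> z /set_mem Az; rewrite /F /from_subspace; case: pselect.
    apply: (within_comp c1 _ cH) => _ [z Az <-].
    by split => //=; rewrite in_itv/= t01.
  apply: (@subspace_eq_continuous _ _ _ (fun z : Z => u z.1)).
    move=> z /set_mem z0; rewrite /F /from_subspace; case: pselect => // Az.
    by rewrite z0 H0.
  by apply: continuous_subspaceT => z; apply: (for_comp (f := fst)); [exact: fst_cts|exact: cu].
have cE : closed (E1 `|` E0) by exact: closedU.
have kE : compact (E1 `|` E0) by exact: (subclosed_compact cE cZ).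
have [g [U [oU EU cg gF]]] := compact_extend nZ cE kE cF.
(* The points whose whole vertical segment lies in [U]; this set is open by the tube lemma. *)
pose O := [set x : X | forall t : I, U (x, t)].
have oO : open O.
  rewrite openE => x Ox.
  have /compact_near_coveringP cI := @unit_interval_compact R.
  have : \forall x' \near x, [set: I] `<=` (fun t => U (x', t)).
    apply: cI => t _; have : nbhs (x, t) U by apply: open_nbhs_nbhs; split => //; exact: Ox.
    by move=> [[P Q] /= [nP nQ] PQU]; exists (Q, P) => // -[t' x'] /= [Qt Px]; exact: PQU.
  by apply: filterS => x' h t; exact: h.
have AO : A `<=` O by move=> x Ax t; apply: EU; left.
have dis : (~` O) `&` A = set0.
  by apply/seteqP; split => // x [nOx Ax]; exact: (nOx (AO x Ax)).
have [lam [clam l0 l1 lr]] := @urysohn_ext_itv X R nX (~` O) A 0 1 (open_closedC oO) cA dis ltr01.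
have lam01 (x : X) : 0 <= lam x <= 1.
  have : range lam (lam x) by exists x.
  by move=> /lr; rewrite /= in_itv.
pose lamI x : I := SigSub (m01 _ (lam01 x)).
have clamI : continuous lamI by apply: continuous_setType.
have UL x : U (x, lamI x).
  have [Ox|nOx] := pselect (O x); first exact: Ox.
  by apply: EU; right; rewrite /E0/=; apply: l0; exists x.
exists (fun x => g (x, lamI x)) => [x|x Ax].
  apply: (for_comp (Y := Z) (f := fun x => (x, lamI x))); last exact: cg.
  by apply: for_pair; [exact: for_id|exact: clamI].
have lx : set_val (lamI x) = 1 :> R by apply: l1; exists x.
rewrite gF; last by left.
by rewrite /F /=; case: pselect => // Ax'; rewrite lx H1.
Qed.

End AbsoluteExtensors.

(** * Alexander-Spanier cocycles *)

Section Cocycles.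
Variable G : zmodType.

(* Alexander-Spanier 1-cocycles with coefficients in [G]: arbitrary functions
   of two points, of which only the values near the diagonal matter. *)
Definition cocycle (T : topologicalType) (S : set T) (c : T -> T -> G) :=
  forall x, S x -> exists2 U, nbhs x U &
    forall u v w, U u -> U v -> U w -> S u -> S v -> S w -> c u w = c u v + c v w.

Definition coboundary (T : topologicalType) (S : set T) (c : T -> T -> G)
    (g : T -> G) :=
  forall x, S x -> exists2 U, nbhs x U &
    forall u v, U u -> U v -> S u -> S v -> c u v = g v - g u.

(** Vanishing of the first Alexander-Spanier cohomology; as a cochain, the potential [g] is an
    arbitrary function. *)
Definition acyclic (T : topologicalType) (S : set T) :=
  forall c, cocycle S c -> exists g, coboundary S c g.

Lemma cocycle_diag (T : topologicalType) (S : set T) c x :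
  cocycle S c -> S x -> c x x = 0.
Proof.
move=> cc Sx; have [U nU h] := cc x Sx.
have Ux := nbhs_singleton nU; have := h _ _ _ Ux Ux Ux Sx Sx Sx.
by move=> e; apply: (addrI (c x x)); rewrite -e addr0.
Qed.

Lemma acyclic_subsingleton (T : topologicalType) (S : set T) :
  (forall x y, S x -> S y -> x = y) -> acyclic S.
Proof.
move=> sub c cc; exists (fun=> 0) => x Sx; exists setT; first exact: filterT.
by move=> u v _ _ Su Sv; rewrite (sub v u)// (cocycle_diag cc)// subrr.
Qed.

Lemma cocycle_pullback (T T' : topologicalType) (S : set T) (S' : set T')
    (h : T -> T') c :
  {within S, continuous h} -> h @` S `<=` S' -> cocycle S' c ->
  cocycle S (fun u v => c (h u) (h v)).
Proof.
move=> /withinP ch hS cc x Sx.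
have S'h y : S y -> S' (h y) by move=> Sy; apply: hS; exists y.
have [U nU hU] := cc _ (S'h x Sx).
exists [set y | S y -> U (h y)]; first exact: ch.
by move=> u v w Uu Uv Uw Su Sv Sw; apply: hU; auto.
Qed.

(** The tube lemma and the Lebesgue number lemma in one: a local property [Q] inherited by subsets
    holds on boxes of uniform size around the compact slice over [b]. *)
Lemma tube_lebesgue (R : realType) (T : topologicalType) (E : normedModType R)
    (F : set E) (b : T) (Q : set (T * E) -> Prop) :
  compact F -> (forall U V, U `<=` V -> Q V -> Q U) ->
  (forall y, F y -> exists2 U, nbhs (b, y) U & Q U) ->
  exists (O : set T) (d : R), [/\ open O, O b, 0 < d &
    forall y, F y -> Q (O `*` ball y d)].
Proof.
move=> /compact_near_coveringP cF Qm loc.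
pose P (i : set T * R) (y : E) := Q (i.1 `*` ball y i.2).
pose base := [set p : set T * R | nbhs b p.1 /\ 0 < p.2].
pose below (p : set T * R) := [set q : set T * R | q.1 `<=` p.1 /\ q.2 <= p.2].
have FF : Filter (filter_from base below).
  apply: filter_from_filter; first by exists (setT, 1); split => //=; exact: filterT.
  move=> p q [np p0] [nq q0]; exists (p.1 `&` q.1, Num.min p.2 q.2).
    by split => /=; [exact: filterI|rewrite lt_min p0].
  move=> r /= [r1]; rewrite le_min => /andP[rp rq].
  by split; split => // t /r1[].
have [|[W e] [/= nW e0] h] := cF _ _ P FF.
  move=> y Fy; have [U nU QU] := loc y Fy.
  have [[V W] /= [nV nW] VW] := nU.
  move/nbhs_ballP : nW => [e /= e0 eW].
  exists (ball y (e / 2), below (V, e / 2)) => /=.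
    by split; [apply: nbhsx_ballx; rewrite divr_gt0|exists (V, e / 2) => //=; split => //; rewrite divr_gt0].
  move=> [y' q] /= [yy' [q1 q2]]; apply: (Qm _ U) => // -[t z] /= [qt qz].
  apply: VW; split => /=; first exact: q1.
  apply: eW; rewrite (splitr e); apply: ball_triangle yy' _.
  exact: le_ball qz.
exists (interior W), e; split => //; first exact: open_interior.
move=> y Fy; apply: (Qm _ (W `*` ball y e)).
  by move=> [t z] [/= /interior_subset].
by apply: (h (W, e)) => //=; split.
Qed.

Lemma lebesgue_number (R : realType) (E : normedModType R)
    (F : set E) (Q : set E -> Prop) :
  compact F -> (forall U V, U `<=` V -> Q V -> Q U) ->
  (forall y, F y -> exists2 U, nbhs y U & Q U) ->
  exists2 d : R, 0 < d & forall y, F y -> Q (ball y d).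
Proof.
move=> cF Qm loc.
have [|y Fy|W [d [_ W0 d0 h]]] := @tube_lebesgue R E E F 0
    (fun W => Q [set y | W (0, y)]) cF.
- by move=> U V UV; apply: Qm => y /UV.
- have [U nU QU] := loc y Fy.
  exists [set u : E * E | U u.2]; first exact: (@snd_cts _ _ (0, y) _ nU).
  exact: Qm QU.
by exists d => // y /h; apply: Qm.
Qed.

(** A discrete Poincare lemma: [c] is summed along the segment from the origin, cut into [N] steps.
    For two nearby endpoints the corners of each small quadrilateral lie in one ball where the
    cocycle identity holds, so the difference of the two sums telescopes. *)
Lemma star_shaped_acyclic (R : realType) (E : normedModType R) (F : set E) :
  compact F -> (forall x t, F x -> 0 <= t <= 1 -> F (t *: x)) -> acyclic F.
Proof.
move=> cF star c cc.
have [||d d0 dP] := @lebesgue_number R E F (fun U => forall u v w, U u -> U v -> U w ->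
    F u -> F v -> F w -> c u w = c u v + c v w) cF.
- by move=> U V UV h u v w *; apply: h; auto.
- by move=> y /cc[U nU h]; exists U.
have [M [_ /(_ (M + 1))]] := compact_bounded cF.
rewrite ltrDl ltr01 => /(_ erefl) bM.
have {}bM x : F x -> `|x| <= `|M| + 1.
  by move=> /bM /= h; rewrite (le_trans h)// lerD2r ler_norm.
have M0 : 0 < `|M| + 1 by rewrite ltr_wpDl.
(* Segments from the origin have length at most [|M| + 1], so that each of the [N] steps is shorter
   than [d / 2]. *)
pose N := (Num.trunc ((`|M| + 1) / (d / 2))).+1.
have NP : (`|M| + 1) / N%:R < d / 2.
  rewrite ltr_pdivrMr ?ltr0n// mulrC -ltr_pdivrMr ?divr_gt0//.
  by rewrite /N truncnS_gt.
pose p (x : E) (i : nat) := (i%:R / N%:R : R) *: x.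
have N0 : (N%:R : R) != 0 by rewrite pnatr_eq0.
have Fp x i : F x -> (i <= N)%N -> F (p x i).
  move=> Fx iN; apply: star => //; rewrite divr_ge0//=.
  by rewrite ler_pdivrMr ?ltr0n// mul1r ler_nat.
exists (fun x => \sum_(i < N) c (p x i) (p x i.+1)) => x0 Fx0.
exists (ball x0 (d / 4)); first by apply: nbhsx_ballx; rewrite divr_gt0.
move=> x x' bx bx' Fx Fx'.
have xx' : `|x - x'| < d / 2.
  have -> : d / 2 = d / 4 + d / 4 by field.
  by have := ball_triangle (ball_sym bx) bx'; rewrite -ball_normE.
have step i : (i < N)%N ->
    c (p x' i) (p x' i.+1) - c (p x i) (p x i.+1) =
    c (p x i.+1) (p x' i.+1) - c (p x i) (p x' i).
  move=> iN; have iN' := ltnW iN.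
  have small (y : E) : F y -> `|p y i - p y i.+1| < d / 2.
    move=> Fy; rewrite /p -scalerBl -mulrBl -natr1 opprD addrA subrr add0r mulN1r.
    rewrite scaleNr normrN normrZ ger0_norm ?invr_ge0// mulrC.
    by apply: le_lt_trans NP; rewrite ler_wpM2r ?invr_ge0// bM.
  have close j : (j <= N)%N -> `|p x j - p x' j| < d / 2.
    move=> jN; rewrite /p -scalerBr normrZ; apply: le_lt_trans xx'.
    rewrite ler_piMl// ger0_norm ?divr_ge0//.
    by rewrite ler_pdivrMr ?ltr0n// mul1r ler_nat.
  have h := dP (p x i) (Fp x i Fx iN').
  have d2 : d / 2 < d by rewrite ltr_pdivrMr// ltr_pMr// ltr1n.
  have b1 : ball (p x i) d (p x i) by exact: ballxx.
  have b2 : ball (p x i) d (p x i.+1).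
    by rewrite -ball_normE /=; apply: lt_trans (small x Fx) d2.
  have b3 : ball (p x i) d (p x' i).
    by rewrite -ball_normE /=; apply: lt_trans (close i iN') d2.
  have b4 : ball (p x i) d (p x' i.+1).
    rewrite [d]splitr; apply: (@ball_triangle _ _ (p x i.+1)).
      by rewrite -ball_normE /=; exact: small.
    by rewrite -ball_normE /=; exact: close.
  have e1 := h _ _ _ b1 b2 b4 (Fp x i Fx iN') (Fp x i.+1 Fx iN) (Fp x' i.+1 Fx' iN).
  have e2 := h _ _ _ b1 b3 b4 (Fp x i Fx iN') (Fp x' i Fx' iN') (Fp x' i.+1 Fx' iN).
  apply/eqP; rewrite subr_eq addrAC eq_sym subr_eq; apply/eqP.
  by rewrite addrC -e1 e2 addrC.
rewrite -sumrB (eq_bigr (fun i : 'I_N => c (p x i.+1) (p x' i.+1) - c (p x i) (p x' i))).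
  rewrite -(big_mkord xpredT (fun i => c (p x i.+1) (p x' i.+1) - c (p x i) (p x' i))).
  rewrite telescope_sumr// /p mul0r !scale0r divff// !scale1r.
  rewrite (cocycle_diag cc) ?subr0//.
  by have := star x 0 Fx; rewrite scale0r; apply; rewrite lexx ler01.
by move=> i _; exact: step.
Qed.

(** As a map of a compact set to a Hausdorff space, [h] is closed: neighbourhoods of all points of a
    fibre cover the preimage of a neighbourhood of its image. This gives the coboundary identity for
    pairs starting at [h x], and the cocycle identity extends it to all nearby pairs. *)
Lemma coboundary_quotient (T T' : topologicalType) (D : set T) (h : T -> T')
    (c : T' -> T' -> G) (g : T -> G) :
  compact D -> hausdorff_space T' -> {within D, continuous h} ->
  cocycle (h @` D) c -> coboundary D (fun u v => c (h u) (h v)) g ->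
  (forall u v, D u -> D v -> h u = h v -> g u = g v) ->
  exists g', coboundary (h @` D) c g'.
Proof.
move=> cD hT' ch cc cg gfib.
pose g' y := xget 0 [set z | exists2 x, D x & h x = y /\ g x = z].
have g'E x : D x -> g' (h x) = g x.
  move=> Dx; rewrite /g'; case: xgetP => [z _ [x' Dx' [hx <-]]|/(_ (g x))].
    exact: gfib.
  by case; exists x.
exists g' => _ [x Dx <-].
have [U nU hU] := cc (h x) (ex_intro2 _ _ x Dx erefl).
have /choice[V VP] : forall a, exists V : set T, (D a -> h a = h x ->
    nbhs a V /\ forall b, V b -> D b -> c (h x) (h b) = g b - g x).
  move=> a; have [[Da ha]|na] := pselect (D a /\ h a = h x); last first.
    by exists set0 => Da ha; case: na.
  have [V nV hV] := cg a Da; exists V => _ _; split => // b Vb Db.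
  by rewrite -ha hV//; [rewrite (gfib a x)|exact: nbhs_singleton].
pose W := \bigcup_(a in [set a | D a /\ h a = h x]) interior (V a).
have oW : open W by apply: bigcup_open => a _; exact: open_interior.
have cDW : compact (D `\` W) by apply: compact_closedI => //; exact: open_closedC.
have chDW : closed (h @` (D `\` W)).
  apply: (compact_closed hT'); apply: compact_within_image => //.
  by apply: continuous_subspaceW ch => y [].
have nx : ~ (h @` (D `\` W)) (h x).
  move=> [a [Da nWa] ha]; apply: nWa; exists a => //.
  by have [] := VP a Da ha.
have near_x b : D b -> ~ (h @` (D `\` W)) (h b) -> c (h x) (h b) = g b - g x.
  move=> Db nb; have [a [Da ha] /interior_subset Vb] : W b.
    by apply: contrapT => nWb; apply: nb; exists b.
  by have [_] := VP a Da ha; exact.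
exists (U `&` ~` (h @` (D `\` W))).
  apply: filterI => //; apply: open_nbhs_nbhs; split => //; exact: closed_openC.
move=> y z [Uu nu] [Uv nv] [u Du uE] [v Dv vE]; subst y z.
have Ux := nbhs_singleton nU.
have := hU _ _ _ Ux Uu Uv (ex_intro2 _ _ x Dx erefl) (ex_intro2 _ _ u Du erefl)
  (ex_intro2 _ _ v Dv erefl).
rewrite !near_x// !g'E// => e; apply: (addrI (g u - g x)).
by rewrite -e [RHS]addrC addrA subrK.
Qed.

(** Local functions with locally constant differences have the same coboundary near the diagonal. To
    get one global [c], each first argument [a] selects an index [i a] from a finite cover by
    shrunken sets [V]; since the closure of [V x] lies in [W x], near [z] only indices whose [W]
    contains [z] are selected. *)
Lemma glue_potentials (T : topologicalType) (S : set T) (h : T -> T -> G)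
    (W : T -> set T) :
  regular_space T -> compact S -> (forall x, S x -> open (W x) /\ W x x) ->
  (forall x x' z, S x -> S x' -> S z -> W x z -> W x' z ->
    \forall w \near z, S w -> h x w - h x' w = h x z - h x' z) ->
  exists2 c, cocycle S c &
    forall x z, S x -> S z -> W x z -> exists2 U, nbhs z U &
      forall u v, U u -> U v -> S u -> S v -> c u v = h x v - h x u.
Proof.
move=> rT cS oW compat.
have /choice[V VP] : forall x, exists V : set T,
    open V /\ (S x -> V x /\ closure V `<=` W x).
  move=> x; have [Sx|nS] := pselect (S x); last by exists set0; split => //; exact: open0.
  have [oWx Wx] := oW x Sx.
  have [U nU clU] := rT x (W x) (open_nbhs_nbhs (conj oWx Wx)).
  exists (interior U); split => [|_]; first exact: open_interior.
  by split; [exact: nU|exact: subset_trans (closureS (@interior_subset _ U)) clU].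
have [||l lP] := @compact_finite_subcover T S T (fun x => [set y | S x /\ V x y]) cS.
- move=> x; have [Sx|nS] := pselect (S x).
    rewrite (_ : [set _ | _] = V x); first exact: (VP x).1.
    by apply/seteqP; split => y // [].
  by rewrite (_ : [set _ | _] = set0); [exact: open0|apply/seteqP; split => y // []].
- by move=> x Sx; exists x; split => //; have [_ /(_ Sx)[]] := VP x.
have /choice[i iP] : forall a, exists x, S a -> [/\ List.In x l, S x & V x a].
  move=> a; have [/lP[x xl [Sx Vx]]|nS] := pselect (S a); first by exists x.
  by exists a.
pose c a b := h (i a) b - h (i a) a.
have cP x z : S x -> S z -> W x z -> exists2 U, nbhs z U &
      forall u v, U u -> U v -> S u -> S v -> c u v = h x v - h x u.
  move=> Sx Sz Wxz.
  pose P y a := S a -> S y -> (V y a -> closure (V y) z) /\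
    (closure (V y) z -> h y a - h x a = h y z - h x z).
  exists [set a | forall y, List.In y l -> P y a].
    elim: l {lP iP} => [|y l IH]; first by apply: filterS filterT => a _ y [].
    have : \forall a \near z, P y a.
      have [Sy|nSy] := pselect (S y); last by apply: filterS filterT => a _ _ /nSy.
      have [cl|ncl] := pselect (closure (V y) z); last first.
        have : nbhs z (~` closure (V y)).
          by apply: open_nbhs_nbhs; split => //; exact/closed_openC/closed_closure.
        by apply: filterS => a /= na _ _; split => // Va; case: na; exact: subset_closure.
      have Wyz : W y z by have [_ /(_ Sy)[_]] := VP y; apply.
      by apply: filterS (compat y x z Sy Sx Sz Wyz Wxz) => a ha Sa _; split => // _; exact: ha.
    by apply: filterS2 IH => a IHa ha y' [<-|/IHa].
  move=> u v Uu Uv Su Sv; have [il Si Vi] := iP u Su.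
  have [cl /(_ (cl Vi)) eu] := Uu _ il Su Si.
  have [_ /(_ (cl Vi)) ev] := Uv _ il Sv Si.
  rewrite /c -(subrK (h x v) (h (i u) v)) ev -(subrK (h x u) (h (i u) u)) eu.
  by rewrite opprD addrACA subrr add0r.
exists c => // x Sx; have [_ Wx] := oW x Sx.
have [U nU hU] := cP x x Sx Sx Wx; exists U => // u v w Uu Uv Uw Su Sv Sw.
by rewrite (hU u w)// (hU u v)// (hU v w)// [RHS]addrC addrA subrK.
Qed.

End Cocycles.

(** * Descent of cocycles along connected acyclic fibres *)

Section Descent.
Variables (G : zmodType) (R : realType) (T : topologicalType) (E : normedModType R).
Variables (B : set T) (C : set E) (rel : T -> E -> Prop).
Hypothesis rT : regular_space T.
Hypothesis cB : compact B.
Hypothesis cC : compact C.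
Hypothesis relC : forall b y, B b -> rel b y -> C y.
Hypothesis rel_closed : forall b y, B b -> ~ rel b y ->
  exists2 W, nbhs (b, y) W & forall b' y', W (b', y') -> B b' -> ~ rel b' y'.
Hypothesis rel_ex : forall b, B b -> exists y, rel b y.
Hypothesis rel_conn : forall b, B b -> connected [set y | rel b y].
Hypothesis rel_acyclic : forall b, B b -> acyclic G [set y | rel b y].

Definition total_rel : set (T * E) := [set u | B u.1 /\ rel u.1 u.2].
Let Z := total_rel.

Variable c : T * E -> T * E -> G.
Hypothesis cc : cocycle Z c.

Let fibre_compact b : B b -> compact [set y | rel b y].
Proof.
move=> Bb; apply: (subclosed_compact _ cC) => [|y]; last exact: relC.
rewrite -openC openE => y /= ny.
have [W nW hW] := rel_closed Bb ny.
have nb : \forall y' \near y, W (b, y').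
  exact: (for_pair (T := E) (@for_cst E T b y) (@for_id E y) nW).
by rewrite /interior/=; apply: filterS nb => y' Wy'; exact: hW Wy' Bb.
Qed.

Let usc b d : B b -> 0 < d -> \forall b' \near b, B b' -> forall y', rel b' y' ->
  exists2 y, rel b y & `|y - y'| < d.
Proof.
move=> Bb d0; have /compact_near_coveringP cov := cC.
have : \forall b' \near b, C `<=` (fun y' => B b' -> rel b' y' ->
    exists2 y, rel b y & `|y - y'| < d).
  apply: cov => y Cy; have [ry|nry] := pselect (rel b y).
    exists (ball y d, setT) => /=; first by split; [exact: nbhsx_ballx|exact: filterT].
    move=> [y' b'] [/= yy' _] _ _; exists y => //.
    by move: yy'; rewrite -ball_normE.
  have [W [[W1 W2] /= [nW1 nW2] hW12] hW] := rel_closed Bb nry.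
  exists (W2, W1) => //= -[y' b'] [/= W2y' W1b'] Bb' ry'.
  by exfalso; apply: (hW b' y') => //; exact: hW12.
by apply: filterS => b' h Bb' y' ry'; apply: h => //; exact: relC ry'.
Qed.

Let potential b (W : set T) (d : R) (g : T * E -> G) :=
  [/\ open W, W b, 0 < d &
    forall u v, Z u -> Z v -> W u.1 -> W v.1 -> `|u.2 - v.2| < d ->
      c u v = g v - g u].

(** A potential on the fibre over [b] spreads to nearby fibres: a point [u] is moved to a close
    point [rho u.2] of the fibre over [b], and the value of [c] along this move is added. *)
Let potential_ex b : B b -> exists W d g, potential b W d g.
Proof.
move=> Bb; set F := [set y | rel b y].
have ZF y : F y -> Z (b, y) by move=> Fy; split.
have c0 : cocycle F (fun y y' => c (b, y) (b, y')).
  apply: (cocycle_pullback (h := fun y => (b, y)) (S' := Z)) cc => //.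
    apply: continuous_subspaceT => y; apply: for_pair; [exact: for_cst|exact: for_id].
  by move=> _ [y Fy <-]; exact: ZF.
have [g0 g0P] := rel_acyclic Bb c0.
have [|y Fy|W [d [oW Wb d0 h]]] := @tube_lebesgue R T E F b (fun U =>
    (forall u v w, U u -> U v -> U w -> Z u -> Z v -> Z w -> c u w = c u v + c v w) /\
    (forall y y', U (b, y) -> U (b, y') -> F y -> F y' ->
       c (b, y) (b, y') = g0 y' - g0 y)) (fibre_compact Bb).
- by move=> U V UV [h1 h2]; split => *; [apply: h1|apply: h2]; auto.
- have [U1 nU1 hU1] := cc (ZF y Fy).
  have [U2 nU2 hU2] := g0P y Fy.
  exists (U1 `&` [set u | U2 u.2]).
    by apply: filterI => //; exact: (@snd_cts _ _ (b, y) _ nU2).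
  split; first by move=> u v w [? ?] [? ?] [? ?] *; exact: hU1.
  by move=> z z' [_ /= ?] [_ /= ?] *; exact: hU2.
have d3 : 0 < d / 3 by rewrite divr_gt0.
have [V [oV Vb Vusc]] := near_open (usc Bb d3).
(* With errors below [d / 3], the points [u.2], [v.2] and [rho v.2] are all within [d] of [rho u.2],
   so one ball of radius [d] serves for every identity. *)
have /choice[rho rhoP] : forall y, exists y0,
    (exists2 y0, F y0 & `|y0 - y| < d / 3) -> F y0 /\ `|y0 - y| < d / 3.
  move=> y; have [[y0 Fy0 yy0]|ny] := pselect (exists2 y0, F y0 & `|y0 - y| < d / 3).
    by exists y0.
  by exists 0 => /ny.
exists (W `&` V), (d / 3), (fun u => g0 (rho u.2) + c (b, rho u.2) u).
split => //; first exact: openI.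
move=> u v Zu Zv [Wu Vu] [Wv Vv] uv.
have [Fu du] := rhoP _ (Vusc _ Vu Zu.1 _ Zu.2).
have [Fv dv] := rhoP _ (Vusc _ Vv Zv.1 _ Zv.2).
have [h1 h2] := h _ Fu.
have bb : ball (rho u.2) d (rho u.2) by exact: ballxx.
have bu : ball (rho u.2) d u.2.
  by rewrite -ball_normE /=; apply: (lt_trans du); rewrite ltr_pdivrMr// ltr_pMr// ltr1n.
have bv0 : `|rho u.2 - v.2| < d / 3 + d / 3.
  rewrite (_ : rho u.2 - v.2 = (rho u.2 - u.2) + (u.2 - v.2)); last by rewrite addrA subrK.
  by apply: (le_lt_trans (ler_normD _ _)); exact: ltrD.
have bv : ball (rho u.2) d v.2.
  by rewrite -ball_normE /=; apply: (lt_trans bv0); lra.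
have brv : ball (rho u.2) d (rho v.2).
  rewrite -ball_normE /=.
  rewrite (_ : rho u.2 - rho v.2 = (rho u.2 - v.2) - (rho v.2 - v.2)); last first.
    by rewrite opprB addrA subrK.
  apply: (le_lt_trans (ler_normB _ _)); lra.
have inb (z : T * E) : W z.1 -> ball (rho u.2) d z.2 -> (W `*` ball (rho u.2) d) z by split.
have e1 := h1 (b, rho u.2) u v (inb (b, rho u.2) Wb bb) (inb u Wu bu) (inb v Wv bv) (ZF _ Fu) Zu Zv.
have e2 := h1 (b, rho u.2) (b, rho v.2) v (inb (b, rho u.2) Wb bb)
  (inb (b, rho v.2) Wb brv) (inb v Wv bv) (ZF _ Fu) (ZF _ Fv) Zv.
have e3 := h2 (rho u.2) (rho v.2) (inb (b, rho u.2) Wb bb) (inb (b, rho v.2) Wb brv) Fu Fv.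
apply: (addrI (c (b, rho u.2) u)); rewrite -e1 e2 e3.
by rewrite [RHS]addrC opprD -!addrA addNr addr0 (addrC (- g0 _)).
Qed.

Variables (A : set T) (k : T -> T -> G).
Hypothesis ck : cocycle (B `&` A) k.
Hypothesis ckc : forall u, Z u -> A u.1 -> exists2 U, nbhs u U &
  forall v w, U v -> U w -> Z v -> Z w -> A v.1 -> A w.1 -> c v w = k v.1 w.1.

(** The degree 1 case of the Vietoris-Begle theorem, relative to [A]. The section [s] is an
    arbitrary choice and not continuous: the difference of two potentials, and over [A] that of a
    potential and [k], is constant on the connected fibres, hence does not depend on the chosen
    points and is locally constant on the base. *)
Lemma cocycle_descent : exists2 c', cocycle B c' &
  forall b, B b -> A b -> exists2 U, nbhs b U &
    forall v w, U v -> U w -> B v -> B w -> A v -> A w -> c' v w = k v w.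
Proof.
have /choice[W0 W0P] : forall b, exists W, B b -> exists d g, potential b W d g.
  move=> b; have [Bb|nb] := pselect (B b); last by exists set0.
  by have [W WP] := potential_ex Bb; exists W.
have /choice[d0 d0P] : forall b, exists d, B b -> exists g, potential b (W0 b) d g.
  move=> b; have [Bb|nb] := pselect (B b); last by exists 0.
  by have [d dP] := W0P b Bb; exists d.
have /choice[g gP] : forall b, exists g, B b -> potential b (W0 b) (d0 b) g.
  move=> b; have [Bb|nb] := pselect (B b); last by exists (fun=> 0).
  by have [g gP] := d0P b Bb; exists g.
have /choice[s sP] : forall b, exists y, B b -> rel b y.
  move=> b; have [Bb|nb] := pselect (B b); last by exists 0.
  by have [y ry] := rel_ex Bb; exists y.
(* a function that is constant along short vertical moves is locally constant on the base *)
have descend (S : set T) (q : T * E -> G) (W : set T) (d : R) z :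
    B z -> S z -> open W -> W z -> 0 < d ->
    (forall u v, Z u -> Z v -> S u.1 -> S v.1 -> W u.1 -> W v.1 ->
      `|u.2 - v.2| < d -> q u = q v) ->
    \forall w \near z, B w -> S w -> forall y y', rel z y -> rel w y' ->
      q (w, y') = q (z, y).
  move=> Bz Sz oW Wz d_gt0 qP.
  have qconst y y' : rel z y -> rel z y' -> q (z, y) = q (z, y').
    apply: (connected_locally_constant (f := fun y => q (z, y)) (rel_conn Bz)).
    move=> x rx; have nb := nbhsx_ballx x d d_gt0.
    apply: filterS nb => x' xx' rx'.
    by apply: qP => //=; rewrite distrC; move: xx'; rewrite -ball_normE.
  have nW : \forall w \near z, W w by apply: open_nbhs_nbhs.
  apply: filterS2 nW (usc Bz d_gt0) => w Ww hw Bw Sw y y' ry ry'.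
  have [y0 ry0 yy0] := hw Bw y' ry'.
  by rewrite (qconst y y0)//; apply: qP => //=; rewrite distrC.
have [|x x' z Bx Bx' Bz Wxz Wx'z|c' cc' c'P] := @glue_potentials G T B (fun b b' => g b (b', s b')) W0 rT cB.
- by move=> x Bx; have [oW Wx _ _] := gP x Bx.
- have [oWx _ dx hx] := gP x Bx; have [oWx' _ dx' hx'] := gP x' Bx'.
  have := descend setT (fun u => g x u - g x' u) (W0 x `&` W0 x') (Num.min (d0 x) (d0 x')) z Bz.
  have mn : 0 < Num.min (d0 x) (d0 x') by rewrite lt_min dx.
  move=> /(_ Logic.I (openI oWx oWx') (conj Wxz Wx'z) mn) h.
  have : \forall w \near z, B w -> forall y y', rel z y -> rel w y' ->
      g x (w, y') - g x' (w, y') = g x (z, y) - g x' (z, y).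
    apply: filterS (h _) => [w hw Bw|u v Zu Zv _ _ [Wu Wu'] [Wv Wv']]; first exact: hw.
    move=> uv; move: uv; rewrite lt_min => /andP[uv uv'].
    have e := hx u v Zu Zv Wu Wv uv; rewrite (hx' u v Zu Zv Wu' Wv' uv') in e.
    rewrite -(subrK (g x u) (g x v)) -e [RHS]addrC -!addrA addKr.
    by rewrite [RHS]addrC.
  by apply: filterS => w hw Bw; apply: hw => //; exact: sP.
exists c' => // b Bb Ab.
have [oW Wb db hb] := gP b Bb.
have [U nU hU] := c'P b b Bb Bb Wb.
have [U' nU' hU'] := ck (conj Bb Ab).
have kbb : k b b = 0 by exact: (cocycle_diag ck).
(* on fibres above [A], [g b] is [k b] up to a constant *)
have [||W [d [oW' Wb' d_gt0 hW]]] := @tube_lebesgue R T E [set y | rel b y] b (fun U =>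
    forall v w, U v -> U w -> Z v -> Z w -> A v.1 -> A w.1 -> c v w = k v.1 w.1)
    (fibre_compact Bb).
- by move=> V V' VV' h v w *; apply: h; auto.
- by move=> y ry; have [V nV hV] := @ckc (b, y) (conj Bb ry) Ab; exists V.
have d2 : 0 < d / 2 by rewrite divr_gt0.
have [V [oV Vb Vusc]] := near_open (usc Bb d2).
have := descend A (fun u => g b u - k b u.1) (W `&` W0 b `&` V `&` interior U')
  (Num.min (d / 2) (d0 b)) b Bb Ab.
have -> : Num.min (d / 2) (d0 b) > 0 by rewrite lt_min d2.
move=> /(_ (openI (openI (openI oW' oW) oV) (@open_interior _ U'))).
move=> /(_ (conj (conj (conj Wb' Wb) Vb) nU') erefl) h.
have {}h : \forall w \near b, B w -> A w -> forall y y', rel b y -> rel w y' ->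
    g b (w, y') - k b w = g b (b, y) - k b b.
  apply: h => u v Zu Zv Au Av [[[Wu W0u] Vu] /interior_subset U'u].
  move=> [[[Wv W0v] Vv] /interior_subset U'v]; rewrite lt_min => /andP[uv uv'].
  have [y0 ry0 yu] := Vusc _ Vu Zu.1 _ Zu.2.
  have bu : ball y0 d u.2.
    by rewrite -ball_normE /=; apply: (lt_trans yu); rewrite ltr_pdivrMr// ltr_pMr// ltr1n.
  have bv : ball y0 d v.2.
    by rewrite [d]splitr; apply: (@ball_triangle _ _ u.2); rewrite -ball_normE.
  have e1 := hW y0 ry0 u v (conj Wu bu) (conj Wv bv) Zu Zv Au Av.
  have e2 := hb u v Zu Zv W0u W0v uv'.
  have e3 := hU' _ _ _ (nbhs_singleton nU') U'u U'v (conj Bb Ab) (conj Zu.1 Au) (conj Zv.1 Av).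
  by rewrite e3 -e1 e2 opprD opprB addrCA [X in _ = _ + X]addrCA subrr addr0 addrC.
exists ([set w | B w -> A w -> forall y y', rel b y -> rel w y' ->
    g b (w, y') - k b w = g b (b, y) - k b b] `&` (U `&` U')).
  by apply: filterI; [exact: h|exact: filterI].
move=> v w [hv [Uv U'v]] [hw [Uw U'w]] Bv Bw Av Aw.
rewrite hU//.
have ev := hv Bv Av (s b) (s v) (sP b Bb) (sP v Bv).
have ew := hw Bw Aw (s b) (s w) (sP b Bb) (sP w Bw).
have e3 := hU' _ _ _ (nbhs_singleton nU') U'v U'w (conj Bb Ab) (conj Bv Av) (conj Bw Aw).
rewrite -(subrK (k b w) (g b (w, s w))) ew -(subrK (k b v) (g b (v, s v))) ev.
by rewrite opprD addrACA subrr add0r e3 addrAC subrr add0r.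
Qed.

End Descent.

(** * Pseudo-projective planes *)

Section Angles.
Variable R : realType.
Implicit Types (t u : R) (k : int).

(** Angles are measured in turns, so that periods are integers and rounding a difference of angles
    reads off a winding number. *)
Definition cosT t : R := cos (pi *+ 2 * t).
Definition sinT t : R := sin (pi *+ 2 * t).

Let pi2_gt0 : 0 < pi *+ 2 :> R.
Proof. by rewrite pmulrn_lgt0// pi_gt0. Qed.

Lemma cosT2D t : cosT t ^+ 2 + sinT t ^+ 2 = 1.
Proof. exact: cos2Dsin2. Qed.

Lemma cosTB t u : cosT (u - t) = cosT t * cosT u + sinT t * sinT u.
Proof. by rewrite /cosT mulrBr cosB mulrC [in X in _ + X]mulrC. Qed.

Lemma cosTD t u : cosT (t + u) = cosT t * cosT u - sinT t * sinT u.
Proof. by rewrite /cosT mulrDr cosD. Qed.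

Lemma sinTD t u : sinT (t + u) = sinT t * cosT u + cosT t * sinT u.
Proof. by rewrite /sinT mulrDr sinD. Qed.

Lemma cosTN t : cosT (- t) = cosT t.
Proof. by rewrite /cosT mulrN cosN. Qed.

Lemma cosT0 : cosT 0 = 1. Proof. by rewrite /cosT mulr0 cos0. Qed.
Lemma sinT0 : sinT 0 = 0. Proof. by rewrite /sinT mulr0 sin0. Qed.

Lemma cosTDn t (n : nat) : cosT (t + n%:R) = cosT t.
Proof. by rewrite /cosT mulrDr mulr_natr (periodicn (@cosD2pi R)). Qed.

Lemma sinTDn t (n : nat) : sinT (t + n%:R) = sinT t.
Proof. by rewrite /sinT mulrDr mulr_natr (periodicn (@sinD2pi R)). Qed.

Lemma cosTDz t k : cosT (t + k%:~R) = cosT t.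
Proof.
case: k => n; first exact: cosTDn.
by rewrite NegzE mulrNz -[in LHS](cosTDn _ n.+1) subrK.
Qed.

Lemma sinTDz t k : sinT (t + k%:~R) = sinT t.
Proof.
case: k => n; first exact: sinTDn.
by rewrite NegzE mulrNz -[in LHS](sinTDn _ n.+1) subrK.
Qed.

Lemma cosT_continuous : continuous cosT.
Proof.
move=> t; apply: (for_comp (f := fun t => pi *+ 2 * t)); last exact: continuous_cos.
by apply: for_mul; [exact: for_cst|exact: for_id].
Qed.

Lemma sinT_continuous : continuous sinT.
Proof.
move=> t; apply: (for_comp (f := fun t => pi *+ 2 * t)); last exact: continuous_sin.
by apply: for_mul; [exact: for_cst|exact: for_id].
Qed.

Lemma angle_ex (a b : R) : a ^+ 2 + b ^+ 2 = 1 -> exists t, a = cosT t /\ b = sinT t.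
Proof.
move=> ab.
have a1 : -1 <= a <= 1.
  rewrite -ler_norml -(@ler_pXn2r _ 2)// ?nnegrE// expr1n real_normK ?num_real//.
  by rewrite -ab lerDl sqr_ge0.
have acK : cos (acos a) = a by rewrite acosK// in_itv/=.
have sa : sin (acos a) = `|b|.
  by rewrite sin_acos// -ab addrAC subrr add0r sqrtr_sqr.
have mk (x : R) : pi *+ 2 * (x / (pi *+ 2)) = x.
  by rewrite mulrC mulfVK// lt0r_neq0// pi2_gt0.
have [b0|b0] := leP 0 b.
  by exists (acos a / (pi *+ 2)); rewrite /cosT /sinT mk acK sa ger0_norm.
exists (- acos a / (pi *+ 2)); rewrite /cosT /sinT mk cosN sinN acK sa.
by rewrite ltr0_norm// opprK.
Qed.

Definition round (x : R) : int := Num.floor (x + 2^-1).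

Lemma roundP x : `|x - (round x)%:~R| <= 2^-1.
Proof.
have /andP[h1 h2] := floor_itv (x + 2^-1); rewrite ler_norml.
move: h1 h2; rewrite -/(round x) intrD; set r := (round x)%:~R; move=> h1 h2.
apply/andP; split; lra.
Qed.

Lemma round_def x k : `|x - k%:~R| < 2^-1 -> round x = k.
Proof.
rewrite ltr_norml => /andP[h1 h2]; apply: floor_def.
by rewrite intrD; apply/andP; split; lra.
Qed.

Lemma cosT_gt0 x : 0 < cosT x -> `|x - (round x)%:~R| < 4^-1.
Proof.
move=> c0; set f := x - _; have f2 : `|f| <= 2^-1 by exact: roundP.
have : 0 < cosT `|f|.
  have -> : cosT `|f| = cosT f.
    by case: (ltrgt0P f) => // [f0|->]; rewrite ?cosTN// ?normr0// ltr0_norm.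
  by rewrite /f -mulrNz cosTDz.
move=> c1; rewrite ltNge; apply/negP => f4; move: c1; rewrite ltNge => /negP; apply.
rewrite /cosT (_ : pi *+ 2 * `|f| = (pi *+ 2 * (`|f| - 4^-1)) + pi / 2); last first.
  by rewrite mulrBr mulr2n; field.
rewrite cosDpihalf oppr_le0; apply: sin_ge0_pi; apply/andP; split.
  by rewrite mulr_ge0 ?(ltW pi2_gt0)// subr_ge0.
have pp : 0 < pi :> R by exact: pi_gt0.
rewrite mulr2n mulrDl -[leRHS]mulr1.
have : pi * (`|f| - 4^-1) <= pi * 2^-1 by rewrite ler_pM2l//; lra.
lra.
Qed.

Lemma cosT_eq1 x : cosT x = 1 -> x = (round x)%:~R.
Proof.
move=> c1; have f4 := @cosT_gt0 x; rewrite c1 ltr01 in f4.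
have {f4} := f4 erefl; set f := x - _ => f4; apply/eqP; rewrite -subr_eq0 -/f.
have cf : cosT `|f| = 1.
  have -> : cosT `|f| = cosT f.
    by case: (ltrgt0P f) => // [f0|->]; rewrite ?cosTN// ?normr0// ltr0_norm.
  by rewrite /f -mulrNz cosTDz.
have sf : sinT `|f| = 0.
  have := cosT2D `|f|; rewrite cf expr1n => e.
  by apply/eqP; rewrite -sqrf_eq0; apply/eqP; lra.
rewrite -normr_eq0 eq_le normr_ge0 andbT leNgt; apply/negP => f0.
suff : 0 < sinT `|f| by rewrite sf ltxx.
apply: sin_gt0_pihalf; rewrite (mulr_gt0 pi2_gt0 f0)/=.
have pp : 0 < pi :> R by exact: pi_gt0.
move: (pi : R) pp => p pp.
have : p * `|f| < p * 4^-1 by rewrite ltr_pM2l.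
rewrite mulr2n mulrDl; lra.
Qed.

Lemma round_add x y : `|x - (round x)%:~R| < 4^-1 -> `|y - (round y)%:~R| < 4^-1 ->
  round (x + y) = round x + round y.
Proof.
move=> hx hy; apply: round_def; rewrite intrD opprD addrACA.
apply: (le_lt_trans (ler_normD _ _)); lra.
Qed.

End Angles.

Section PseudoProjective.
Variable R : realType.
Local Notation V := 'rV[R]_5.

Definition vec5 (a b c d e : R) : V := \row_i nth 0 [:: a; b; c; d; e] i.
Notation x0 := (@Ordinal 5 0 isT).
Notation x1 := (@Ordinal 5 1 isT).
Notation x2 := (@Ordinal 5 2 isT).
Notation x3 := (@Ordinal 5 3 isT).
Notation x4 := (@Ordinal 5 4 isT).

Lemma vec5_inj a b c d e a' b' c' d' e' :
  vec5 a b c d e = vec5 a' b' c' d' e' -> [/\ a = a', b = b', c = c', d = d' & e = e'].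
Proof.
move=> /rowP h; split.
- by have := h x0; rewrite !mxE.
- by have := h x1; rewrite !mxE.
- by have := h x2; rewrite !mxE.
- by have := h x3; rewrite !mxE.
- by have := h x4; rewrite !mxE.
Qed.

Lemma for_vec5 (T : topologicalType) (a b c d e : T -> R) x :
  {for x, continuous a} -> {for x, continuous b} -> {for x, continuous c} ->
  {for x, continuous d} -> {for x, continuous e} ->
  {for x, continuous (fun y => vec5 (a y) (b y) (c y) (d y) (e y))}.
Proof.
move=> ca cb cc cd ce; apply: for_rV => -[[|[|[|[|[|//]]]]] i].
- by rewrite (_ : (fun _ => _) = a)//; apply/funext => y; rewrite mxE.
- by rewrite (_ : (fun _ => _) = b)//; apply/funext => y; rewrite mxE.
- by rewrite (_ : (fun _ => _) = c)//; apply/funext => y; rewrite mxE.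
- by rewrite (_ : (fun _ => _) = d)//; apply/funext => y; rewrite mxE.
- by rewrite (_ : (fun _ => _) = e)//; apply/funext => y; rewrite mxE.
Qed.

(* Powers of the complex number [z.1 + i z.2]. *)
Fixpoint cpow (n : nat) (z : R * R) : R * R :=
  if n is m.+1 then
    let w := cpow m z in (z.1 * w.1 - z.2 * w.2, z.1 * w.2 + z.2 * w.1)
  else (1, 0).

Lemma cpow_continuous n : continuous (cpow n).
Proof.
elim: n => [z|n IH z]; first exact: for_cst.
have c1 : {for z, continuous (fun z : R * R => z.1)} by exact/for_fst/for_id.
have c2 : {for z, continuous (fun z : R * R => z.2)} by exact/for_snd/for_id.
have c3 : {for z, continuous (fun z : R * R => (cpow n z).1)} by exact/for_fst/IH.
have c4 : {for z, continuous (fun z : R * R => (cpow n z).2)} by exact/for_snd/IH.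
have : {for z, continuous (fun z : R * R => (z.1 * (cpow n z).1 - z.2 * (cpow n z).2,
    z.1 * (cpow n z).2 + z.2 * (cpow n z).1))}.
  apply: for_pair.
    by apply: for_sub; exact: for_mul.
  by apply: for_add; exact: for_mul.
exact.
Qed.

Lemma cpow_polar n (r t : R) :
  cpow n (r * cosT t, r * sinT t) = (r ^+ n * cosT (n%:R * t), r ^+ n * sinT (n%:R * t)).
Proof.
elim: n => [|n IH]; first by rewrite mul0r expr0 !mul1r cosT0 sinT0.
rewrite /= IH /= -natr1 mulrDl mul1r [n%:R * t + t]addrC cosTD sinTD exprS.
by congr pair; ring.
Qed.

Definition dimap (n : nat) (z : 'rV[R]_2) : V :=
  let s := normsq z in let w := cpow n.+1 (z ord0 0, z ord0 1) in
  vec5 w.1 w.2 ((1 - s) * z ord0 0) ((1 - s) * z ord0 1) s.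

Definition polar (r t : R) : 'rV[R]_2 := \row_i nth 0 [:: r * cosT t; r * sinT t] i.

Lemma normsq2 (z : 'rV[R]_2) : normsq z = z ord0 0 ^+ 2 + z ord0 1 ^+ 2.
Proof. by rewrite /normsq big_ord_recl big_ord1; congr (_ + z _ _ ^+ 2); exact: val_inj. Qed.

Lemma normsq_polar r t : normsq (polar r t) = r ^+ 2.
Proof. by rewrite normsq2 !mxE /= !exprMn -mulrDr cosT2D mulr1. Qed.

Lemma polar_ex (z : 'rV[R]_2) : exists r t, 0 <= r /\ z = polar r t.
Proof.
have [z0|z0] := eqVneq (normsq z) 0.
  exists 0, 0; split => //; move: z0; rewrite normsq2 => /eqP.
  rewrite paddr_eq0 ?sqr_ge0// !sqrf_eq0 => /andP[/eqP a0 /eqP b0].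
  apply/rowP => -[[|[|//]] i]; rewrite mxE /= mul0r.
    by rewrite -[RHS]a0; congr (z _ _); exact: val_inj.
  by rewrite -[RHS]b0; congr (z _ _); exact: val_inj.
pose r := Num.sqrt (normsq z).
have r0 : 0 < r by rewrite sqrtr_gt0 lt_neqAle eq_sym z0 normsq_ge0.
have r2 : r ^+ 2 = normsq z by rewrite sqr_sqrtr// normsq_ge0.
have [|t [ct st]] := @angle_ex R (z ord0 0 / r) (z ord0 1 / r).
  by rewrite !exprMn -mulrDl -normsq2 -r2 -exprMn divff ?expr1n// gt_eqF.
exists r, t; split; first exact: ltW.
apply/rowP => -[[|[|//]] i]; rewrite mxE /= -?ct -?st mulrCA divff ?gt_eqF// mulr1.
  by congr (z _ _); exact: val_inj.
by congr (z _ _); exact: val_inj.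
Qed.

Lemma dimap_polar n r t : dimap n (polar r t) =
  vec5 (r ^+ n.+1 * cosT (n.+1%:R * t)) (r ^+ n.+1 * sinT (n.+1%:R * t))
    ((1 - r ^+ 2) * (r * cosT t)) ((1 - r ^+ 2) * (r * sinT t)) (r ^+ 2).
Proof. by rewrite /dimap normsq_polar !mxE [nth _ _ _]/= cpow_polar. Qed.

Lemma dimap_continuous n : continuous (dimap n).
Proof.
move=> z; have c0 i : {for z, continuous (fun z : 'rV[R]_2 => z ord0 i)}.
  by apply: for_coord; exact: for_id.
have cs : {for z, continuous (@normsq R 2)} by exact: normsq_continuous.
have cw : {for z, continuous (fun z : 'rV[R]_2 => cpow n.+1 (z ord0 0, z ord0 1))}.
  by apply: (for_comp (for_pair (c0 0) (c0 1))); exact: cpow_continuous.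
have c1s : {for z, continuous (fun z : 'rV[R]_2 => 1 - normsq z)}.
  by apply: for_sub => //; exact: for_cst.
have m0 := for_mul c1s (c0 0); have m1 := for_mul c1s (c0 1).
exact: (for_vec5 (for_fst cw) (for_snd cw) m0 m1 cs).
Qed.

(* The pseudo-projective plane of degree [n + 1]: the disk with the points of
   its boundary circle identified along [z |-> z ^ (n + 1)].  The last three
   coordinates make the quotient map injective inside the disk, where it is
   inverted by a rational formula. *)
Definition ppl n : set V := dimap n @` @closed_disk R 2.

(** The point -1 of the core circle, where the parametrization [loop] of the 1-cell of the comb
    begins and ends. *)
Definition ppl_base : V := vec5 (-1) 0 0 0 1.

(** One and the same subset for all [n]. For [n = 0] it is the boundary circle of the disk [ppl 0],
    so the map from this boundary to the core circle of any other [ppl n] is just the identity on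
    coordinates. *)
Definition core_circle : set V := [set v | exists t, v = vec5 (cosT t) (sinT t) 0 0 1].

Lemma ppl_compact n : compact (ppl n).
Proof.
apply: compact_within_image; last exact: closed_disk_compact.
exact/continuous_subspaceT/dimap_continuous.
Qed.

Lemma ppl_closed n : closed (ppl n).
Proof. exact: (compact_closed (@norm_hausdorff R V) (@ppl_compact n)). Qed.

Lemma core_circle_ppl n : core_circle `<=` ppl n.
Proof.
move=> _ [t ->]; exists (polar 1 (t / n.+1%:R)).
  by rewrite /closed_disk/= normsq_polar expr1n.
rewrite dimap_polar !expr1n subrr !mul0r !mul1r mulrC mulfVK//.
Qed.

Lemma ppl_base_core : core_circle ppl_base.
Proof.
have [|t [ct st]] := @angle_ex R (-1) 0; first by rewrite sqrrN expr1n expr0n addr0.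
by exists t; rewrite -ct -st.
Qed.

Lemma ppl_base_in n : ppl n ppl_base.
Proof. exact/core_circle_ppl/ppl_base_core. Qed.

Lemma ppl_boundary n v : ppl n v -> v ord0 x4 = 1 -> core_circle v.
Proof.
move=> [z zD <-]; have [r [t [r0 ->]]] := polar_ex z.
rewrite dimap_polar mxE /= => r2.
have -> : r = 1.
  apply/eqP; rewrite -(@eqrXn2 _ 2)// r2 ?expr1n//.
by exists (n.+1%:R * t); rewrite !expr1n subrr !mul0r !mul1r.
Qed.

Lemma disk_star (m : nat) (x : 'rV[R]_m) t :
  closed_disk x -> 0 <= t <= 1 -> closed_disk (t *: x).
Proof.
rewrite /closed_disk/= normsqZ => x1 /andP[t0 t1].
by rewrite mulr_ile1 ?sqr_ge0 ?normsq_ge0// expr_le1.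
Qed.

Lemma disk_connected m : connected (@closed_disk R m).
Proof.
have -> : @closed_disk R m =
    \bigcup_(x in @closed_disk R m) ((fun t : R => t *: x) @` `[0, 1]).
  apply/seteqP; split => x.
    by move=> Dx; exists x => //; exists 1; rewrite ?scale1r//= in_itv/= ler01 lexx.
  by move=> [y Dy [t]]; rewrite /= in_itv/= => t01 <-; exact: disk_star.
apply: bigcup_connected.
  exists 0 => x Dx; exists 0; rewrite ?scale0r//= in_itv/= lexx ler01.
  by [].
move=> x Dx; apply: connected_continuous_connected; first exact: segment_connected.
by apply: continuous_subspaceT => t; apply: for_scale; [exact: for_id|exact: for_cst].
Qed.

Lemma ppl_connected n : connected (ppl n).
Proof.
apply: connected_continuous_connected; first exact: disk_connected.
exact/continuous_subspaceT/dimap_continuous.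
Qed.

Lemma disk_acyclic (G : zmodType) m : acyclic G (@closed_disk R m).
Proof.
by apply: star_shaped_acyclic; [exact: closed_disk_compact|exact: disk_star].
Qed.

End PseudoProjective.

(** * Acyclicity of the planes of small degree *)

Section CoreClass.
Variable R : realType.
Local Notation V := 'rV[R]_5.
Notation x0 := (@Ordinal 5 0 isT).
Notation x1 := (@Ordinal 5 1 isT).
Notation x2 := (@Ordinal 5 2 isT).
Notation x3 := (@Ordinal 5 3 isT).
Notation x4 := (@Ordinal 5 4 isT).

Lemma turn_half (y : R) : 0 <= y -> y <= 2^-1 -> pi *+ 2 * y \in `[0, pi].
Proof.
move=> y0 y2; rewrite in_itv/=; have pp : 0 < pi :> R by exact: pi_gt0.
apply/andP; split; first by rewrite mulr_ge0// mulrn_wge0// ltW.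
rewrite mulrnAl -mulrnAr -[leRHS]mulr1 ler_pM2l// mulr2n; lra.
Qed.

Lemma ltr_cosT (x y : R) : 0 <= x <= 2^-1 -> 0 <= y <= 2^-1 ->
  (cosT x < cosT y) = (y < x).
Proof.
move=> /andP[x0 x2] /andP[y0 y2]; rewrite /cosT ltr_cos ?turn_half//.
by rewrite ltr_pM2l// pmulrn_lgt0// pi_gt0.
Qed.

Lemma cosT_gt (e x : R) : 0 <= e <= 2^-1 -> cosT e < cosT x ->
  `|x - (round x)%:~R| < e.
Proof.
move=> /andP[e0 e2] ex; have f2 := roundP x; set f := x - _ in f2 *.
have fx : cosT `|f| = cosT x.
  have -> : cosT `|f| = cosT f.
    by case: (ltrgt0P f) => // [f0|->]; rewrite ?cosTN// ?normr0// ltr0_norm.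
  by rewrite /f -mulrNz cosTDz.
by move: ex; rewrite -fx ltr_cosT// ?e0// normr_ge0.
Qed.

Lemma polar_continuous r : continuous (@polar R r).
Proof.
move=> t; apply: for_rV => -[[|[|//]] i].
  rewrite (_ : (fun _ => _) = fun t => r * cosT t); last by apply/funext => u; rewrite mxE.
  by apply: for_mul; [exact: for_cst|exact: cosT_continuous].
rewrite (_ : (fun _ => _) = fun t => r * sinT t); last by apply/funext => u; rewrite mxE.
by apply: for_mul; [exact: for_cst|exact: sinT_continuous].
Qed.

Lemma polarDz r t (k : int) : @polar R r (t + k%:~R) = polar r t.
Proof. by rewrite /polar cosTDz sinTDz. Qed.

Lemma real_connected : connected [set: R].
Proof. by apply/connected_intervalP. Qed.

(** Pulled back to the disk, the cocycle has a potential [g]. Rotating a boundary point by [1 / q]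
    of a turn changes [g] by a constant, and [q] such rotations change nothing; as [q < p] is
    invertible mod [p], the constant is 0. So [g] is constant on the fibres of [dimap] and
    descends. *)
Lemma ppl_acyclic p n : prime p -> (n.+1 < p)%N -> acyclic 'F_p (@ppl R n).
Proof.
move=> pp np c cc; set q : R := n.+1%:R.
have q0 : q != 0 by rewrite pnatr_eq0.
have ch : {within @closed_disk R 2, continuous (dimap n)}.
  exact/continuous_subspaceT/dimap_continuous.
have [g gP] := disk_acyclic (cocycle_pullback ch (@subset_refl _ (@ppl R n)) cc).
apply: (coboundary_quotient (closed_disk_compact (n := 2)) (@norm_hausdorff _ _) ch cc gP).
have D1 t : closed_disk (polar 1 t : 'rV[R]_2) by rewrite /closed_disk/= normsq_polar expr1n.
have rotE t : dimap n (polar 1 (t + q^-1)) = dimap n (polar 1 t) :> V.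
  rewrite !dimap_polar; congr vec5; last by rewrite expr1n subrr !mul0r.
  - by rewrite mulrDr -/q divff// (cosTDn _ 1).
  - by rewrite mulrDr -/q divff// (sinTDn _ 1).
  - by rewrite expr1n subrr !mul0r.
(* The two boundary points have the same image in [ppl n], so [c] takes the same values at both;
   hence [k] is locally constant. *)
pose k t := g (polar 1 (t + q^-1)) - g (polar 1 t).
have kconst t t' : k t = k t'.
  apply: (connected_locally_constant real_connected) => // {t t'} t _.
  have [U nU hU] := gP _ (D1 t); have [U' nU' hU'] := gP _ (D1 (t + q^-1)).
  have n1 : \forall u \near t, U (polar 1 u) by exact: (polar_continuous nU).
  have n2 : \forall u \near t, U' (polar 1 (u + q^-1)).
    have c1 : {for t, continuous (fun u => polar 1 (u + q^-1) : 'rV[R]_2)}.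
      apply: (for_comp (f := fun u => u + q^-1)); last exact: polar_continuous.
      by apply: for_add; [exact: for_id|exact: for_cst].
    exact: (c1 _ nU').
  apply: filterS2 n1 n2 => u Uu U'u _.
  have e1 := hU _ _ (nbhs_singleton nU) Uu (D1 t) (D1 u).
  have e2 := hU' _ _ (nbhs_singleton nU') U'u (D1 _) (D1 (u + q^-1)).
  rewrite !rotE e1 in e2; rewrite /k.
  by rewrite -[X in X - _](subrK (g (polar 1 (t + q^-1)))) -e2 addrAC [X in X + _]addrAC subrr add0r addrC.
have kn (t : R) (m : nat) : g (polar 1 (t + m%:R / q)) - g (polar 1 t) = k 0 *+ m.
  elim: m => [|m IH]; first by rewrite mul0r addr0 subrr.
  rewrite -natr1 mulrDl mul1r addrA mulrSr -IH -(kconst (t + m%:R / q)) /k.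
  by rewrite [RHS]addrC addrA subrK.
have k0 : k 0 = 0.
  have := kn 0 n.+1; rewrite -/q divff// add0r -[1]/(1%:~R) -[X in polar 1 X]add0r polarDz subrr.
  move=> /esym/eqP; rewrite -mulr_natr mulf_eq0 => /orP[/eqP //|].
  by rewrite -(dvdn_pcharf (pchar_Fp pp)) => /(dvdn_leq (ltn0Sn n)); rewrite leqNgt np.
have gz t (m : int) : g (polar 1 (t + m%:~R / q)) = g (polar 1 t).
  case: m => m; first by apply/eqP; rewrite -subr_eq0 kn k0 mul0rn.
  apply/eqP; rewrite eq_sym -subr_eq0 NegzE mulrNz mulNr.
  by rewrite -[X in g (polar 1 X) - _](subrK (m.+1%:R / q)) kn k0 mul0rn.
move=> u v; have [r [t [r0 ->]]] := polar_ex u; have [r' [t' [r'0 ->]]] := polar_ex v.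
move=> Du Dv; rewrite !dimap_polar => /vec5_inj[e1 e2 e3 e4 /eqP].
rewrite eqrXn2// => /eqP rr; subst r'.
have [r1|r1] := eqVneq r 1; last first.
  have s1 : 1 - r ^+ 2 != 0.
    by rewrite subr_eq0 eq_sym -[X in _ != X](expr1n _ 2) eqrXn2.
  have f3 := mulfI s1 e3; have f4 := mulfI s1 e4.
  by congr g; rewrite /polar f3 f4.
subst r; rewrite !expr1n !mul1r in e1 e2.
have : cosT (q * t' - q * t) = 1 by rewrite cosTB -e1 -e2 -!expr2 cosT2D.
move=> /cosT_eq1; set m := round _ => em.
by rewrite -(gz t m) -em -mulrBr mulrAC divff// mul1r addrC subrK.
Qed.

End CoreClass.

(** * The cohomology class of the core circle *)

Section CoreClass.
Variable R : realType.
Local Notation V := 'rV[R]_5.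
Notation x0 := (@Ordinal 5 0 isT).
Notation x1 := (@Ordinal 5 1 isT).
Notation x2 := (@Ordinal 5 2 isT).
Notation x3 := (@Ordinal 5 3 isT).
Notation x4 := (@Ordinal 5 4 isT).

Section Class.
Variable n : nat.
Let q : R := n.+1%:R.

(* [angle v] lifts the angle of a point of [ppl n] through the quotient map,
   rescaled so that turning once around the core circle adds 1. *)
Definition angle (v : V) : R :=
  xget 0 [set a | exists r t, [/\ 0 <= r, r <= 1, v = dimap n (polar r t) & a = n.+1%:R * t]].

Lemma angleP v : @ppl R n v -> exists r t,
  [/\ 0 <= r, r <= 1, v = dimap n (polar r t) & angle v = n.+1%:R * t].
Proof.
move=> [z Dz <-]; have [r [t [r0 zE]]] := polar_ex z.
rewrite /angle; case: xgetP => [a _ [r' [t' [? ? ? ?]]]|/(_ (n.+1%:R * t))].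
  by exists r', t'.
case; exists r, t; split => //; last by rewrite zE.
move: Dz; rewrite zE /closed_disk/= normsq_polar.
by rewrite expr_le1.
Qed.

(* The angle is well defined modulo [n + 1] inside the disk, but only modulo 1
   on the core circle. *)
Definition core_cocycle (v w : V) : 'F_n.+1 :=
  if (2^-1 < v ord0 x4) && (2^-1 < w ord0 x4)
  then (round (angle w - angle v))%:~R else 0.

(** Near the centre the cochain is 0 by definition. Elsewhere inside the disk nearby angles differ
    by almost a multiple of [n.+1], and such multiples vanish in the coefficients. Near the core
    circle all differences are close to integers, and there rounding is additive. *)
Lemma core_cocycleP : prime n.+1 -> cocycle (@ppl R n) core_cocycle.
Proof.
move=> pq v Pv; have cx i : {for v, continuous (fun w : V => w ord0 i)}.
  by apply: for_coord; exact: for_id.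
pose s4 (w : V) : R := w ord0 x4.
have [r [t [r0 r1 vE av]]] := angleP Pv.
have v4 : v ord0 x4 = r ^+ 2 by rewrite vE dimap_polar mxE.
have [r12|r12] := ltP (r ^+ 2) 2^-1.
  exists [set w : V | w ord0 x4 < 2^-1].
    by apply: (near_lt (f := s4) (g := fun=> 2^-1)); [exact: cx|exact: for_cst|rewrite /s4 v4].
  move=> a b d /= ha hb hd _ _ _.
  by rewrite /core_cocycle !ltNge !ltW//= add0r.
have r_gt0 : 0 < r.
  rewrite lt_neqAle r0 andbT eq_sym; apply: contraTneq r12 => ->.
  by rewrite expr0n/= -ltNge; lra.
have [r1'|r1'] := eqVneq r 1; last first.
  have {}r1 : r < 1 by rewrite lt_neqAle r1' r1.
  have s1 : r ^+ 2 < 1 by rewrite expr_lt1.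
  (* Angles are [q] times the angle in the disk: two deviations below [e] add up to less than 1/4
     after this scaling, which is safe for rounding. *)
  pose e : R := 8^-1 / q.
  have e0 : 0 < e by rewrite divr_gt0// invr_gt0.
  have e2 : e < 2^-1.
    have : e <= 8^-1 by rewrite /e ler_pdivrMr// ler_peMr ?invr_ge0// ler1n.
    lra.
  have ce : cosT e < 1.
    by rewrite -[ltRHS]cosT0 ltr_cosT// ?lexx ?invr_ge0 ?ler0n// (ltW e0) ltW.
  (* In polar coordinates this is the product of [(1 - r' ^+ 2) * r'] and [cosT (t' - t) - cosT e],
     so positivity keeps [w] off the boundary and its disk angle within [e] of [t] modulo 1. *)
  pose psi (w : V) := w ord0 x2 * cosT t + w ord0 x3 * sinT t
    - cosT e * ((1 - w ord0 x4) * Num.sqrt (w ord0 x4)).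
  have psi_cts : {for v, continuous psi}.
    apply: for_sub.
      by apply: for_add; apply: for_mul => //; exact: for_cst.
    apply: for_mul; first exact: for_cst.
    apply: for_mul; last exact: for_sqrt.
    by apply: for_sub => //; exact: for_cst.
  have psiE r' t' : 0 <= r' -> psi (dimap n (polar r' t')) =
      (1 - r' ^+ 2) * r' * (cosT (t' - t) - cosT e).
    move=> r'0; rewrite /psi dimap_polar !mxE /= sqrtr_sqr ger0_norm// cosTB.
    by ring.
  have psi0 : 0 < psi v.
    rewrite vE psiE// subrr cosT0 !mulr_gt0// subr_gt0//.
  have near1 : \forall w \near v, 0 < psi w.
    by apply: (near_lt (f := fun=> 0)) => //; exact: for_cst.
  exists [set w | 0 < psi w] => //.
  have close w : @ppl R n w -> 0 < psi w ->
      exists m : int, `|angle w / q - t - m%:~R| < e.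
    move=> Pw; have [r' [t' [r'0 r'1 -> aw]]] := angleP Pw.
    rewrite psiE// => h; exists (round (t' - t)).
    rewrite aw mulrAC divff ?gt_eqF// mul1r; apply: cosT_gt; first by rewrite (ltW e0) ltW.
    rewrite -subr_gt0; apply: contraT; rewrite -leNgt => h'.
    by move: h; rewrite ltNge mulr_ge0_le0// mulr_ge0// subr_ge0 expr_le1.
  have zero a b : @ppl R n a -> @ppl R n b -> 0 < psi a -> 0 < psi b -> core_cocycle a b = 0.
    move=> Pa Pb /(close a Pa)[m ma] /(close b Pb)[m' mb].
    rewrite /core_cocycle; case: ifP => // _.
    have -> : round (angle b - angle a) = (n.+1%:Z * (m' - m))%R.
      apply: round_def; rewrite intrM intrB.
      have -> : angle b - angle a - n.+1%:~R * (m'%:~R - m%:~R) =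
        q * ((angle b / q - t - m'%:~R) - (angle a / q - t - m%:~R)).
        by rewrite -[n.+1%:~R]/q; field; rewrite gt_eqF.
      rewrite normrM gtr0_norm// mulrC -ltr_pdivlMr//.
      apply: (le_lt_trans (ler_normB _ _)).
      have -> : 2^-1 / q = 4 * e by rewrite /e; field; rewrite gt_eqF.
      lra.
    rewrite intrM -[n.+1%:~R]/(n.+1%:R) pchar_Fp_0 ?mul0r//.
  by move=> a b d ha hb hd Pa Pb Pd; rewrite !zero// addr0.
have v4' : v ord0 x4 = 1 by rewrite v4 r1' expr1n.
subst r; have [a0 vE'] := ppl_boundary Pv v4'.
(* The scalar product of the power coordinates with the direction of [v]; a value above [cosT 8^-1]
   puts the angle within 1/8 of [a0] modulo 1. *)
pose phi (w : V) := w ord0 x0 * cosT a0 + w ord0 x1 * sinT a0.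
have phi_cts : {for v, continuous phi}.
  by apply: for_add; apply: for_mul => //; exact: for_cst.
have c8 : cosT (8^-1 : R) < 1.
  by rewrite -[ltRHS]cosT0 ltr_cosT// ?lexx ?invr_ge0 ?ler0n ?invr_gt0//=; lra.
have c80 : 0 <= cosT (8^-1 : R).
  rewrite /cosT cos_ge0_pihalf//; have pp : 0 < pi :> R by exact: pi_gt0.
  move: (pi : R) pp => P pp; rewrite -mulr_natl; apply/andP; split; lra.
have phiE r' t' : phi (dimap n (polar r' t')) = r' ^+ n.+1 * cosT (n.+1%:R * t' - a0).
  by rewrite /phi dimap_polar !mxE /= cosTB; ring.
have phi1 : cosT 8^-1 < phi v.
  by rewrite /phi vE' !mxE /= -!expr2 cosT2D.
have near1 : \forall w \near v, cosT 8^-1 < phi w.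
  by apply: (near_lt (f := fun=> cosT 8^-1)) => //; exact: for_cst.
have near2 : \forall w \near v, 2^-1 < s4 w.
  by apply: (near_lt (f := fun=> 2^-1)); [exact: for_cst|exact: cx|rewrite /s4 v4'; lra].
exists ([set w | cosT 8^-1 < phi w] `&` [set w | 2^-1 < w ord0 x4]); first exact: filterI.
have close w : ppl n w -> cosT 8^-1 < phi w -> `|angle w - a0 - (round (angle w - a0))%:~R| < 8^-1.
  move=> Pw; have [r' [t' [r'0 r'1 -> ->]]] := angleP Pw.
  rewrite phiE => h; apply: cosT_gt; first by apply/andP; split; lra.
  apply: (lt_le_trans h); rewrite ler_piMl ?exprn_ile1//.
  rewrite leNgt; apply/negP => neg; move: h; rewrite ltNge => /negP; apply.
  by apply: le_trans c80; rewrite mulr_ge0_le0 ?exprn_ge0// ltW.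
have diff a b : ppl n a -> ppl n b -> cosT 8^-1 < phi a -> cosT 8^-1 < phi b ->
    `|angle b - angle a - (round (angle b - angle a))%:~R| < 4^-1.
  move=> Pa Pb /(close a Pa) ha /(close b Pb) hb.
  set ka := round _ in ha; set kb := round _ in hb.
  have h : `|angle b - angle a - (kb - ka)%:~R| < 4^-1.
    rewrite intrB; move: ha hb; rewrite !ltr_norml => /andP[? ?] /andP[? ?].
    by apply/andP; split; lra.
  by rewrite (@round_def _ _ (kb - ka))//; apply: lt_trans h _; lra.
move=> a b d [ha sa] [hb sb] [hd sd] Pa Pb Pd; rewrite /core_cocycle.
move: sa sb sd => /= -> -> -> /=.
rewrite -intrD -round_add; [|exact: diff|exact: diff].
by congr (_ %:~R); congr round; ring.
Qed.

(** Along the circle a potential follows the integer jumps of [angle]: corrected by them it is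
    locally constant in the parameter [t]. After one turn the point is the same but the correction
    has changed by 1, which is nonzero in the coefficients. *)
Lemma core_cocycle_nontrivial : prime n.+1 -> forall g : V -> 'F_n.+1,
  ~ coboundary (@core_circle R) core_cocycle g.
Proof.
move=> pq g gP; pose gam (t : R) : V := vec5 (cosT t) (sinT t) 0 0 1.
have Cgam t : core_circle (gam t) by exists t.
have gam_cts : continuous gam.
  by move=> t; apply: for_vec5; [exact: cosT_continuous|exact: sinT_continuous| | |]; exact: for_cst.
have gam4 t : gam t ord0 x4 = 1 by rewrite mxE.
pose k t := round (angle (gam t) - t).
have kE t : angle (gam t) = t + (k t)%:~R.
  have [r [s [r0 r1 gE aE]]] := angleP (core_circle_ppl n (Cgam t)).
  have rr : r = 1.
    have := gam4 t; rewrite gE dimap_polar mxE /= => r2.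
    by apply/eqP; rewrite -(@eqrXn2 _ 2)// r2 expr1n.
  move: gE; rewrite rr dimap_polar !expr1n !mul1r -aE => /vec5_inj[e1 e2 _ _ _].
  rewrite /k -cosT_eq1 ?subrKC// cosTB -e1 -e2.
  by rewrite -!expr2 cosT2D.
pose m t : 'F_n.+1 := g (gam t) - (k t)%:~R.
have m_cst s t : m s = m t.
  apply: (connected_locally_constant (@real_connected R)) => // {}s _.
  have [U nU gU] := gP _ (Cgam s).
  have near1 : \forall t \near s, U (gam t) by exact: gam_cts.
  have near2 : \forall t \near s, ball s 2^-1 t by apply: nbhsx_ballx; rewrite invr_gt0.
  apply: filterS2 near1 near2 => t' Ut' bt' _.
  have := gU _ _ (nbhs_singleton nU) Ut' (Cgam s) (Cgam t').
  have h2 : 2^-1 < 1 :> R by lra.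
  rewrite /core_cocycle !gam4 h2/= => h.
  have hk : round (angle (gam t') - angle (gam s)) = k t' - k s.
    apply: round_def; rewrite !kE intrB; move: bt'; rewrite -ball_normE/= distrC.
    by congr (`|_| < _); ring.
  by move: h; rewrite hk intrB /m => h; rewrite -[g (gam t')](subrK (g (gam s))) -h; ring.
have : m 1 = m 0 by exact: m_cst.
have g10 : gam 1 = gam 0.
  by rewrite /gam -(add0r 1) -[1]/(1%:R) cosTDn sinTDn.
have k10 : k 1 = k 0 - 1.
  apply: (@intr_inj R); rewrite intrB.
  have := kE 1; rewrite g10 kE => h; move: h; lra.
rewrite /m g10 k10 => /addrI/oppr_inj/eqP; rewrite intrB.
by rewrite -subr_eq0 addrAC subrr add0r oppr_eq0 oner_eq0.
Qed.

End Class.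
End CoreClass.

(** * Neighbourhood retractions onto the pseudo-projective planes *)

Section PseudoProjectiveRetraction.
Variable R : realType.
Local Notation V := 'rV[R]_5.
Notation x0 := (@Ordinal 5 0 isT).
Notation x1 := (@Ordinal 5 1 isT).
Notation x2 := (@Ordinal 5 2 isT).
Notation x3 := (@Ordinal 5 3 isT).
Notation x4 := (@Ordinal 5 4 isT).

Lemma dimap_x4 n (z : 'rV[R]_2) : dimap n z ord0 x4 = normsq z.
Proof. by rewrite mxE. Qed.

Lemma dimap_inj n (z w : 'rV[R]_2) : open_disk z -> dimap n z = dimap n w -> z = w.
Proof.
rewrite /open_disk/= => z1 /vec5_inj[_ _ e2 e3 e4].
have nz : 1 - normsq z != 0 by rewrite gt_eqF// subr_gt0.
move: e2 e3; rewrite -e4 => /(mulfI nz) e2 /(mulfI nz) e3.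
apply/rowP => i; case: i => [[|[|i]] Hi] //.
  by move: e2; rewrite (_ : 0 = Ordinal Hi)//; exact: val_inj.
by move: e3; rewrite (_ : 1 = Ordinal Hi)//; exact: val_inj.
Qed.

Lemma dimap_sphere n (z : 'rV[R]_2) : unit_sphere z -> core_circle (dimap n z).
Proof.
move=> z1; apply: (@ppl_boundary _ n); last by rewrite dimap_x4.
by exists z => //; exact: sphere_sub_disk.
Qed.

Lemma core_circle_compact : compact (@core_circle R).
Proof.
have -> : @core_circle R = dimap 0 @` @unit_sphere R 2.
  apply/seteqP; split => [_ [t ->]|_ [z z1 <-]]; last exact: dimap_sphere.
  exists (polar 1 t); first by rewrite /unit_sphere/= normsq_polar expr1n.
  by rewrite dimap_polar !expr1n !mul1r subrr !mul0r.
apply: continuous_compact.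
  by apply: continuous_subspaceT; exact: dimap_continuous.
apply: subclosed_compact (@closed_disk_compact R 2) _.
  exact: unit_sphere_closed.
exact: sphere_sub_disk.
Qed.

Lemma core_circle_nbhd_retract : nbhd_retract R (@core_circle R).
Proof.
pose p (v : V) : R := v ord0 x0 ^+ 2 + v ord0 x1 ^+ 2.
have cc i (v : V) : {for v, continuous (fun w : V => w ord0 i)} by apply: for_coord; exact: for_id.
have cp (v : V) : {for v, continuous p}.
  by apply: for_add; apply: for_mul; exact: cc.
pose r (v : V) : V := vec5 (v ord0 x0 / Num.sqrt (p v)) (v ord0 x1 / Num.sqrt (p v)) 0 0 1.
exists V, id, r, [set v | 0 < p v]; split.
- exact: tietze_rV.
- by apply: continuous_subspaceT => v; exact: cvg_id.
- rewrite openE => v pv; rewrite /interior/=.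
  by apply: (@near_lt R V (fun=> 0) p v _ (cp v) pv); exact: for_cst.
- by move=> _ [_ [t ->] <-]; rewrite /p/= !mxE/= cosT2D.
split.
- move=> v pv.
  have ci i : {for v, continuous (fun w : V => w ord0 i / Num.sqrt (p w))}.
    apply: for_mul; first exact: cc.
    by apply: for_inv; [rewrite gt_eqF// sqrtr_gt0|apply: for_sqrt; exact: cp].
  by apply: (for_vec5 (ci x0) (ci x1)); exact: for_cst.
- move=> v pv.
  have sp : 0 < Num.sqrt (p v) by rewrite sqrtr_gt0.
  have [|t [e1 e2]] := @angle_ex R (v ord0 x0 / Num.sqrt (p v)) (v ord0 x1 / Num.sqrt (p v)).
    by rewrite !exprMn -mulrDl exprVn sqr_sqrtr ?ltW// divff// gt_eqF.
  by exists t; rewrite /r e1 e2.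
- by move=> _ [t ->]; rewrite /r /p !mxE/= cosT2D sqrtr1 !divr1.
Qed.

(** [ppl n] is the core circle with a single 2-cell attached by [dimap n], so the construction for
    cell attachments applies. *)
Lemma ppl_nbhd_retract n : nbhd_retract R (@ppl R n).
Proof.
have -> : @ppl R n = dimap n @` @open_disk R 2 `|` @core_circle R.
  apply/seteqP; split => [_ [z zD <-]|v [[z zD <-]|/core_circle_ppl]]; last exact.
    move: zD; rewrite disk_split => -[zD|/dimap_sphere]; last by right.
    by left; exists z.
  by exists z => //; exact: open_sub_disk.
apply: attach_nbhd_retract.
- exact: norm_hausdorff.
- by apply: continuous_subspaceT; exact: dimap_continuous.
- by move=> v w vD _; exact: dimap_inj.
- by move=> _ [z zS <-]; exact: dimap_sphere.
- move=> v vD [t]; move/(congr1 (fun w : V => w ord0 x4)); rewrite dimap_x4 mxE/=.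
  by move=> e; move: vD; rewrite /open_disk/= e ltxx.
- exact: core_circle_compact.
- exact: core_circle_nbhd_retract.
Qed.

(* The openness of [Nr.1] will make the constraint imposed on the formal solutions
   a closed condition, and the closure is needed to solve it by extension. *)
Lemma ppl_retraction_ex n : exists Nr : set V * (V -> V),
  [/\ open Nr.1, @ppl R n `<=` Nr.1,
      forall v, closure Nr.1 v -> {for v, continuous Nr.2},
      forall v, closure Nr.1 v -> ppl n (Nr.2 v) &
      forall v, ppl n v -> Nr.2 v = v].
Proof.
have [|g [U [oU PU cg gP gE]]] := nbhd_retract_extend (f := fun v : V => v) (A := @ppl R n)
  (ppl_nbhd_retract n) (@ppl_compact R n) (@pseudometric_normal R V) (@ppl_closed R n)
  (continuous_subspaceT (fun x => @cvg_id _ (nbhs x))).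
  by move=> _ [v Pv <-].
have [|||d d0 dP] := @lebesgue_number R V (@ppl R n) (fun W => W `<=` U).
- exact: ppl_compact.
- by move=> W W' WW W'U; exact: subset_trans W'U.
- by move=> v /PU Uv; exists U => //; apply: open_nbhs_nbhs.
pose N := \bigcup_(v in @ppl R n) ball v (d / 2).
have oN : open N by apply: bigcup_open => v _; exact: ball_open.
have NU : closure N `<=` U.
  move=> v /(_ (ball v (d / 2)))[|w [[y Py yw] vw]]; first by apply: nbhsx_ballx; rewrite divr_gt0.
  apply: (dP y Py); rewrite (splitr d); apply: ball_triangle yw _.
  exact: ball_sym.
exists (N, g); split => //=.
- by move=> v Pv; exists v => //; apply: ballxx; rewrite divr_gt0.
- by move=> v /NU; exact: cg.
- by move=> v /NU Uv; apply: gP; exists v.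
Qed.

Definition ppl_nbhd n : set V := (sval (cid (ppl_retraction_ex n))).1.
Definition ppl_retr n : V -> V := (sval (cid (ppl_retraction_ex n))).2.

Lemma ppl_nbhd_open n : open (ppl_nbhd n).
Proof. by rewrite /ppl_nbhd; case: cid => -[N r] [] . Qed.

Lemma ppl_sub_nbhd n : ppl n `<=` ppl_nbhd n.
Proof. by rewrite /ppl_nbhd; case: cid => -[N r] [] . Qed.

Lemma ppl_retr_continuous n v : closure (ppl_nbhd n) v -> {for v, continuous (ppl_retr n)}.
Proof. by move: v; rewrite /ppl_nbhd /ppl_retr; case: cid => -[N r] [] . Qed.

Lemma ppl_retr_in n v : closure (ppl_nbhd n) v -> ppl n (ppl_retr n v).
Proof. by move: v; rewrite /ppl_nbhd /ppl_retr; case: cid => -[N r] [] . Qed.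

Lemma ppl_retr_id n v : ppl n v -> ppl_retr n v = v.
Proof. by move: v; rewrite /ppl_retr; case: cid => -[N r] [] . Qed.

End PseudoProjectiveRetraction.

(** * Lattices of continuous functions *)

Section StoneWeierstrass.
Variables (R : realType) (X : topologicalType) (S : set (X -> R)) (h : X -> R).
Hypothesis cX : compact [set: X].
Hypothesis Scts : forall f, S f -> continuous f.
Hypothesis hcts : continuous h.
Hypothesis Smax : forall f g, S f -> S g -> S (fun x => Num.max (f x) (g x)).
Hypothesis Smin : forall f g, S f -> S g -> S (fun x => Num.min (f x) (g x)).

Let fold_min (I : Type) (F : I -> X -> R) (i0 : I) (l : seq I) :
  (forall i, S (F i)) -> exists2 f, S f &
    (forall i x, List.In i (i0 :: l) -> f x <= F i x) /\
    (forall x c, (forall i, c < F i x) -> c < f x).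
Proof.
move=> SF; elim: l => [|j l [f Sf [fle flt]]].
  by exists (F i0) => //; split => // i x [<-|[]].
exists (fun x => Num.min (F j x) (f x)); first exact: Smin.
split=> [i x [<-|[<-|li]]|x c cF]; rewrite ?lt_min ?cF ?flt// ge_min ?lexx//.
- by rewrite fle ?orbT//; left.
- by rewrite fle ?orbT//; right.
Qed.

Let fold_max (I : Type) (F : I -> X -> R) (i0 : I) (l : seq I) :
  (forall i, S (F i)) -> exists2 f, S f &
    (forall i x, List.In i (i0 :: l) -> F i x <= f x) /\
    (forall x c, (forall i, F i x < c) -> f x < c).
Proof.
move=> SF; elim: l => [|j l [f Sf [fle flt]]].
  by exists (F i0) => //; split => // i x [<-|[]].
exists (fun x => Num.max (F j x) (f x)); first exact: Smax.
split=> [i x [<-|[<-|li]]|x c cF]; rewrite ?gt_max ?cF ?flt// le_max ?lexx//.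
- by rewrite fle ?orbT//; left.
- by rewrite fle ?orbT//; right.
Qed.

(** For fixed [x], a finite minimum of two-point interpolants lies below [h + e] everywhere and
    still above [h - e] at [x]. A finite maximum of such minima is within [e] of [h]. *)
Lemma lattice_dense (e : R) : 0 < e -> (exists f, S f) ->
  (forall x y d, 0 < d -> exists2 f, S f & `|f x - h x| < d /\ `|f y - h y| < d) ->
  exists2 f, S f & forall x, `|f x - h x| < e.
Proof.
move=> e0 [f0 Sf0] S2.
have [[x0 _]|nX] := pselect (exists x : X, True); last first.
  by exists f0 => // x; case: nX; exists x.
have /choice[F FP] : forall xy : X * X, exists f, S f /\
    (`|f xy.1 - h xy.1| < e /\ `|f xy.2 - h xy.2| < e).
  by move=> [x y]; have [f Sf ff] := S2 x y e e0; exists f.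
have cadd c : continuous (fun x => h x + c).
  by move=> x; apply: for_add; [exact: hcts|exact: for_cst].
have /choice[f fP] : forall x, exists f, S f /\
    ((forall z, f z < h z + e) /\ h x - e < f x).
  move=> x; pose W y := [set z | F (x, y) z < h z + e].
  have [l lP] : exists l, forall z, [set: X] z -> exists2 y, List.In y l & W y z.
    apply: compact_finite_subcover => // [y|z _].
      by apply: open_ltr_fun; [apply: Scts; case: (FP (x, y))|exact: cadd].
    by exists z; rewrite /W/=; have [_ [_ /=]] := FP (x, z); rewrite ltr_norml => /andP[_]; rewrite ltrBlDl.
  have [f Sf [f1 f2]] := @fold_min _ (fun y => F (x, y)) x l (fun y => (FP (x, y)).1).
  exists f; split => //; split => [z|].
    have [y ly Wz] := lP z I.
    by apply: le_lt_trans Wz; apply: f1; right.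
  apply: f2 => y; have [_ [/= + _]] := FP (x, y).
  by rewrite ltr_norml => /andP[]; rewrite ltrBrDl.
pose W x := [set z | h z - e < f x z].
have [l lP] : exists l, forall z, [set: X] z -> exists2 x, List.In x l & W x z.
  apply: compact_finite_subcover => // [y|z _].
    apply: open_ltr_fun; first exact: cadd.
    by apply: Scts; case: (fP y).
  by exists z; case: (fP z) => _ [].
have [g Sg [g1 g2]] := @fold_max _ f x0 l (fun y => (fP y).1).
exists g => // z; rewrite ltr_norml; apply/andP; split.
  have [y ly Wz] := lP z I; rewrite ltrBrDl.
  by apply: (lt_le_trans Wz); apply: g1; right.
rewrite ltrBlDl; apply: g2 => y; by have [_ []] := fP y.
Qed.

End StoneWeierstrass.

(** The line through the two prescribed values has real coefficients [p0] and [q0], while terms have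
    rational ones; [M] bounds the effect of the error in the slope at both nodes. *)
Lemma rat_affine_approx (R : realType) (u v a b d : R) : 0 < d -> u != v ->
  exists p q : rat, `|ratr p + ratr q * u - a| < d /\ `|ratr p + ratr q * v - b| < d.
Proof.
move=> d0 uv; have uv0 : u - v != 0 by rewrite subr_eq0.
pose q0 := (a - b) / (u - v); pose p0 := a - q0 * u.
have near_rat (c e : R) : 0 < e -> exists q : rat, `|ratr q - c| < e.
  move=> e0; have [] := @rat_in_itvoo R (c - e) (c + e); first lra.
  by move=> q; rewrite in_itv/= => /andP[? ?]; exists q; rewrite ltr_norml; apply/andP; split; lra.
pose M := 1 + `|u| + `|v|.
have M0 : 0 < M by rewrite /M; have := normr_ge0 u; have := normr_ge0 v; lra.
have [p pP] := near_rat p0 (d / 2) ltac:(lra).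
have [q qP] := near_rat q0 (d / 2 / M) ltac:(rewrite divr_gt0//; lra).
have bound w : `|w| <= M -> `|ratr p + ratr q * w - (p0 + q0 * w)| < d.
  move=> wM; have -> : ratr p + ratr q * w - (p0 + q0 * w) = (ratr p - p0) + (ratr q - q0) * w by ring.
  apply: (le_lt_trans (ler_normD _ _)); rewrite normrM.
  have : `|ratr q - q0| * `|w| <= d / 2.
    have -> : d / 2 = d / 2 / M * M by rewrite mulfVK// gt_eqF.
    by apply: ler_pM => //; exact: ltW.
  lra.
exists p, q; split.
  have -> : a = p0 + q0 * u by rewrite /p0 subrK.
  by apply: bound; rewrite /M; have := normr_ge0 v; lra.
have -> : b = p0 + q0 * v by rewrite /p0 /q0; field.
by apply: bound; rewrite /M; have := normr_ge0 u; lra.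
Qed.

(** * Valuations of formal terms *)

(* Formal expressions for ['rV_5]-valued functions.  The coefficients are rational
   in order to have only countably many terms when [J] is countable. *)
Inductive term (J : Type) :=
| Tbase of J
| Tcst of rat
| Tlin of rat & 'I_5 & 'I_5 & term J & term J
| Tmax of term J & term J
| Tsol of nat & term J.

HB.instance Definition _ (J : Type) := gen_eqMixin (term J).
HB.instance Definition _ (J : Type) := gen_choiceMixin (term J).

Section Terms.
Variables (R : realType) (J : Type).
Local Notation V := 'rV[R]_5.
Local Notation term := (term J).

Definition espace := {ptws term -> V}.

(** An elementary operation that combines addition, rational multiples and the transfer between
    coordinates, so that a single constructor yields all rational linear combinations. *)
Definition lin_op (q : rat) (i j : 'I_5) (x y : V) : V :=
  x + (ratr q * y ord0 i) *: delta_mx ord0 j.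
Definition max_op (x y : V) : V := \row_i Num.max (x ord0 i) (y ord0 i).
Definition cst_val (q : rat) : V := const_mx (ratr q).

Lemma eval_cts (t : term) : continuous (fun e : espace => e t).
Proof. exact: (@proj_continuous _ (fun _ : term => V) t). Qed.

Lemma for_lin (T : topologicalType) q i j (f g : T -> V) x :
  {for x, continuous f} -> {for x, continuous g} ->
  {for x, continuous (fun y => lin_op q i j (f y) (g y))}.
Proof.
move=> cf cg; have c1 : {for x, continuous (fun y => ratr q * g y ord0 i)}.
  by apply: for_mul; [exact: for_cst|exact: for_coord].
have c2 : {for x, continuous (fun _ : T => delta_mx ord0 j : V)} by exact: for_cst.
exact: (for_add cf (for_scale c1 c2)).
Qed.

Lemma for_maxop (T : topologicalType) (f g : T -> V) x :
  {for x, continuous f} -> {for x, continuous g} ->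
  {for x, continuous (fun y => max_op (f y) (g y))}.
Proof.
move=> cf cg; apply: for_rV => i.
have -> : (fun y => max_op (f y) (g y) ord0 i) = (fun y => Num.max (f y ord0 i) (g y ord0 i)).
  by apply/funext => y; rewrite mxE.
by apply: for_max; exact: for_coord.
Qed.

Variables (B : set V) (P : nat -> bool).
Hypothesis cB : compact B.

Definition children (t : term) : seq term :=
  match t with
  | Tlin _ _ _ t1 t2 | Tmax t1 t2 => [:: t1; t2]
  | Tsol _ t1 => [:: t1]
  | _ => [::]
  end.

(* [Tsol n t] denotes an extension over the whole space of the map [t], moved
   into [ppl n] where it is close to [ppl n].  When [P n] is false, it is pinned
   to the base point.  Only the values of [e] at the children of [t] matter. *)
Definition rel (e : term -> V) (t : term) (y : V) : Prop :=
  match t with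
  | Tbase _ => B y
  | Tcst q => y = cst_val q
  | Tlin q i j t1 t2 => y = lin_op q i j (e t1) (e t2)
  | Tmax t1 t2 => y = max_op (e t1) (e t2)
  | Tsol n t1 => if P n then ppl n y /\ (ppl_nbhd n (e t1) -> y = ppl_retr n (e t1))
                 else y = @ppl_base R
  end.

(** A compact range for each coordinate that does not depend on [P], so that valuations for
    different sets of degrees live in the same compact box. *)
Fixpoint crange (t : term) : set V :=
  match t with
  | Tbase _ => B
  | Tcst q => [set cst_val q]
  | Tlin q i j t1 t2 =>
      (fun p : V * V => lin_op q i j p.1 p.2) @` (crange t1 `*` crange t2)
  | Tmax t1 t2 => (fun p : V * V => max_op p.1 p.2) @` (crange t1 `*` crange t2)
  | Tsol n _ => ppl n
  end.

Lemma crange_compact t : compact (crange t).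
Proof.
have c12 (F : V * V -> V) (A1 A2 : set V) : continuous F -> compact A1 -> compact A2 ->
    compact (F @` (A1 `*` A2)).
  move=> cF c1 c2; apply: continuous_compact; last exact: compact_setX.
  exact: continuous_subspaceT.
elim: t => [j|q|q i j t1 c1 t2 c2|t1 c1 t2 c2|n t _] //=.
- exact: compact_set1.
- apply: c12 => // p; apply: for_lin; [exact: fst_cts|exact: snd_cts].
- apply: c12 => // p; apply: for_maxop; [exact: fst_cts|exact: snd_cts].
- exact: ppl_compact.
Qed.

Definition box : set espace := [set e | forall t, crange t (e t)].
Definition valid : set espace := [set e | forall t, rel e t (e t)].

Lemma box_compact : compact box.
Proof. exact: (@tychonoff _ (fun=> V) crange crange_compact). Qed.

Lemma espace_hausdorff : hausdorff_space espace.
Proof. by apply: hausdorff_product => _; exact: norm_hausdorff. Qed.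

Lemma rel_crange e t y : (forall t', List.In t' (children t) -> crange t' (e t')) ->
  rel e t y -> crange t y.
Proof.
case: t => [j|q|q i j t1 t2|t1 t2|n t] //=.
- move=> h ->; exists (e t1, e t2) => //=.
  by split; apply: h; [left|right; left].
- move=> h ->; exists (e t1, e t2) => //=.
  by split; apply: h; [left|right; left].
- move=> _; case: ifP => _; first by case.
  by move=> ->; exact: ppl_base_in.
Qed.

Lemma valid_sub_box : valid `<=` box.
Proof.
move=> e ve; elim => [j|q|q i j t1 c1 t2 c2|t1 c1 t2 c2|n t c].
- exact: (ve (Tbase j)).
- exact: (ve (Tcst _ q)).
- by apply: (rel_crange _ (ve (Tlin q i j t1 t2))) => t' [<-|[<-|[]]].
- by apply: (rel_crange _ (ve (Tmax t1 t2))) => t' [<-|[<-|[]]].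
- by apply: (rel_crange _ (ve (Tsol n t))) => t' [<-|[]].
Qed.

Lemma rel_open t (e : espace) (y : V) : ~ rel e t y ->
  \forall p \near (e, y), ~ rel p.1 t p.2.
Proof.
have near_neq (F : espace -> V) : {for e, continuous F} -> y <> F e ->
    \forall p \near (e, y), p.2 <> F p.1.
  move=> cF yF; have cN : {for (e, y), continuous (fun p : espace * V => `|p.2 - F p.1|)}.
    apply: for_norm; apply: for_sub; first exact: snd_cts.
    by apply: (for_comp (f := fst)) => //; exact: fst_cts.
  have h : 0 < `|y - F e| by rewrite normr_gt0 subr_eq0; apply/eqP.
  have : \forall p \near (e, y), (fun=> 0) p < `|p.2 - F p.1|.
    by apply: near_lt cN h; exact: for_cst.
  by apply: filterS => p; rewrite normr_gt0 subr_eq0 => /eqP.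
have near_closed (C : set V) : closed C -> ~ C y -> \forall p \near (e, y), ~ C p.2.
  move=> cC Cy; have nC : nbhs y (~` C) by apply: open_nbhs_nbhs; split => //; exact: closed_openC.
  exact: (@snd_cts espace V (e, y) _ nC).
have ce t' : {for e, continuous (fun e : espace => e t')} by exact: eval_cts.
case: t => [j|q|q i j t1 t2|t1 t2|n t] /=.
- by apply: near_closed; apply: compact_closed => //; exact: norm_hausdorff.
- by apply: near_neq; exact: for_cst.
- by apply: (near_neq (fun e => lin_op q i j (e t1) (e t2))); exact: for_lin.
- by apply: (near_neq (fun e => max_op (e t1) (e t2))); exact: for_maxop.
- case: ifP => _; last by apply: (near_neq (fun=> _)); exact: for_cst.
  move=> nrel; have [yP|yP] := pselect (ppl n y); last first.
    have := near_closed _ (@ppl_closed R n) yP.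
    by apply: filterS => p h [].
  have [eN|eN] := pselect (ppl_nbhd n (e t)); last by exfalso; apply: nrel.
  have yr : y <> ppl_retr n (e t) by move=> yr; apply: nrel.
  have cr : {for e, continuous (fun e : espace => ppl_retr n (e t))}.
    by apply: for_comp; [exact: ce|apply: ppl_retr_continuous; exact: subset_closure].
  have nN : nbhs (e t) (ppl_nbhd n).
    by apply: open_nbhs_nbhs; split => //; exact: ppl_nbhd_open.
  have n1 : \forall p \near (e, y), ppl_nbhd n (p.1 t).
    have : {for (e, y), continuous (fun p : espace * V => p.1 t)}.
      exact: (for_comp (@fst_cts espace V (e, y)) (ce t)).
    by move=> /(_ _ nN).
  apply: filterS2 n1 (near_neq _ cr yr) => p pN pr [_ h].
  by apply: pr; exact: h.
Qed.

Lemma rel_diag_open t (e : espace) : ~ rel e t (e t) -> \forall e' \near e, ~ rel e' t (e' t).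
Proof.
move=> /rel_open h.
have : {for e, continuous (fun e' : espace => (e', e' t))}.
  by apply: for_pair; [exact: for_id|exact: eval_cts].
by move=> /(_ _ h).
Qed.

Lemma rel_closed t : closed [set e : espace | rel e t (e t)].
Proof.
rewrite -[X in closed X]setCK; apply: open_closedC; apply: open_from_near => e.
exact: rel_diag_open.
Qed.

Lemma valid_closed : closed valid.
Proof.
have -> : valid = \bigcap_(t in [set: term]) [set e : espace | rel e t (e t)].
  by apply/seteqP; split => e h t; [move=> _|]; exact: h.
by apply: closed_bigI => t _; exact: rel_closed.
Qed.

Lemma valid_compact : compact valid.
Proof. exact: subclosed_compact valid_closed box_compact valid_sub_box. Qed.

(** The open sets where a given constraint fails cover, together with [W], the compact box; a finite
    subcover names the constraints that force a point into [W]. *)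
Lemma finite_constraints (W : set espace) : open W -> valid `<=` W ->
  exists L : seq term, forall e, box e ->
    (forall t, List.In t L -> rel e t (e t)) -> W e.
Proof.
move=> oW vW.
pose F (o : option term) : set espace :=
  if o is Some t then [set e | ~ rel e t (e t)] else W.
have [||L LP] := @compact_finite_subcover _ _ _ F box_compact.
- by case=> [t|//]; apply: closed_openC; exact: rel_closed.
- move=> e _; have [ve|/existsNP[t nt]] := pselect (valid e); last by exists (Some t).
  by exists None; exact: vW.
exists (pmap id L) => e be eL.
have [[t|] tL //= nt] := LP e be; case: nt; apply: eL.
by elim: L {LP} tL => [|[t'|] L IH] //= [|h]; [case=> ->; left|right; exact: IH|by []|exact: IH].
Qed.

End Terms.

Lemma rV_norm_lt (R : realType) n (v : 'rV[R]_n) (d : R) : 0 < d ->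
  (forall i, `|v ord0 i| < d) -> `|v| < d.
Proof.
move=> d0 h; rewrite [ltLHS]mx_normrE; apply/bigmax_ltP; split => // -[i j] _ /=.
by rewrite (ord1 i); exact: h.
Qed.

Lemma AE_sub (X Y : topologicalType) (S : set Y) (A : set X) (f : X -> Y) :
  absolute_extensor (set_type S) X -> closed A -> {within A, continuous f} ->
  (forall x, A x -> S (f x)) ->
  exists g : X -> Y, [/\ continuous g, forall x, S (g x) & forall x, A x -> g x = f x].
Proof.
move=> ae cA cf fA.
have fA' (a : A) : f (set_val a) \in S by apply: mem_set; apply: fA; exact: set_valP.
have [|g cg gf] := ae A cA (fun a => SigSub (fA' a)).
  apply: continuous_setType.
  exact: ((subspace_sigL_continuousP _ _).1 cf).
exists (fun x => set_val (g x)); split.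
- move=> x; apply: continuous_comp; [exact: cg|exact: initial_continuous].
- by move=> x; exact: set_valP.
- move=> x Ax; exact: (congr1 set_val (gf (SigSub (mem_set Ax)))).
Qed.

Lemma AE_sub_intro (X Y : topologicalType) (S : set Y) (y0 : Y) :
  (forall (A : set X) (f : X -> Y), closed A -> {within A, continuous f} ->
    (forall x, A x -> S (f x)) ->
    exists g : X -> Y, [/\ continuous g, forall x, S (g x) & forall x, A x -> g x = f x]) ->
  absolute_extensor (set_type S) X.
Proof.
move=> h A cA f cf.
have cf' : continuous (set_val \o f).
  by move=> a; apply: continuous_comp; [exact: cf|exact: initial_continuous].
have vE (a : A) : valL_ y0 (set_val \o f) (set_val a) = set_val (f a).
  by have := congr1 (fun k => k a) (valLK y0 (set_val \o f)).
have [||g [cg gS gf]] := h A (valL_ y0 (set_val \o f)) cA.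
- exact: ((subspace_valL_continuousP' _ y0 _).2 cf').
- by move=> x Ax; rewrite (vE (SigSub (mem_set Ax))); exact: set_valP.
exists (fun x => SigSub (mem_set (gS x))).
  by apply: continuous_setType.
by move=> a; apply: val_inj; rewrite /= gf ?vE//; exact: set_valP.
Qed.

(** Over [W] the map [r \o p] already extends to all of [X] as [h]. Close to [A] the extension is
    the retracted straight homotopy from [g] to [p], with a Urysohn function as time; where the time
    has reached 1 it continues as [h]. *)
Lemma close_extension (R : realType) (E : normedModType R) (X : topologicalType)
    (A W : set X) (N S : set E) (r : E -> E) (g p h : X -> E) :
  normal_space X -> closed A -> open W -> A `<=` W ->
  (forall v, N v -> {for v, continuous r} /\ S (r v)) ->
  continuous g -> continuous p -> continuous h -> (forall x, S (h x)) ->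
  (forall x, W x -> h x = r (p x)) ->
  (forall x s, W x -> 0 <= s <= 1 -> N ((1 - s) *: g x + s *: p x)) ->
  exists F : X -> E, [/\ continuous F, forall x, S (F x) & forall x, A x -> F x = r (g x)].
Proof.
move=> nX cA oW AW rN cg cp ch hS hr WN.
have dis : A `&` ~` W = set0 by apply/seteqP; split => // x [/AW].
(* The range reaches 2, so that the homotopy is complete on [l = 1], still inside [W], and the two
   closed pieces can be glued there. *)
have [l [cl l0 l2 lr]] := @urysohn_ext_itv X R nX A (~` W) 0 2 cA (open_closedC oW) dis ltac:(lra).
have l02 x : 0 <= l x <= 2.
  have : range l (l x) by exists x.
  by move=> /lr; rewrite /= in_itv.
pose f x := r ((1 - l x) *: g x + l x *: p x).
have lW x : l x <= 1 -> W x.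
  move=> lx; apply: contrapT => nW; have : l x = 2 by apply: l2; exists x.
  lra.
exists (fun x => if l x <= 1 then f x else h x).
have c1 : closed [set x | l x <= 1].
  by apply: (@closed_comp _ _ l [set y | y <= 1]); [move=> x _; exact: cl|exact: closed_le].
have c2 : closed [set x | 1 <= l x].
  by apply: (@closed_comp _ _ l [set y | 1 <= y]); [move=> x _; exact: cl|exact: closed_ge].
have lN x : l x <= 1 -> N ((1 - l x) *: g x + l x *: p x).
  by move=> lx; apply: WN; [exact: lW|case/andP: (l02 x) => -> _].
split.
- suff : {within [set: X], continuous (fun x => if l x <= 1 then f x else h x)}.
    by move=> hh; apply: (continuous_subspace_setT _).2.
  have -> : [set: X] = [set x | l x <= 1] `|` [set x | 1 <= l x].
    by apply/seteqP; split => // x _; have [|/ltW] := leP (l x) 1; [left|right].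
  apply: withinU_continuous => //.
  + apply/withinP => x /= lx; rewrite lx => U nU.
    have cf : {for x, continuous f}.
      apply: for_comp; last by have [] := rN _ (lN x lx).
      apply: for_add; apply: for_scale; [|exact: cg|exact: cl|exact: cp].
      by apply: for_sub; [exact: for_cst|exact: cl].
    have : \forall y \near x, U (f y) by exact: cf.
    by apply: filterS => y Uy ->.
  + apply/withinP => x /= lx U nU.
    have {}nU : nbhs (h x) U.
      move: nU; case: ifPn => // lx1.
      have e : l x = 1 by apply/eqP; rewrite eq_le lx1.
      by rewrite /f e subrr scale0r add0r scale1r -hr//; exact: lW.
    have : \forall y \near x, U (h y) by exact: ch.
    apply: filterS => y Uy ly; case: ifPn => // ly1.
    have e : l y = 1 by apply/eqP; rewrite eq_le ly1.
    by rewrite /f e subrr scale0r add0r scale1r -hr//; exact: lW.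
- by move=> x; case: ifPn => // lx; have [] := rN _ (lN x lx).
- move=> x Ax; have e : l x = 0 by apply: l0; exists x.
  by rewrite e ler01 /f e subr0 scale1r scale0r addr0.
Qed.

(** * Density of the terms *)

Section TermDensity.
Variables (R : realType) (J : Type).
Local Notation V := 'rV[R]_5.
Variables (B : set V) (P : nat -> bool).
Hypothesis cB : compact B.
Let U := set_type (@valid R J B P).

Lemma U_compact : compact [set: U].
Proof. by apply: compact_setType; exact: valid_compact. Qed.

Lemma U_hausdorff : hausdorff_space U.
Proof. by apply: hausdorff_setType; exact: espace_hausdorff. Qed.

Lemma U_eval (t : term J) : continuous (fun u : U => set_val u t).
Proof.
move=> u; apply: (@continuous_comp _ _ _ (@set_val _ (valid B P)) (fun e : espace R J => e t)).
  exact: initial_continuous.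
exact: eval_cts.
Qed.

Let U_rel (u : U) t : rel B P (set_val u) t (set_val u t).
Proof. exact: (set_valP u). Qed.

Let scal : set (U -> R) := [set f | exists t, forall u : U, f u = set_val u t ord0 ord0].

Let scal_affine p q t i : scal (fun u : U => ratr p + ratr q * set_val u t ord0 i).
Proof.
exists (Tlin q i ord0 (Tcst _ p) t) => u.
by rewrite (U_rel u (Tlin _ _ _ _ _)) /lin_op (U_rel u (Tcst _ p)) !mxE/= mulr1.
Qed.

Let scal_max f g : scal f -> scal g -> scal (fun u : U => Num.max (f u) (g u)).
Proof.
move=> [s fs] [t gt]; exists (Tmax s t) => u.
by rewrite (U_rel u (Tmax s t)) mxE fs gt.
Qed.

Let scal_opp f : scal f -> scal (fun u : U => - f u).
Proof.
move=> [t ft]; have [s hs] := scal_affine 0 (-1) t ord0; exists s => u.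
by rewrite -hs raddf0 add0r rmorphN1 mulN1r ft.
Qed.

Let scal_min f g : scal f -> scal g -> scal (fun u : U => Num.min (f u) (g u)).
Proof.
move=> sf sg; have [t ht] := scal_opp (scal_max (scal_opp sf) (scal_opp sg)).
by exists t => u; rewrite -ht oppr_max !opprK.
Qed.

Lemma scalar_term_dense (h : U -> R) (d : R) : continuous h -> 0 < d ->
  exists t, forall u : U, `|set_val u t ord0 ord0 - h u| < d.
Proof.
move=> ch d0.
have [|||f [t ft] fd] := @lattice_dense R U scal h U_compact _ ch scal_max scal_min d d0.
- move=> f [t ft]; have -> : f = fun u : U => set_val u t ord0 ord0 by apply/funext.
  by move=> u; apply: for_coord; exact: U_eval.
- by have [t ht] := scal_affine 0 0 (Tcst _ 0) ord0; eexists; exists t; exact: ht.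
- move=> u v e e0; have [uv|uv] := pselect (u = v).
    (* For equal points a single value is prescribed and a constant suffices; at the auxiliary node
       0 the affine function is its constant coefficient. *)
    have [p [q [hp _]]] := @rat_affine_approx R 0 1 (h u) 0 e e0 ltac:(by rewrite eq_sym oner_eq0).
    exists (fun w : U => ratr p + ratr 0 * set_val w (Tcst _ 0) ord0 ord0); first exact: scal_affine.
    by move: hp; rewrite -uv raddf0 !mul0r mulr0.
  have [t [i ti]] : exists t i, set_val u t ord0 i != set_val v t ord0 i.
    apply: contrapT => n; apply: uv; apply: val_inj; apply/funext => t; apply/rowP => i.
    by apply: contrapT => /eqP ti; apply: n; exists t, i.
  have [p [q [hp hq]]] := @rat_affine_approx R _ _ (h u) (h v) e e0 ti.
  by exists (fun w : U => ratr p + ratr q * set_val w t ord0 i).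
by exists t => u; rewrite -ft; exact: fd.
Qed.

Lemma term_dense (g : U -> V) (d : R) : continuous g -> 0 < d ->
  exists t, forall u : U, `|set_val u t - g u| < d.
Proof.
move=> cg d0.
have /choice[s sP] : forall i, exists t, forall u : U, `|set_val u t ord0 ord0 - g u ord0 i| < d.
  by move=> i; apply: scalar_term_dense => //; move=> u; apply: for_coord; exact: cg.
(* Starting from the zero vector, each step adds the leading coordinate of the scalar term [s i] to
   coordinate [i]. *)
pose t := foldr (fun i t => Tlin 1 ord0 i t (s i)) (Tcst J 0) (index_enum 'I_5).
exists t => u.
have tE : set_val u t = \sum_i (set_val u (s i) ord0 ord0) *: delta_mx ord0 i.
  rewrite /t; elim: (index_enum _) => [|i l IH]/=.
    by rewrite big_nil (U_rel u (Tcst _ 0)); apply/rowP => k; rewrite !mxE raddf0.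
  by rewrite big_cons (U_rel u (Tlin _ _ _ _ _)) /lin_op IH rmorph1 mul1r addrC.
apply: rV_norm_lt => // i; rewrite mxE tE summxE (bigD1 i)//= big1 ?addr0.
  by rewrite !mxE !eqxx mulr1; exact: sP.
by move=> k ki; rewrite !mxE eqxx eq_sym (negbTE ki) mulr0.
Qed.

(* The formal solution of a term that is close to a map extends an approximation
   of it, and close maps into [ppl n] have the same extension properties. *)
Lemma valid_AE n : P n -> absolute_extensor (set_type (@ppl R n)) U.
Proof.
move=> Pn; apply: (AE_sub_intro (@ppl_base R)) => A f cA cf fA.
have nU : normal_space U by apply: compact_normal; [exact: U_hausdorff|exact: U_compact].
have bf : exists M, forall u : U, A u -> `|f u| <= M.
  have [M [_ /(_ (M + 1))]] := compact_bounded (@ppl_compact R n).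
  by rewrite ltrDl ltr01 => /(_ erefl) bM; exists (M + 1) => u Au; apply: bM; exact: fA.
have [g cg gf] := @tietze_rV R 5 _ nU _ _ cA cf bf.
have [|||d d0 dN] := @lebesgue_number R V (@ppl R n) (fun W => W `<=` ppl_nbhd n).
- exact: ppl_compact.
- by move=> W W' WW W'U; exact: subset_trans W'U.
- move=> v /ppl_sub_nbhd Uv; exists (ppl_nbhd n) => //.
  by apply: open_nbhs_nbhs; split => //; exact: ppl_nbhd_open.
have [t tg] := @term_dense g (d / 2) cg ltac:(by rewrite divr_gt0).
(* Here [g] is within [d / 2] of [ppl n] and the term within [d / 2] of [g], so the segment between
   them stays in a ball of radius [d] around a point of [ppl n]. *)
pose W := g @^-1` (\bigcup_(v in @ppl R n) ball v (d / 2)).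
have WN (u : U) s : W u -> 0 <= s <= 1 -> ppl_nbhd n ((1 - s) *: g u + s *: set_val u t).
  move=> [v Pv vu] s01; apply: (dN v Pv).
  rewrite -ball_normE/=.
  have -> : v - ((1 - s) *: g u + s *: set_val u t) = (v - g u) - s *: (set_val u t - g u).
    by apply/rowP => i; rewrite !mxE; ring.
  apply: (le_lt_trans (ler_normB _ _)); rewrite (splitr d); apply: ltrD.
    by move: vu; rewrite -ball_normE.
  rewrite normrZ; apply: le_lt_trans (tg u).
  by case/andP: s01 => s0 s1; rewrite ger0_norm// ler_piMl.
have [|||||||||F [cF FS FE]] := @close_extension R V U A W (ppl_nbhd n) (ppl n) (ppl_retr n)
  g (fun u : U => set_val u t) (fun u : U => set_val u (Tsol n t)) nU cA.
- apply: open_comp; first by move=> u _; exact: cg.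
  by apply: bigcup_open => v _; exact: ball_open.
- move=> u Au; exists (f u); first exact: fA.
  by rewrite gf//; apply: ballxx; rewrite divr_gt0.
- move=> v /subset_closure Nv; split; [exact: ppl_retr_continuous|exact: ppl_retr_in].
- exact: cg.
- exact: U_eval.
- exact: U_eval.
- by move=> u; have := U_rel u (Tsol n t); rewrite /= Pn => -[].
- move=> u Wu; have := U_rel u (Tsol n t); rewrite /= Pn => -[_]; apply.
  by have := WN u 1 Wu; rewrite subrr scale0r add0r scale1r ler01 lexx; apply.
- exact: WN.
exists F; split => // u Au; rewrite FE// gf// ppl_retr_id//; exact: fA.
Qed.

End TermDensity.

Lemma continuous_ptws (X Y : topologicalType) (I : Type) (F : X -> {ptws I -> Y}) :
  (forall i, continuous (fun x => F x i)) -> continuous F.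
Proof.
move=> cF x; apply/cvg_sup => i U.
have /= -> := @nbhsE (initial_topology (fun f : {ptws I -> Y} => f i)) (F x).
case=> B [[C oC <- CF]] /filterS; apply; apply: cF.
by apply: open_nbhs_nbhs.
Qed.

(** * Maps into the space of valuations *)

Section TermMaps.
Variables (R : realType) (J : Type).
Local Notation V := 'rV[R]_5.
Variables (B : set V) (P : nat -> bool).
Let U := set_type (@valid R J B P).

Section Construction.
Variable X : topologicalType.
Hypothesis cX : compact [set: X].
Hypothesis hX : hausdorff_space X.
Hypothesis XAE : forall n, P n -> absolute_extensor (set_type (@ppl R n)) X.
Variable f : J -> X -> V.
Hypothesis fcts : forall j, continuous (f j).
Hypothesis fB : forall j x, B (f j x).

Definition solution n (g : X -> V) : set (X -> V) :=
  [set h | [/\ continuous h, forall x, ppl n (h x) &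
             forall x, ppl_nbhd n (g x) -> h x = ppl_retr n (g x)]].

Lemma solution_ex n g : P n -> continuous g -> exists h, solution n g h.
Proof.
move=> Pn cg.
have cA : closed (g @^-1` closure (ppl_nbhd n)).
  by apply: closed_comp; [move=> x _; exact: cg|exact: closed_closure].
have [||h [ch hP hE]] := AE_sub (f := fun x => ppl_retr n (g x)) (XAE Pn) cA.
- apply/withinP => x Nx W nW.
  have cr : {for x, continuous (fun x => ppl_retr n (g x))}.
    by apply: for_comp; [exact: cg|exact: ppl_retr_continuous].
  have : \forall y \near x, W (ppl_retr n (g y)) by exact: cr.
  by apply: filterS => y Wy _.
- by move=> x; exact: ppl_retr_in.
by exists h; split => // x Nx; apply: hE; exact: subset_closure.
Qed.

Fixpoint term_map (t : term J) : X -> V :=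
  match t with
  | Tbase j => f j
  | Tcst q => fun=> cst_val R q
  | Tlin q i j t1 t2 => fun x => lin_op q i j (term_map t1 x) (term_map t2 x)
  | Tmax t1 t2 => fun x => max_op (term_map t1 x) (term_map t2 x)
  | Tsol n t1 => if P n then xget (fun=> @ppl_base R) (solution n (term_map t1))
                 else fun=> @ppl_base R
  end.

Lemma term_map_continuous t : continuous (term_map t).
Proof.
elim: t => [j|q|q i j t1 c1 t2 c2|t1 c1 t2 c2|n t ct] /=.
- exact: fcts.
- by move=> x; exact: for_cst.
- by move=> x; apply: for_lin; [exact: c1|exact: c2].
- by move=> x; apply: for_maxop; [exact: c1|exact: c2].
- case: ifP => Pn; last by move=> x; exact: for_cst.
  by case: xgetP => [h -> []//|/(_ _)]; have [h hs] := solution_ex Pn ct => /(_ h).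
Qed.

Lemma term_map_rel x t : rel B P (fun t => term_map t x) t (term_map t x).
Proof.
case: t => [j|q|q i j t1 t2|t1 t2|n t] //=.
case Pn: (P n) => //.
have [h hs] := solution_ex Pn (@term_map_continuous t).
by case: xgetP => [h1 _ [_ h2 h3]|/(_ h)//]; split; [exact: h2|exact: h3].
Qed.

Lemma valid_map : exists2 F : X -> U, continuous F &
  forall j x, set_val (F x) (Tbase j) = f j x.
Proof.
have vF x : ((fun t => term_map t x) : espace R J) \in valid B P.
  by apply: mem_set => t; exact: term_map_rel.
exists (fun x => SigSub (vF x)) => //.
apply: continuous_setType; apply: continuous_ptws => t; exact: term_map_continuous.
Qed.

End Construction.

(** A single valuation involves no continuity, so the formal solutions are chosen value by value. *)
Lemma valid_nonempty v0 : B v0 -> exists e, @valid R J B P e.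
Proof.
move=> Bv0; pose e := fix e (t : term J) : V :=
  match t with
  | Tbase j => v0
  | Tcst q => cst_val R q
  | Tlin q i j t1 t2 => lin_op q i j (e t1) (e t2)
  | Tmax t1 t2 => max_op (e t1) (e t2)
  | Tsol n t1 => if P n then
      if pselect (ppl_nbhd n (e t1)) then ppl_retr n (e t1) else @ppl_base R
    else @ppl_base R
  end.
exists e => -[j|q|q i j t1 t2|t1 t2|n t] //=.
case: (P n) => //; case: pselect => //= h; split => //.
- by apply: ppl_retr_in; exact: subset_closure.
- exact: ppl_base_in.
Qed.

Lemma dfwith_cts (t : term J) :
  continuous (fun p : espace R J * V => dfwith p.1 t p.2 : espace R J).
Proof.
apply: continuous_ptws => s p.
have [<-|ts] := eqVneq t s.
  have -> : (fun p : espace R J * V => dfwith p.1 t p.2 t) = snd.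
    by apply/funext => q; rewrite dfwithin.
  exact: snd_cts.
have -> : (fun p : espace R J * V => dfwith p.1 t p.2 s) = fun p => p.1 s.
  by apply/funext => q; rewrite dfwithout.
exact: (for_comp (@fst_cts (espace R J) V p) (@eval_cts R J s p.1)).
Qed.

End TermMaps.

(** * Finite stages *)

Lemma tietze_within (R : realType) n (T : topologicalType) (K C : set T) (f : T -> 'rV[R]_n) :
  compact K -> hausdorff_space T -> closed C -> C `<=` K -> {within C, continuous f} ->
  (exists M, forall x, C x -> `|f x| <= M) ->
  exists2 g, {within K, continuous g} & forall x, C x -> g x = f x.
Proof.
move=> cK hT cC CK cf [M fM].
pose X := set_type K; pose i : X -> T := set_val.
have ci : continuous i by exact: initial_continuous.
have nX : normal_space X.
  by apply: compact_normal; [exact: hausdorff_setType|exact: compact_setType].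
have cf' : {within i @^-1` C, continuous (f \o i)}.
  apply/withinP => x Cx W nW.
  have := (withinP _ _).1 cf (i x) Cx W nW.
  by move=> h; exact: (ci x _ h).
have [||g cg gf] := @tietze_rV R n X nX _ _ _ cf'.
- by apply: closed_comp => // x _; exact: ci.
- by exists M => x Cx; exact: fM.
exists (valL_ 0 g); first exact: ((subspace_valL_continuousP' _ 0 g).2 cg).
move=> x Cx; have xK : x \in K by apply: mem_set; exact: CK.
have : valL_ 0 g (i (SigSub xK)) = g (SigSub xK).
  by have := congr1 (fun k => k (SigSub xK)) (valLK 0 g).
by move=> ->; rewrite gf.
Qed.

Section NonExtension.
Variables (R : realType) (n : nat).
Hypothesis pn : prime n.+1.
Local Notation V := 'rV[R]_5.
Notation x4 := (@Ordinal 5 4 isT).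
Local Notation term := (term unit).
Local Notation espace := (espace R unit).
Let B : set V := ppl 0.
(** [ppl k] has degree [k.+1], so these are exactly the degrees below the prime [n.+1]. *)
Let P k := (k < n)%N.
Let b : term := Tbase tt.
Local Notation rel := (@rel R unit B P).
Local Notation valid := (@valid R unit B P).
Local Notation box := (@box R unit B).
Let cB : compact B. Proof. exact: ppl_compact. Qed.
Variable e0 : espace.
Hypothesis ve0 : valid e0.

(** Children come after their parents. Hence no constraint in the tail mentions the head, unless the
    head occurs there again, and the head coordinate can be forgotten first. *)
Fixpoint closed_list (L : seq term) : Prop :=
  if L is t :: L' then
    (forall t', List.In t' (children t) -> List.In t' L') /\ closed_list L'
  else True.

Lemma closed_list_children L t t' : closed_list L -> List.In t L ->
  List.In t' (children t) -> List.In t' L.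
Proof.
elim: L => //= s L IH [sL cL] [<-|tL] t't; right; [exact: sL|exact: IH].
Qed.

Lemma closed_list_cat L1 L2 : closed_list L1 -> closed_list L2 -> closed_list (L1 ++ L2).
Proof.
elim: L1 => //= t L1 IH [tL cL] c2; split; last exact: IH.
by move=> t' /tL h; apply: List.in_or_app; left.
Qed.

Fixpoint subterms (t : term) : seq term :=
  t :: match t with
  | Tlin _ _ _ t1 t2 | Tmax t1 t2 => subterms t1 ++ subterms t2
  | Tsol _ t1 => subterms t1
  | _ => [::]
  end.

Lemma subterms_in t : List.In t (subterms t).
Proof. by case: t => *; left. Qed.

Lemma subterms_closed t : closed_list (subterms t).
Proof.
elim: t => [j|q|q i j t1 c1 t2 c2|t1 c1 t2 c2|k t ct] //=.
- split; last exact: closed_list_cat.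
  by move=> t [<-|[<-|[]]]; apply: List.in_or_app; [left|right]; exact: subterms_in.
- split; last exact: closed_list_cat.
  by move=> t [<-|[<-|[]]]; apply: List.in_or_app; [left|right]; exact: subterms_in.
- by split=> // t' [<-|[]]; exact: subterms_in.
Qed.

Lemma closed_list_ex (L : seq term) :
  exists2 L', closed_list L' & forall t, List.In t L -> List.In t L'.
Proof.
elim: L => [|t L [L' cL' LL']]; first by exists [::].
exists (subterms t ++ L'); first by apply: closed_list_cat => //; exact: subterms_closed.
by move=> t' [<-|/LL' h]; apply: List.in_or_app; [left; exact: subterms_in|right].
Qed.

(* The tower of spaces interpolating between [ppl 0] (no constraints) and [valid]. *)
Definition stage (L : seq term) : set espace :=
  [set e | [/\ B (e b), forall t, List.In t L -> rel e t (e t) &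
              forall t, ~ List.In t L -> t <> b -> e t = e0 t]].

Lemma stage_box L : closed_list L -> stage L `<=` box.
Proof.
move=> cL e [eb eL eN] t.
have [tL|tL] := pselect (List.In t L); last first.
  have [->//|tb] := pselect (t = b).
  by rewrite eN//; exact: (valid_sub_box ve0).
elim: L cL eL t tL {eN} => //= s L IH [sL cL] eL t.
have {}IH := IH cL (fun t tL => eL t (or_intror tL)).
move=> [<-|]; last exact: IH.
apply: (rel_crange _ (eL s (or_introl erefl))) => t' /sL; exact: IH.
Qed.

Lemma stage_compact L : closed_list L -> compact (stage L).
Proof.
move=> cL; apply: subclosed_compact (box_compact cB) (stage_box cL).
have -> : stage L = [set e : espace | B (e b)] `&`
    \bigcap_(t in [set t | List.In t L]) [set e : espace | rel e t (e t)] `&`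
    \bigcap_(t in [set t | ~ List.In t L /\ t <> b]) ((fun e : espace => e t) @^-1` [set e0 t]).
  apply/seteqP; split => e.
    by move=> [h1 h2 h3]; split; [split => // t; exact: h2|move=> t []; exact: h3].
  by move=> [[h1 h2] h3]; split => // t h h'; exact: h3.
apply: closedI; [apply: closedI|].
- apply: (@closed_comp _ _ (fun e : espace => e b) B).
    by move=> x _; exact: eval_cts.
  exact: ppl_closed.
- by apply: closed_bigI => t _; exact: rel_closed.
- apply: closed_bigI => t _; apply: closed_comp; first by move=> x _; exact: eval_cts.
  by apply: compact_closed; [exact: norm_hausdorff|exact: compact_set1].
Qed.

Lemma rel_ext (e e' : espace) t y :
  (forall t', List.In t' (children t) -> e t' = e' t') -> rel e t y -> rel e' t y.
Proof.
case: t => [j|q|q i j t1 t2|t1 t2|k t] //= h.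
- by rewrite (h t1 (or_introl erefl)) (h t2 (or_intror (or_introl erefl))).
- by rewrite (h t1 (or_introl erefl)) (h t2 (or_intror (or_introl erefl))).
- by rewrite (h t (or_introl erefl)).
Qed.

Lemma rel_fibre (e : espace) t : t <> b ->
  (exists y, [set y | rel e t y] = [set y]) \/
  (exists k, (k < n)%N /\ [set y | rel e t y] = ppl k).
Proof.
case: t => [[]//|q|q i j t1 t2|t1 t2|k t] _ /=; try by left; eexists.
rewrite /P; case kn: (k < n)%N; last by left; eexists.
have [N|N] := pselect (ppl_nbhd k (e t)).
  left; exists (ppl_retr k (e t)); apply/seteqP; split=> [y [_]/(_ N)//|y /= ->].
  by split => //; apply: ppl_retr_in; exact: subset_closure.
by right; exists k; split => //; apply/seteqP; split => [y []|y].
Qed.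

Let A : set espace := [set e : espace | e b ord0 x4 = 1].
Let k (v w : espace) := @core_cocycle R n (v b) (w b).

(** During the descent the cocycle keeps its values over the boundary circle, where it is the core
    class of the base coordinate; this is what makes the last stage contradictory. *)
Definition compatible (L : seq term) (c : espace -> espace -> 'F_n.+1) :=
  forall e, stage L e -> A e -> exists2 U, nbhs e U &
    forall v w, U v -> U w -> stage L v -> stage L w -> A v -> A w -> c v w = k v w.

Lemma base_core (e : espace) : B (e b) -> A e -> core_circle (e b).
Proof. by move=> eb eA; exact: ppl_boundary eb eA. Qed.

Let k_cocycle (S : set espace) : (forall e, S e -> B (e b)) -> cocycle (S `&` A) k.
Proof.
move=> SB; apply: (cocycle_pullback (h := fun e : espace => e b) _ _ (core_cocycleP pn)).
  by apply: continuous_subspaceT; exact: eval_cts.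
by move=> _ [e [Se Ae] <-]; apply: core_circle_ppl; apply: base_core => //; exact: SB.
Qed.

(** Overwriting the coordinate [t] maps the pairs of a valuation in the lower stage and an
    admissible value to the upper stage. The fibre of admissible values is a point or some [ppl k]
    of degree below the prime, so the cocycle pulled back to these pairs descends. *)
Lemma stage_descent_new t L c : closed_list (t :: L) -> ~ List.In t L -> t <> b ->
  cocycle (stage (t :: L)) c -> compatible (t :: L) c ->
  exists2 c', cocycle (stage L) c' & compatible L c'.
Proof.
move=> [tL cL] ntL tb cc comp.
pose phi (u : espace * V) : espace := dfwith u.1 t u.2.
have cphi : continuous phi by exact: dfwith_cts.
have phib u : phi u b = u.1 b by rewrite /phi dfwithout//; apply/eqP.
have phiZ u : total_rel (stage L) (fun e y => rel e t y) u -> stage (t :: L) (phi u).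
  move=> [[h1 h2 h3] h4]; split.
  - by rewrite phib.
  - move=> s [<-|sL].
      rewrite {2}/phi dfwithin; apply: rel_ext h4 => t' tt'.
      by rewrite /phi dfwithout//; apply/eqP => tt''; apply: ntL; rewrite tt''; exact: tL.
    have ts : t <> s by move=> ts; apply: ntL; rewrite ts.
    rewrite {2}/phi dfwithout; last exact/eqP.
    apply: rel_ext (h2 s sL) => t' tt'.
    rewrite /phi dfwithout//; apply/eqP => tt''; apply: ntL; rewrite tt''.
    exact: closed_list_children sL tt'.
  - move=> s sL sb; rewrite /phi dfwithout; last by apply/eqP => ts; apply: sL; left.
    by apply: h3 => // sL'; apply: sL; right.
have relC e y : stage L e -> rel e t y -> crange B t y.
  by move=> /(stage_box cL) be; apply: rel_crange => t' _; exact: be.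
have fib e : stage L e -> [/\ exists y, rel e t y, connected [set y | rel e t y] &
    acyclic 'F_n.+1 [set y | rel e t y]].
  move=> _; have [[y yE]|[j [jn jE]]] := rel_fibre e tb.
    rewrite yE; split; [by exists y; have : [set y] y by []; rewrite -yE|exact: connected1|].
    by apply: acyclic_subsingleton => u v -> ->.
  rewrite jE; split; [|exact: ppl_connected|by apply: ppl_acyclic].
  by exists (@ppl_base R); have := @ppl_base_in R j; rewrite -jE.
have [|||c' cc' compc'] := @cocycle_descent 'F_n.+1 R espace V (stage L) (crange B t)
  (fun e y => rel e t y) uniform_regular (stage_compact cL) (@crange_compact R unit B cB t) relC
  _ (fun e se => let: And3 h _ _ := fib e se in h) (fun e se => let: And3 _ h _ := fib e se in h)
  (fun e se => let: And3 _ _ h := fib e se in h) (fun u v => c (phi u) (phi v)) _ A k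
  (k_cocycle (fun e (se : stage L e) => let: And3 h _ _ := se in h)) .
- move=> e y _ ny; exists [set q : espace * V | ~ rel q.1 t q.2]; first exact: rel_open.
  by move=> e' y' h _.
- apply: cocycle_pullback cc; first exact: continuous_subspaceT.
  by move=> _ [u Zu <-]; exact: phiZ.
- move=> u Zu Au; have Aphi : A (phi u) by rewrite /A/= phib.
  have [U nU UP] := comp _ (phiZ u Zu) Aphi.
  exists (phi @^-1` U); first exact: (cphi u).
  move=> v w Uv Uw Zv Zw Av Aw.
  rewrite UP//; rewrite /A/= ?phib//; first by rewrite /k !phib.
  + exact: phiZ.
  + exact: phiZ.
by exists c'.
Qed.

Lemma stage_descent L c : closed_list L -> cocycle (stage L) c -> compatible L c ->
  exists2 c', cocycle (stage [::]) c' & compatible [::] c'.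
Proof.
elim: L c => [|t L IH] c; first by exists c.
move=> /[dup] ctL [_ cL] cc comp.
(* A repeated term, or the base term, whose constraint is built into every stage, leaves the stage
   unchanged. *)
have [tn|tn] := pselect (List.In t L \/ t = b); last first.
  have [||c' cc' comp'] := stage_descent_new ctL _ _ cc comp.
  - by move=> h; apply: tn; left.
  - by move=> h; apply: tn; right.
  exact: IH cc' comp'.
have E : stage (t :: L) = stage L.
  apply/seteqP; split => e [h1 h2 h3]; split => //.
  - by move=> s sL; apply: h2; right.
  - move=> s sL sb; apply: h3 => // -[ts|//].
    by subst s; case: tn.
  - move=> s [<-|]; last exact: h2.
    by case: tn => [|->]; [exact: h2|exact: h1].
  - by move=> s sL; apply: h3 => sL'; apply: sL; right.
by apply: (IH c) => //; move: cc comp; rewrite /compatible E.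
Qed.

(** Without constraints the stage is a copy of the disk [ppl 0]. A potential there restricts to one
    for the core class on the boundary circle, which has none. *)
Lemma stage_nil_contra c : cocycle (stage [::]) c -> compatible [::] c -> False.
Proof.
move=> cc comp.
pose psi (y : V) : espace := dfwith e0 b y.
have cpsi : continuous psi.
  move=> y.
  have h : {for y, continuous (fun y : V => (e0, y))}.
    by apply: for_pair; [exact: for_cst|exact: for_id].
  exact: (for_comp h (@dfwith_cts R unit b (e0, y))).
have psib y : psi y b = y by rewrite /psi dfwithin.
have psiZ y : B y -> stage [::] (psi y).
  move=> By; split; [by rewrite psib|by []|].
  by move=> t _ tb; rewrite /psi dfwithout//; apply/eqP => /esym.
have [|g gP] := @ppl_acyclic R n.+1 0 pn (prime_gt1 pn) (fun y z => c (psi y) (psi z)).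
  apply: cocycle_pullback cc; first exact: continuous_subspaceT.
  by move=> _ [y By <-]; exact: psiZ.
apply: (@core_cocycle_nontrivial R n pn g) => y Cy.
have By : B y by exact: core_circle_ppl.
have CA z : core_circle z -> A (psi z).
  by move=> [t ->]; rewrite /A/= psib mxE.
have [U nU UP] := gP y By.
have [W nW WP] := comp _ (psiZ y By) (CA y Cy).
exists (U `&` psi @^-1` W); first by apply: filterI => //; exact: (cpsi y).
move=> u v [Uu Wu] [Uv Wv] Cu Cv.
rewrite -UP//; [|exact: core_circle_ppl|exact: core_circle_ppl].
have := WP _ _ Wu Wv (psiZ u (@core_circle_ppl R 0 _ Cu)) (psiZ v (@core_circle_ppl R 0 _ Cv)) (CA _ Cu) (CA _ Cv).
by rewrite /k !psib => ->.
Qed.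

End NonExtension.

(** * An extension problem without solution *)

Section NotExtensor.
Variables (R : realType) (n : nat).
Hypothesis pn : prime n.+1.
Local Notation V := 'rV[R]_5.
Notation x4 := (@Ordinal 5 4 isT).
Local Notation espace := (espace R unit).
Let P k := (k < n)%N.
Let b : term unit := Tbase tt.
Local Notation valid := (@valid R unit (@ppl R 0) P).
Local Notation box := (@box R unit (@ppl R 0)).
Let cB : compact (@ppl R 0). Proof. exact: ppl_compact. Qed.

Lemma valid_not_AE : ~ absolute_extensor (set_type (@ppl R n)) (set_type valid).
Proof.
move=> ae; pose i : set_type valid -> espace := set_val.
have ci : continuous i by exact: initial_continuous.
have hE : hausdorff_space espace := @espace_hausdorff R unit.
pose A : set espace := [set e : espace | e b ord0 x4 = 1].
have cA : closed A.
  apply: (@closed_comp _ _ (fun e : espace => e b ord0 x4) [set 1]).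
    by move=> x _; apply: for_coord; exact: eval_cts.
  exact: closed_eq.
have coreA e : box e -> A e -> core_circle (e b).
  by move=> be Ae; apply: ppl_boundary Ae; exact: (be b).
have vbox : valid `<=` box by exact: valid_sub_box.
have [|||g [cg gP gA]] := AE_sub (f := fun u => i u b) ae (A := i @^-1` A).
- by apply: closed_comp => // x _; exact: ci.
- by apply: continuous_subspaceT => u; exact: (for_comp (ci u) (@eval_cts R unit b (i u))).
- move=> u Au; apply: core_circle_ppl; apply: coreA => //; apply: vbox.
  exact: set_valP.
(* The base coordinate is prescribed over all of [A] in the box, not only at valid points, so that
   the later extension still agrees with it on a finite stage. *)
pose G (e : espace) : V := if e b ord0 x4 == 1 then e b else valL_ 0 g e.
have gE e (ve : e \in valid) : valL_ 0 g e = g (SigSub ve).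
  by have := congr1 (fun k => k (SigSub ve)) (valLK 0 g).
have GA e : A e -> G e = e b by rewrite /A/= /G => ->; rewrite eqxx.
have Gv e : valid e -> G e = valL_ 0 g e.
  move=> ve; rewrite /G; case: eqP => // Ae.
  by rewrite (gE e (mem_set ve)) gA.
pose C := valid `|` (box `&` A).
have cC : closed C.
  apply: closedU; first exact: valid_closed.
  by apply: closedI => //; apply: compact_closed => //; exact: box_compact.
have Cbox : C `<=` box by move=> e [/vbox|[]].
have GP e : C e -> ppl n (G e).
  move=> [ve|[be Ae]]; last by rewrite GA//; apply: core_circle_ppl; exact: coreA.
  by rewrite Gv// (gE e (mem_set ve)).
have cG : {within C, continuous G}.
  apply: withinU_continuous.
  - exact: valid_closed.
  - by apply: closedI => //; apply: compact_closed => //; exact: box_compact.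
  - have := (@subspace_valL_continuousP' _ valid V 0 g).2 cg.
    apply: subspace_eq_continuous => e /set_mem ve.
    by rewrite /from_subspace Gv.
  - have : {within box `&` A, continuous (fun e : espace => e b)}.
      by apply: continuous_subspaceT; exact: eval_cts.
    apply: subspace_eq_continuous => e /set_mem [_ Ae].
    by rewrite /from_subspace GA.
have [M [_ /(_ (M + 1))]] := compact_bounded (@ppl_compact R n).
rewrite ltrDl ltr01 => /(_ erefl) bM.
have bG : exists N, forall x, C x -> `|G x| <= N.
  by exists (M + 1) => x Cx; apply: bM; exact: GP.
have [H cH HG] := tietze_within (box_compact cB) hE cC Cbox cG bG.
(* The extension [H] takes values in the open set [ppl_nbhd n] near valid points; finitely many
   constraints will force this, after which [ppl_retr] brings the values into [ppl n]. *)
pose W : set espace := interior [set e : espace | box e -> ppl_nbhd n (H e)].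
have nH e : C e -> nbhs (H e) (ppl_nbhd n).
  move=> Ce; apply: open_nbhs_nbhs; split; first exact: ppl_nbhd_open.
  by rewrite HG//; apply: ppl_sub_nbhd; exact: GP.
have vW : valid `<=` W.
  move=> e ve; have Ce : C e by left.
  exact: ((withinP _ _).1 cH e (Cbox e Ce) _ (nH e Ce)).
have [L0 L0P] := finite_constraints cB (open_interior _) vW.
have [L cL L0L] := closed_list_ex L0.
have [e0 ve0] := @valid_nonempty R unit _ P (@ppl_base R) (@ppl_base_in R 0).
pose S := @stage R n e0 L.
have Sbox : S `<=` box by exact: stage_box.
have SN e : S e -> ppl_nbhd n (H e).
  move=> Se; have be := Sbox e Se.
  have : W e by apply: L0P => // t tL; case: Se => _ h _; apply: h; exact: L0L.
  by move=> /interior_subset; exact.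
pose h e := ppl_retr n (H e).
have ch : {within S, continuous h}.
  apply: (@within_comp _ _ _ S (ppl_nbhd n) H (ppl_retr n)).
  - exact: continuous_subspaceW Sbox cH.
  - by move=> _ [e Se <-]; exact: SN.
  - apply/withinP => v Nv U nU.
    have cr : {for v, continuous (@ppl_retr R n)} by apply: ppl_retr_continuous; exact: subset_closure.
    have : \forall w \near v, U (ppl_retr n w) by exact: cr.
    by apply: filterS => w Uw _.
have hA e : S e -> A e -> h e = e b.
  move=> Se Ae; have Ce : C e by right; split => //; exact: Sbox.
  by rewrite /h HG// ppl_retr_id ?GA//; rewrite -GA//; exact: GP.
have cc : cocycle S (fun v w => @core_cocycle R n (h v) (h w)).
  apply: cocycle_pullback ch _ (core_cocycleP pn).
  by move=> _ [e Se <-]; apply: ppl_retr_in; apply: subset_closure; exact: SN.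
have [|c' cc' comp'] := stage_descent pn ve0 cL cc.
  move=> e Se Ae; exists setT; first exact: filterT.
  by move=> v w _ _ Sv Sw Av Aw; rewrite !hA.
exact: (stage_nil_contra pn cc' comp').
Qed.

End NotExtensor.

(** * Finite domination *)

Lemma finite_cw_compact (R : realType) (F : CWcomplex R) : finite_cw F -> compact [set: F].
Proof.
move=> /(@finite_seqP {classic (cw_cell F)})[l lE].
have lin c : List.In c l.
  have : [set: cw_cell F] c by [].
  rewrite lE /=; elim: (l : seq {classic (cw_cell F)}) => //= a s IH.
  by rewrite inE => /orP[/eqP ->|/IH]; [left|right].
have -> : [set: F] = [set x | exists2 c, List.In c l & @ccell R F c x].
  apply/seteqP; split => // x _; have [c [v vD <-]] := ocell_cover x.
  by exists c => //; exists v => //; exact: open_sub_disk.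
elim: (l : seq (cw_cell F)) => [|c s IH].
  by rewrite (_ : [set x | _] = set0); [exact: compact0|apply/seteqP; split => // x [c []]].
have -> : [set x | exists2 d, List.In d (c :: s) & @ccell R F d x] =
    ccell c `|` [set x | exists2 d, List.In d s & @ccell R F d x].
  apply/seteqP; split => x.
    by move=> [d [<-|ds] dx]; [left|right; exists d].
  by move=> [cx|[d ds dx]]; [exists c => //; left|exists d => //; right].
by apply: compactU => //; exact: ccell_compact.
Qed.

Lemma separating_function (R : realType) (X : topologicalType) (x y : X) :
  compact [set: X] -> hausdorff_space X -> x <> y ->
  exists h : X -> R, [/\ continuous h, forall z, 0 <= h z <= 1 & h x <> h y].
Proof.
move=> cX hX xy.
have nX : normal_space X by exact: compact_normal.
have c1 (z : X) : closed [set z].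
  apply: accessible_closed_set1; exact: (hausdorff_accessible hX).
have dis : [set x] `&` [set y] = set0 by apply/seteqP; split => // z [-> /= yx].
have [h [ch h0 h1 hr]] := @urysohn_ext_itv X R nX _ _ 0 1 (c1 x) (c1 y) dis ltr01.
exists h; split => // [z|].
  have : range h (h z) by exists z.
  by move=> /hr; rewrite /= in_itv.
have -> : h x = 0 by apply: h0; exists x.
have -> : h y = 1 by apply: h1; exists y.
by move=> /esym/eqP; rewrite oner_eq0.
Qed.

Section Segment.
Variable R : realType.
Local Notation V := 'rV[R]_5.
Let d0 : V := delta_mx ord0 ord0.

Definition to_segment (s : R) : V := s *: d0.
Definition segment : set V := to_segment @` `[0, 1]%classic.

Lemma to_segment_inj : injective to_segment.
Proof. by move=> s s' /rowP/(_ ord0); rewrite !mxE eqxx !mulr1. Qed.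

Lemma for_segment (T : topologicalType) (f : T -> R) x :
  {for x, continuous f} -> {for x, continuous (fun y => to_segment (f y))}.
Proof. by move=> cf; apply: for_scale => //; exact: for_cst. Qed.

Lemma segment_in (s : R) : 0 <= s <= 1 -> segment (to_segment s).
Proof. by move=> s01; exists s => //=; rewrite in_itv. Qed.

Lemma segment_set_compact : compact segment.
Proof.
apply: continuous_compact; last exact: segment_compact.
by apply: continuous_subspaceT => s; apply: for_segment; exact: for_id.
Qed.

End Segment.

Lemma sol_bound (J : Type) (L : seq (term J)) : exists m, forall n t,
  List.In (Tsol n t) L -> (n < m)%N.
Proof.
elim: L => [|s L [m mL]]; first by exists 0%N.
pose k := if s is Tsol n _ then n.+1 else 0%N.
exists (maxn k m) => n t [st|tL]; rewrite leq_max.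
  by rewrite /k st leqnn.
by rewrite (mL n t tL) orbT.
Qed.

Section Dominated.
Variables (R : realType) (K F : CWcomplex R).
Hypothesis finF : finite_cw F.
Variables (s : K -> F) (r : F -> K).
Hypothesis cs : continuous s.
Hypothesis cr : continuous r.
Hypothesis hrs : homotopic R (r \o s) id.
Hypothesis KAE : forall X : topologicalType, compact [set: X] -> hausdorff_space X ->
  (forall n, absolute_extensor (set_type (@ppl R n)) X) -> absolute_extensor K X.

Local Notation V := 'rV[R]_5.
(** With all functions as base functions the space of valuations may fail to be metrizable, but it
    is a compact Hausdorff space, which is all that [KAE] asks for. *)
Let J := {classic {h : F -> R | continuous h /\ forall x, 0 <= h x <= 1}}.
Local Notation espace := (espace R J).
Let B : set V := @segment R.
Let cB : compact B. Proof. exact: segment_set_compact. Qed.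
Local Notation box := (@box R J B).
Local Notation valid := (@valid R J B (fun=> true)).
Let cF : compact [set: F]. Proof. exact: finite_cw_compact. Qed.
Let hF : hausdorff_space F. Proof. exact: cw_hausdorff. Qed.

Let emb (x : F) : {ptws J -> V} := fun h => to_segment (sval h x).

Let emb_continuous : continuous emb.
Proof.
apply: continuous_ptws => -[h [ch h01]] x; apply: for_segment; exact: ch.
Qed.

Let emb_inj x y : emb x = emb y -> x = y.
Proof.
move=> exy; apply: contrapT => /(separating_function R cF hF)[h [ch h01]]; apply.
have := congr1 (fun f => f (exist _ h (conj ch h01))) exy.
exact: to_segment_inj.
Qed.

Let restr (e : espace) : {ptws J -> V} := fun h => e (Tbase h).

Let restr_continuous : continuous restr.
Proof. by apply: continuous_ptws => h e; exact: eval_cts. Qed.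

Let valid_ne : exists e, valid e.
Proof.
apply: (@valid_nonempty R J B _ (to_segment 0)); apply: segment_in.
by rewrite lexx ler01.
Qed.

Let valid_K : absolute_extensor K (set_type valid).
Proof.
apply: KAE; [exact: U_compact|exact: U_hausdorff|].
by move=> n; exact: valid_AE.
Qed.

Let K_ne : exists k : K, True.
Proof.
apply: (AE_closed_image valid_K); have [e ve] := valid_ne.
by exists (SigSub (mem_set ve)).
Qed.

Lemma dominated_core : exists m, forall X : topologicalType,
  compact [set: X] -> hausdorff_space X ->
  (forall n, (n < m)%N -> absolute_extensor (set_type (@ppl R n)) X) ->
  absolute_extensor K X.
Proof.
have [k0 _] := K_ne.
pose inv (y : {ptws J -> V}) : F := xget (s k0) [set x | emb x = y].
have invK x : inv (emb x) = x.
  by rewrite /inv; case: xgetP => [z _ /emb_inj//|/(_ x) h]; case: h.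
have cinv : {within emb @` [set: F], continuous inv}.
  apply: quotient_continuous => //.
  - by apply: hausdorff_product => _; exact: norm_hausdorff.
  - exact: continuous_subspaceT.
  - rewrite (_ : inv \o emb = id); last by apply/funext => x; exact: invK.
    by apply: continuous_subspaceT => x; exact: cvg_id.
pose gam (e : espace) := inv (restr e).
(* The points of the box whose base coordinates are those of a point of [F], valid or not; [gam]
   recovers this point. *)
pose Gs : set espace := box `&` restr @^-1` (range emb).
have cbox : closed box.
  by apply: compact_closed; [exact: espace_hausdorff|exact: box_compact].
have cG : closed Gs.
  apply: closedI => //; apply: closed_comp; first by move=> x _; exact: restr_continuous.
  apply: compact_closed; last by apply: continuous_compact => //; exact: continuous_subspaceT.
  by apply: hausdorff_product => _; exact: norm_hausdorff.
have cgam : {within Gs, continuous gam}.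
  apply: (within_comp _ _ cinv); first exact: continuous_subspaceT.
  by move=> _ [e [_ Ge] <-].
pose i : set_type valid -> espace := set_val.
have ci : continuous i by exact: initial_continuous.
have [||phi cphi phiE] := AE_extend (f := fun u => r (gam (i u))) (A := i @^-1` Gs) valid_K.
- by apply: closed_comp => // x _; exact: ci.
- apply: (@within_comp_cts _ _ _ _ (fun u => gam (i u)) r) => //.
  apply: (within_comp _ _ cgam); first exact: continuous_subspaceT.
  by move=> _ [e Ge <-].
pose phi' : espace -> K := valL_ k0 phi.
have phi'E e (ve : e \in valid) : phi' e = phi (SigSub ve).
  by have := congr1 (fun k => k (SigSub ve)) (valLK k0 phi).
(* The extension over the valid points is combined with [r \o gam] on all of [Gs], so that the
   boundary values remain prescribed after most constraints are dropped. *)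
pose Th (e : espace) : K := if pselect (Gs e) then r (gam e) else phi' e.
have ThG e : Gs e -> Th e = r (gam e) by rewrite /Th; case: pselect.
have Thv e : valid e -> Th e = phi' e.
  move=> ve; rewrite /Th; case: pselect => // Ge.
  by rewrite (phi'E e (mem_set ve)) phiE.
pose C := valid `|` Gs.
have vbox : valid `<=` box by exact: valid_sub_box.
have Cbox : C `<=` box by move=> e [/vbox|[]].
have cC : closed C by apply: closedU => //; exact: valid_closed.
have cTh : {within C, continuous Th}.
  apply: withinU_continuous => //; first exact: valid_closed.
  - have := (@subspace_valL_continuousP' _ valid K k0 phi).2 cphi.
    apply: subspace_eq_continuous => e /set_mem ve.
    by rewrite /from_subspace Thv.
  - have := within_comp_cts cgam cr.
    apply: subspace_eq_continuous => e /set_mem Ge.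
    by rewrite /from_subspace ThG.
pose Bx := set_type box; pose j : Bx -> espace := set_val.
have cj : continuous j by exact: initial_continuous.
have cptB : compact [set: Bx] by apply: compact_setType; exact: box_compact.
have hB : hausdorff_space Bx by apply: hausdorff_setType; exact: espace_hausdorff.
have cjC : closed (j @^-1` C) by apply: closed_comp => // x _; exact: cj.
have [||th [U0 [oU0 CU0 cth thE]]] := @compact_extend R K Bx (j @^-1` C) (fun u => Th (j u))
    (compact_normal hB cptB) cjC.
- exact: subclosed_compact cjC cptB _.
- apply: (within_comp _ _ cTh); first exact: continuous_subspaceT.
  by move=> _ [e Ge <-].
have [W oW WU] : exists2 W, open W & j @^-1` W = U0 by exact: oU0.
have vW : valid `<=` W.
  move=> e ve; have : U0 (SigSub (mem_set (vbox e ve))) by apply: CU0; left.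
  by rewrite -WU.
have [L LP] := finite_constraints cB oW vW.
(* The finitely many constraints in [L] involve formal solutions of index below [m] only. *)
have [m mL] := sol_bound L.
exists m => X cX hX XAE.
apply: AE_intro K_ne _ => A f cA cf.
have nX : normal_space X by exact: compact_normal.
have /choice[g gP] : forall h : J, exists g : X -> R,
    [/\ continuous g, forall x, A x -> g x = sval h (s (f x)) & forall x, 0 <= g x <= 1].
  move=> [h [ch h01]]; apply: tietze_clamp => //.
  exact: (within_comp_cts (within_comp_cts cf cs) ch).
(* Problems of index at least [m] are pinned to the base point. The resulting valuations lie in the
   same box and satisfy all constraints in [L], hence lie in the domain [U0] of [th]; on [A] this
   yields [r (s (f x))], and the homotopy corrects it to [f]. *)
have [||Phi cPhi PhiE] := @valid_map R J B (fun n => (n < m)%N) X XAE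
    (fun h x => to_segment (g h x)).
- by move=> h x; apply: for_segment; case: (gP h) => cg _ _; exact: cg.
- by move=> h x; apply: segment_in; case: (gP h).
have Pbox x : set_val (Phi x) \in box.
  by apply: mem_set; apply: (@valid_sub_box R J B (fun n => (n < m)%N)); exact: set_valP.
pose Phi' x : Bx := SigSub (Pbox x).
have cPhi' : continuous Phi'.
  apply: continuous_setType => x.
  apply: (@continuous_comp _ _ _ Phi set_val); first exact: cPhi.
  exact: initial_continuous.
have PU x : U0 (Phi' x).
  rewrite -WU; apply: LP; first exact: (set_mem (Pbox x)).
  move=> t tL; have : rel B (fun n => (n < m)%N) (set_val (Phi x)) t (set_val (Phi x) t).
    exact: (set_valP (Phi x)).
  by case: t tL => //= n t /mL ->.
have [H [cH H0 H1]] := hrs.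
apply: (homotopy_extension (u := fun x => th (Phi' x)) (H := H)) => //.
- by move=> x; exact: (for_comp (cPhi' x) (cth _ (PU x))).
- move=> x Ax; have rE : restr (j (Phi' x)) = emb (s (f x)).
    apply/funext => h; rewrite /restr /emb; apply: etrans (PhiE h x) _.
    by case: (gP h) => _ ->.
  have Gx : Gs (j (Phi' x)).
    by split; [exact: (set_mem (Pbox x))|exists (s (f x)) => //; rewrite rE].
  rewrite H0 thE; last by right.
  by rewrite ThG// /gam rE invK.
Qed.

End Dominated.

Lemma finitely_dominated_AE (R : realType) (K : CWcomplex R) : finitely_dominated K ->
  (forall X : topologicalType, compact [set: X] -> hausdorff_space X ->
    (forall n, absolute_extensor (set_type (@ppl R n)) X) -> absolute_extensor K X) ->
  exists m, forall X : topologicalType, compact [set: X] -> hausdorff_space X ->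
    (forall n, (n < m)%N -> absolute_extensor (set_type (@ppl R n)) X) ->
    absolute_extensor K X.
Proof. by move=> [F fF [s [r [cs cr h]]]]; exact: dominated_core h. Qed.

(** * The comb *)

Inductive mcell := Vtx of nat | Ray of nat | Loop of nat | Disc of nat.

Definition mcell_code (c : mcell) : nat * nat :=
  match c with Vtx n => (n, 0) | Ray n => (n, 1) | Loop n => (n, 2) | Disc n => (n, 3) end%N.

Lemma mcell_code_inj : injective mcell_code.
Proof. by case=> n [] m //= [->]. Qed.

Lemma mcell_countable : countable [set: mcell].
Proof.
apply/countable_injP; exists (fun c => pickle (mcell_code c)).
by move=> c d _ _ /(pcan_inj pickleK) /mcell_code_inj.
Qed.

Definition mdim (c : mcell) : nat :=
  match c with Vtx _ => 0 | Ray _ | Loop _ => 1 | Disc _ => 2 end%N.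

Definition mindex (c : mcell) : nat :=
  match c with Vtx n | Ray n | Loop n | Disc n => n end.

Section Comb.
Variable R : realType.
Local Notation V := 'rV[R]_5.
Notation x0 := (@Ordinal 5 0 isT).
Notation x1 := (@Ordinal 5 1 isT).
Notation x2 := (@Ordinal 5 2 isT).
Notation x3 := (@Ordinal 5 3 isT).
Notation x4 := (@Ordinal 5 4 isT).
Local Notation base := (@ppl_base R).

(* A ray with [ppl n] attached at [n] by its base point. *)
Definition Mset : set (R * V) :=
  [set p | (0 <= p.1 /\ p.2 = base) \/ exists n : nat, p.1 = n%:R /\ ppl n p.2].

(** The double angle formulas with [t] as the sine: as [t] runs from -1 to 1, the circle is
    traversed once, starting and ending at -1. *)
Definition loop (t : R) : V := vec5 (1 - 2 * t ^+ 2) (2 * t * Num.sqrt (1 - t ^+ 2)) 0 0 1.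

Definition mchar (c : mcell) : 'rV[R]_(mdim c) -> R * V :=
  match c return 'rV[R]_(mdim c) -> R * V with
  | Vtx n => fun _ => (n%:R, base)
  | Ray n => fun z => (n%:R + (1 + disk_proj z ord0 ord0) / 2, base)
  | Loop n => fun z => (n%:R, loop (disk_proj z ord0 ord0))
  | Disc n => fun z => (n%:R, dimap n (disk_proj z))
  end.

Lemma sqr_lt1 (x : R) : (x ^+ 2 < 1) = (-1 < x < 1).
Proof. by rewrite -ltr_norml -(real_normK (num_real x)) expr_lt1. Qed.

Lemma sqr_le1 (x : R) : (x ^+ 2 <= 1) = (-1 <= x <= 1).
Proof. by rewrite -ler_norml -(real_normK (num_real x)) expr_le1. Qed.

Arguments mchar : clear implicits.

Lemma normsq1 (z : 'rV[R]_1) : normsq z = z ord0 ord0 ^+ 2.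
Proof. by rewrite /normsq big_ord1. Qed.

Lemma loop_core t : t ^+ 2 <= 1 -> core_circle (loop t).
Proof.
move=> t1; have [|s [e1 e2]] := @angle_ex R (1 - 2 * t ^+ 2) (2 * t * Num.sqrt (1 - t ^+ 2)).
  by rewrite !exprMn sqr_sqrtr ?subr_ge0//; ring.
by exists s; rewrite /loop e1 e2.
Qed.

Lemma mchar_in c z : Mset (mchar c z).
Proof.
case: c z => n z /=; rewrite /Mset/=.
- by left; split => //; exact: ler0n.
- left; split => //; have := disk_proj_in z; rewrite /closed_disk/= normsq1 sqr_le1 => /andP[h _].
  have := ler0n R n; lra.
- right; exists n; split => //; apply: core_circle_ppl; apply: loop_core.
  by rewrite -normsq1; exact: disk_proj_in.
- by right; exists n; split => //; exists (disk_proj z) => //; exact: disk_proj_in.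
Qed.

Lemma mchar_continuous c : continuous (mchar c).
Proof.
have cp n i (z : 'rV[R]_n.+1) : {for z, continuous (fun z : 'rV[R]_n.+1 => disk_proj z ord0 i)}.
  by apply: for_coord; exact: disk_proj_continuous.
have cpair (T : topologicalType) (f : T -> R) (g : T -> V) :
    (forall z, {for z, continuous f}) -> (forall z, {for z, continuous g}) ->
    continuous (fun z => (f z, g z)).
  by move=> cf cg z; exact: (for_pair (cf z) (cg z)).
case: c => n.
- by apply: cpair => z; exact: for_cst.
- apply: (cpair _ (fun z : 'rV[R]_1 => n%:R + (1 + disk_proj z ord0 ord0) / 2)) => z.
    apply: for_add; first exact: for_cst.
    by apply: for_mul; [apply: for_add; [exact: for_cst|exact: cp]|exact: for_cst].
  exact: for_cst.
- apply: (cpair _ (fun _ : 'rV[R]_1 => n%:R) (fun z => loop (disk_proj z ord0 ord0))) => z.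
    exact: for_cst.
  have csq : {for z, continuous (fun z : 'rV[R]_1 => disk_proj z ord0 ord0 ^+ 2)}.
    by apply: for_mul; exact: cp.
  have c0 : {for z, continuous (fun z : 'rV[R]_1 => 1 - 2 * disk_proj z ord0 ord0 ^+ 2)}.
    by apply: for_sub; [exact: for_cst|apply: for_mul => //; exact: for_cst].
  have c1 : {for z, continuous (fun z : 'rV[R]_1 =>
      2 * disk_proj z ord0 ord0 * Num.sqrt (1 - disk_proj z ord0 ord0 ^+ 2))}.
    apply: for_mul; first by apply: for_mul; [exact: for_cst|exact: cp].
    by apply: for_sqrt; apply: for_sub => //; exact: for_cst.
  by apply: (for_vec5 c0 c1); exact: for_cst.
- apply: (cpair _ (fun _ : 'rV[R]_2 => n%:R) (fun z => dimap n (disk_proj z))) => z.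
    exact: for_cst.
  exact: (for_comp (@disk_proj_continuous R 2 z) (@dimap_continuous R n (disk_proj z))).
Qed.

(** The open cells by equations and inequalities, which turns disjointness and covering into case
    distinctions. *)
Definition mocell (c : mcell) : set (R * V) :=
  match c with
  | Vtx n => [set p | p.1 = n%:R /\ p.2 = base]
  | Ray n => [set p | [/\ n%:R < p.1, p.1 < n%:R + 1 & p.2 = base]]
  | Loop n => [set p | [/\ p.1 = n%:R, core_circle p.2 & p.2 <> base]]
  | Disc n => [set p | [/\ p.1 = n%:R, ppl n p.2 & p.2 ord0 x4 < 1]]
  end.

Lemma base_x4 : base ord0 x4 = 1.
Proof. by rewrite mxE. Qed.

Lemma core_x4 (v : V) : core_circle v -> v ord0 x4 = 1.
Proof. by move=> [t ->]; rewrite mxE. Qed.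

Lemma mchar_mocell c z : open_disk z -> mocell c (mchar c z).
Proof.
move=> zO; have zC := open_sub_disk zO; move: zO; rewrite /open_disk/=.
case: c z zC => n z zC /=; rewrite ?disk_proj_id//; rewrite /= ?normsq1 => z1.
- by move: z1; rewrite sqr_lt1 => /andP[? ?]; split => //; lra.
- split => //; first by apply: loop_core; exact: ltW.
  by move=> /vec5_inj[h _ _ _ _]; lra.
- by split => //; [exists z|rewrite dimap_x4].
Qed.

Lemma mocell_mchar c p : mocell c p -> exists2 z, open_disk z & mchar c z = p.
Proof.
case: c => n; case: p => t v /=.
- move=> [-> ->]; exists 0 => //.
  by rewrite /open_disk/= normsq0.
- move=> [h1 h2 ->]; exists (const_mx (2 * (t - n%:R) - 1)).
    by rewrite /open_disk/= normsq1 mxE sqr_lt1; apply/andP; split; lra.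
  rewrite disk_proj_id; last first.
    by rewrite /closed_disk/= normsq1 mxE sqr_le1; apply/andP; split; lra.
  by rewrite mxE; congr pair; field.
- move=> [-> [s ->] nb].
  set a := cosT s; set b := sinT s.
  have ab : a ^+ 2 + b ^+ 2 = 1 by exact: cosT2D.
  have a1 : -1 < a.
    rewrite lt_neqAle; apply/andP; split; last first.
      have : a ^+ 2 <= 1 by rewrite -ab lerDl sqr_ge0.
      by rewrite sqr_le1 => /andP[].
    apply/eqP => ea; apply: nb; rewrite /ppl_base -/a -/b -ea.
    suff -> : b = 0 by [].
    apply/eqP; rewrite -sqrf_eq0; apply/eqP; move: ab; rewrite -ea; lra.
  have q0 : 0 < 2 * (1 + a) by lra.
  (* The sine of the half angle of [(a, b)], which inverts [loop] away from the base point. *)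
  pose u := b / Num.sqrt (2 * (1 + a)).
  have u2 : u ^+ 2 = (1 - a) / 2.
    rewrite /u exprMn exprVn sqr_sqrtr ?ltW//.
    have -> : b ^+ 2 = 1 - a ^+ 2 by lra.
    by field; rewrite gt_eqF//; lra.
  have u1 : u ^+ 2 < 1 by rewrite u2; lra.
  exists (const_mx u); first by rewrite /open_disk/= normsq1 mxE.
  rewrite disk_proj_id; last by rewrite /closed_disk/= normsq1 mxE ltW.
  rewrite mxE /loop u2; congr pair.
  have -> : 1 - 2 * ((1 - a) / 2) = a by field.
  have -> : 2 * u * Num.sqrt (1 - (1 - a) / 2) = b; last by [].
  have sq : Num.sqrt (2 * (1 + a)) = 2 * Num.sqrt (1 - (1 - a) / 2).
    have -> : 2 * (1 + a) = 2 ^+ 2 * (1 - (1 - a) / 2) by field.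
    by rewrite sqrtrM ?sqr_ge0// sqrtr_sqr ger0_norm.
  rewrite /u sq; field.
  by rewrite gt_eqF// sqrtr_gt0; lra.
- move=> [-> [z zD <-]]; rewrite dimap_x4 => z1; exists z => //.
  by rewrite disk_proj_id.
Qed.

Lemma mocell_index c p : mocell c p -> Num.truncn p.1 = mindex c.
Proof.
have h n (t : R) : n%:R <= t -> t < n%:R + 1 -> Num.truncn t = n.
  by move=> h1 h2; apply/truncn_def; rewrite h1 -natr1.
by case: c => n /= [h1 h2]; move=> *; apply: h => //; rewrite ?h1 ?ltrDl// ltW.
Qed.

Lemma mocell_disj c d p : mocell c p -> mocell d p -> c = d.
Proof.
move=> cp dp; have := mocell_index cp; rewrite (mocell_index dp).
case: c cp => n; case: d dp => m /= dp cp e; rewrite ?e//; exfalso; subst m.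
- by case: cp dp => -> _ [h _ _]; move: h; rewrite ltxx.
- by case: cp dp => _ -> [].
- by case: cp dp => _ -> [_ _]; rewrite base_x4 ltxx.
- by case: dp cp => -> _ [h _ _]; move: h; rewrite ltxx.
- by case: cp dp => _ _ -> [].
- by case: cp dp => _ _ -> [_ _]; rewrite base_x4 ltxx.
- by case: dp cp => _ -> [].
- by case: dp cp => _ _ -> [].
- by case: cp dp => _ /core_x4 -> _ [_ _]; rewrite ltxx.
- by case: dp cp => _ -> [_ _]; rewrite base_x4 ltxx.
- by case: dp cp => _ _ -> [_ _]; rewrite base_x4 ltxx.
- by case: dp cp => _ /core_x4 -> _ [_ _]; rewrite ltxx.
Qed.

Lemma mocell_core n (v : V) : core_circle v ->
  mocell (Vtx n) (n%:R, v) \/ mocell (Loop n) (n%:R, v).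
Proof. by move=> Cv; have [->|vb] := pselect (v = base); [left|right]. Qed.

Lemma mocell_cover p : Mset p -> exists c, mocell c p.
Proof.
move=> [[t0 pb]|[n [pn Pp]]].
  pose n := Num.truncn p.1.
  have /andP[h1 h2] := truncn_itv t0.
  have [e|e] := eqVneq p.1 n%:R; first by exists (Vtx n).
  exists (Ray n); split => //; last by rewrite natr1.
  by rewrite lt_neqAle eq_sym e.
case: p pn Pp => t v /= -> Pv.
have [v1|v1] := ltP (v ord0 x4) 1; first by exists (Disc n).
have Cv : core_circle v.
  apply: (ppl_boundary Pv); apply/eqP; rewrite eq_le v1 andbT.
  by case: Pv => z zD <-; rewrite dimap_x4.
by case: (mocell_core n Cv) => h; eexists; exact: h.
Qed.

End Comb.

Section CombComplex.
Variable R : realType.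
Local Notation V := 'rV[R]_5.
Notation x0 := (@Ordinal 5 0 isT).
Notation x1 := (@Ordinal 5 1 isT).
Notation x2 := (@Ordinal 5 2 isT).
Notation x3 := (@Ordinal 5 3 isT).
Notation x4 := (@Ordinal 5 4 isT).
Local Notation base := (@ppl_base R).

Definition Mspace := set_type (@Mset R).

Lemma Mspace_hausdorff : hausdorff_space Mspace.
Proof. by apply: hausdorff_setType; exact: norm_hausdorff. Qed.

Definition Mchar (c : mcell) (z : 'rV[R]_(mdim c)) : Mspace :=
  SigSub (mem_set (@mchar_in R c z)).
Arguments Mchar : clear implicits.

Lemma Mchar_continuous c : continuous (Mchar c).
Proof. by apply: continuous_setType; exact: mchar_continuous. Qed.

Lemma embedding_of_inverse (d : nat) (f : 'rV[R]_d -> Mspace) (W : set (R * V))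
    (g : R * V -> 'rV[R]_d) :
  continuous f -> open W -> (forall p, W p -> {for p, continuous g}) ->
  (forall z, open_disk z -> W (set_val (f z)) /\ g (set_val (f z)) = z) ->
  embedding (sigL (@open_disk R d) f).
Proof.
move=> cf oW cg gK; split.
- apply: (subspace_sigL_continuousP _ _).1.
  exact: continuous_subspaceT.
- move=> z w /= e; apply: val_inj => /=.
  have [_ <-] := gK _ (set_valP z); have [_ <-] := gK _ (set_valP w).
  by congr (g (set_val _)).
- move=> U [U' oU' <-].
  have oV : open (W `&` g @^-1` U').
    apply: open_from_near => p [Wp gp].
    apply: filterI; first exact: open_nbhs_nbhs.
    by apply: cg => //; exact: open_nbhs_nbhs.
  exists (set_val @^-1` (W `&` g @^-1` U')); first by exists (W `&` g @^-1` U').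
  apply/seteqP; split => z /=; have [Wz gz] := gK _ (set_valP z).
    by move=> [_]; rewrite /sigL/= gz.
  by move=> U'z; split; rewrite /sigL//= gz.
Qed.

Lemma Mchar_embedding c : embedding (sigL (@open_disk R (mdim c)) (Mchar c)).
Proof.
have cc (i : 'I_5) (p : R * V) : {for p, continuous (fun p : R * V => p.2 ord0 i)}.
  by apply: for_coord; exact: snd_cts.
have crow (T : topologicalType) (f : T -> R) x : {for x, continuous f} ->
    {for x, continuous (fun y => const_mx (f y) : 'rV[R]_1)}.
  move=> cf; apply: for_rV => i.
  by have -> : (fun y => (const_mx (f y) : 'rV[R]_1) ord0 i) = f by apply/funext => y; rewrite mxE.
have eta1 (z : 'rV[R]_1) (t : R) : t = z ord0 ord0 -> const_mx t = z.
  by move=> ->; apply/rowP => i; rewrite mxE (ord1 i).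
case: c => n.
- apply: (@embedding_of_inverse 0 _ setT (fun=> 0)).
  + exact: (@Mchar_continuous (Vtx n)).
  + exact: openT.
  + by move=> p _; exact: for_cst.
  + by move=> z _; split => //; apply/rowP => -[].
- apply: (@embedding_of_inverse 1 _ setT (fun p => const_mx (2 * (p.1 - n%:R) - 1))).
  + exact: (@Mchar_continuous (Ray n)).
  + exact: openT.
  + move=> p _; apply: crow; apply: for_sub; last exact: for_cst.
    apply: for_mul; first exact: for_cst.
    by apply: for_sub; [exact: fst_cts|exact: for_cst].
  + move=> z zD; split => //; apply: eta1; rewrite /= disk_proj_id; last exact: open_sub_disk.
    by field.
- pose g (p : R * V) : 'rV[R]_1 := const_mx (p.2 ord0 x1 / Num.sqrt (2 * (1 + p.2 ord0 x0))).
  apply: (@embedding_of_inverse 1 (Mchar (Loop n)) [set p : R * V | -1 < p.2 ord0 x0] g).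
  + exact: (@Mchar_continuous (Loop n)).
  + by apply: (@open_ltr_fun R _ (fun=> -1) (fun p : R * V => p.2 ord0 x0)) => p; [exact: for_cst|exact: cc].
  + move=> p /= p0; apply: crow; apply: for_mul; first exact: cc.
    apply: for_inv; first by rewrite gt_eqF// sqrtr_gt0; lra.
    apply: for_sqrt; apply: for_mul; first exact: for_cst.
    by apply: for_add; [exact: for_cst|exact: cc].
  + move=> z zD; rewrite /g /= !disk_proj_id; [|exact: open_sub_disk..].
    move: zD; rewrite /open_disk/= normsq1; set t := z ord0 ord0 => t1.
    rewrite /loop !mxE/=; split; first by lra.
    apply: eta1; rewrite -/t.
    have -> : 2 * (1 + (1 - 2 * t ^+ 2)) = 2 ^+ 2 * (1 - t ^+ 2) by ring.
    rewrite sqrtrM ?sqr_ge0// sqrtr_sqr ger0_norm//.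
    by field; rewrite gt_eqF// sqrtr_gt0 subr_gt0.
- pose g (p : R * V) : 'rV[R]_2 :=
    \row_i nth 0 [:: p.2 ord0 x2 / (1 - p.2 ord0 x4); p.2 ord0 x3 / (1 - p.2 ord0 x4)] i.
  apply: (@embedding_of_inverse 2 (Mchar (Disc n)) [set p : R * V | p.2 ord0 x4 < 1] g).
  + exact: (@Mchar_continuous (Disc n)).
  + by apply: (@open_ltr_fun R _ (fun p : R * V => p.2 ord0 x4) (fun=> 1)) => p; [exact: cc|exact: for_cst].
  + move=> p /= p1.
    have ci i : {for p, continuous (fun p : R * V => p.2 ord0 i / (1 - p.2 ord0 x4))}.
      apply: for_mul; first exact: cc.
      by apply: for_inv; [rewrite gt_eqF// subr_gt0|apply: for_sub; [exact: for_cst|exact: cc]].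
    apply: for_rV => -[[|[|i]] Hi] //.
      have -> : (fun p => g p ord0 (Ordinal Hi)) = fun p => p.2 ord0 x2 / (1 - p.2 ord0 x4).
        by apply/funext => q; rewrite mxE.
      exact: ci.
    have -> : (fun p => g p ord0 (Ordinal Hi)) = fun p => p.2 ord0 x3 / (1 - p.2 ord0 x4).
      by apply/funext => q; rewrite mxE.
    exact: ci.
  + move=> z zD; rewrite /g /= !disk_proj_id; [|exact: open_sub_disk..].
    rewrite dimap_x4; split => //.
    have nz : 1 - normsq z != 0 by rewrite gt_eqF// subr_gt0.
    apply/rowP => -[[|[|i]] Hi] //; rewrite !mxE/= mulrAC divff// mul1r.
      by congr (z _ _); exact: val_inj.
    by congr (z _ _); exact: val_inj.
Qed.

Lemma Mchar_open_image c : Mchar c @` @open_disk R (mdim c) = set_val @^-1` mocell c.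
Proof.
apply/seteqP; split => [_ [z zD <-]|x /= xc]; first exact: mchar_mocell.
have [z zD zE] := mocell_mchar xc; exists z => //.
exact: val_inj.
Qed.

Lemma Mchar_trivIset :
  trivIset [set: mcell] (fun c => Mchar c @` @open_disk R (mdim c)).
Proof.
move=> c d _ _ [x []]; rewrite !Mchar_open_image; exact: mocell_disj.
Qed.

Lemma Mchar_cover :
  \bigcup_(c in [set: mcell]) (Mchar c @` @open_disk R (mdim c)) = [set: Mspace].
Proof.
apply/seteqP; split => // x _; have [c xc] := mocell_cover (set_valP x).
by exists c => //; rewrite Mchar_open_image.
Qed.

Lemma Mchar_boundary c : exists F : set mcell,
  [/\ finite_set F, (forall d, F d -> (mdim d < mdim c)%N) &
    Mchar c @` @unit_sphere R (mdim c) `<=`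
      \bigcup_(d in F) (Mchar d @` @open_disk R (mdim d))].
Proof.
have unitD (m : nat) (z : 'rV[R]_m) : unit_sphere z -> disk_proj z = z.
  by move=> z1; apply: disk_proj_id; exact: sphere_sub_disk.
case: c => n.
- exists set0; split => // x [z]; rewrite /unit_sphere/= /normsq big_ord0 => /eqP.
  by rewrite eq_sym oner_eq0.
- exists [set Vtx n; Vtx n.+1]; split; [exact: finite_set2|by move=> d [->|->]|].
  move=> x [z zS <-]; have := zS; rewrite /unit_sphere/= normsq1 => /eqP.
  rewrite sqrf_eq1 => /orP[]/eqP z1.
    exists (Vtx n.+1); first by right.
    rewrite Mchar_open_image /= unitD// z1; split => //.
    by rewrite -natr1; field.
  exists (Vtx n); first by left.
  by rewrite Mchar_open_image /= unitD// z1; split => //; field.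
- exists [set Vtx n]; split; [exact: finite_set1|by move=> d ->|].
  move=> x [z zS <-]; have := zS; rewrite /unit_sphere/= normsq1 => z1.
  exists (Vtx n) => //; rewrite Mchar_open_image /= unitD//; split => //.
  rewrite /loop z1 subrr sqrtr0 mulr0 /ppl_base; congr vec5; ring.
- exists [set Vtx n; Loop n]; split; [exact: finite_set2|by move=> d [->|->]|].
  move=> x [z zS <-]; case: (mocell_core n (dimap_sphere n zS)) => h.
    by exists (Vtx n); [left|rewrite Mchar_open_image /= unitD].
  by exists (Loop n); [right|rewrite Mchar_open_image /= unitD].
Qed.

(** The comb is locally finite: a bounded part of the ray meets only finitely many closed cells,
    each compact. A countable wedge at one point would not allow this. *)
Lemma Mchar_weak (A : set Mspace) :
  (forall c, closed (@closed_disk R (mdim c) `&` Mchar c @^-1` A)) -> closed A.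
Proof.
move=> cA; rewrite -[A]setCK; apply: open_closedC; apply: open_from_near => p Ap.
have cC c : closed (Mchar c @` (@closed_disk R (mdim c) `&` Mchar c @^-1` A)).
  apply: compact_closed; first exact: Mspace_hausdorff.
  apply: continuous_compact; first by apply: continuous_subspaceT; exact: Mchar_continuous.
  apply: subclosed_compact (cA c) (@closed_disk_compact R (mdim c)) _.
  by move=> z [].
pose S n := Mchar (Vtx n) @` (@closed_disk R 0 `&` Mchar (Vtx n) @^-1` A) `|`
  Mchar (Ray n) @` (@closed_disk R 1 `&` Mchar (Ray n) @^-1` A) `|`
  Mchar (Loop n) @` (@closed_disk R 1 `&` Mchar (Loop n) @^-1` A) `|`
  Mchar (Disc n) @` (@closed_disk R 2 `&` Mchar (Disc n) @^-1` A).
have cS n : closed (S n).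
  apply: closedU; last exact: (cC (Disc n)).
  apply: closedU; last exact: (cC (Loop n)).
  by apply: closedU; [exact: (cC (Vtx n))|exact: (cC (Ray n))].
have SA n : S n `<=` A by move=> x [[[]|]|] [z [_ /= h] <-].
pose N := (Num.truncn ((set_val p).1 + 1)).+1.
have pN : (set_val p).1 + 1 < N%:R.
  exact: truncnS_gt.
pose T := \bigcup_(n in `I_N) S n.
have cT : closed T by apply: closed_bigcup => //; exact: finite_II.
have nT : nbhs p (~` T).
  apply: open_nbhs_nbhs; split; first exact: closed_openC.
  by move=> [n _ /SA].
have nN : \forall q \near p, (set_val q).1 < N%:R.
  apply: (near_lt (f := fun q : Mspace => (set_val q).1) (g := fun=> N%:R)).
  - apply: (for_comp (f := fun q : Mspace => set_val q)); last exact: fst_cts.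
    exact: initial_continuous.
  - exact: for_cst.
  - lra.
apply: filterS2 nT nN => q qT qN Aq; apply: qT.
have [c qc] := mocell_cover (set_valP q).
have [z zD zE] := mocell_mchar qc.
have Mz : Mchar c z = q by exact: val_inj.
have im : (Mchar c @` (@closed_disk R (mdim c) `&` Mchar c @^-1` A)) q.
  by exists z => //; split; [exact: open_sub_disk|rewrite /= Mz].
exists (mindex c).
  rewrite /= -(mocell_index qc).
  have q0 : 0 <= (set_val q).1.
    by case: (set_valP q) => [[]//|[n [-> _]]]; exact: ler0n.
  by rewrite -(ltr_nat R); apply: le_lt_trans qN; case/andP: (truncn_itv q0).
case: c im {qc z zD zE Mz} => n im /=.
- by left; left; left.
- by left; left; right.
- by left; right.
- by right.
Qed.

Definition Mcw : CWcomplex R := {|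
  cw_space := Mspace;
  cw_hausdorff := Mspace_hausdorff;
  cw_cell := mcell;
  cw_dim := mdim;
  cw_char := Mchar;
  cw_cont := fun c => continuous_subspaceT (@Mchar_continuous c);
  cw_homeo := Mchar_embedding;
  cw_disjoint := Mchar_trivIset;
  cw_cover := Mchar_cover;
  cw_boundary := Mchar_boundary;
  cw_weak := Mchar_weak |}.

Lemma Mcw_countable : countable_cw Mcw.
Proof. exact: mcell_countable. Qed.

End CombComplex.

Lemma within_setType (X Y : topologicalType) (B : set Y) (A : set X) (f : X -> set_type B) :
  {within A, continuous (set_val \o f)} -> {within A, continuous f}.
Proof.
move=> cf; apply/withinP => x Ax W [W0 [[Q oQ <-] Fx] WW].
have nQ : nbhs ((set_val \o f) x) Q by exact: open_nbhs_nbhs.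
have := (withinP _ _).1 cf x Ax _ nQ.
by apply: filterS => y h Ay; apply: WW; exact: h.
Qed.

(** * Extension of maps into the comb *)

Section CombExtensor.
Variable R : realType.
Local Notation V := 'rV[R]_5.
Local Notation base := (@ppl_base R).
Local Notation M := (Mspace R).

(** The retraction onto the tooth at [n]. Strictly between integers the second coordinate of a point
    of the comb is already the base point, which makes both branches fit continuously. *)
Definition leaf_proj (n : nat) (x : M) : V :=
  if `|(set_val x).1 - n%:R| < 1 then (set_val x).2 else base.

Lemma Mset_noninteger (n : nat) (p : R * V) : Mset p -> p.1 != n%:R ->
  `|p.1 - n%:R| < 1 -> p.2 = base.
Proof.
move=> [[_ ->]//|[m [-> _]]] mn; rewrite ltr_norml => /andP[h1 h2].
have mn1 : (m < n.+1)%N by rewrite -(ltr_nat R) -natr1; lra.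
have nm1 : (n < m.+1)%N by rewrite -(ltr_nat R) -natr1; lra.
by case/eqP: mn; congr (_%:R); apply/eqP; rewrite eqn_leq -ltnS mn1 -ltnS.
Qed.

Lemma leaf_proj_in n x : ppl n (leaf_proj n x).
Proof.
rewrite /leaf_proj; case: ifP => h; last exact: ppl_base_in.
have [e|e] := eqVneq (set_val x).1 n%:R; last first.
  by rewrite (Mset_noninteger (set_valP x) e h); exact: ppl_base_in.
case: (set_valP x) => [[_ ->]|[m [me Pm]]]; first exact: ppl_base_in.
by have -> : n = m by apply/eqP; rewrite -(eqr_nat R) -e me.
Qed.

Let fst_c (x : M) : {for x, continuous (fun y : M => (set_val y).1)}.
Proof.
apply: (for_comp (f := fun q : M => set_val q)); last exact: fst_cts.
exact: initial_continuous.
Qed.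

Let snd_c (x : M) : {for x, continuous (fun y : M => (set_val y).2)}.
Proof.
apply: (for_comp (f := fun q : M => set_val q)); last exact: snd_cts.
exact: initial_continuous.
Qed.

Lemma leaf_proj_continuous n : continuous (leaf_proj n).
Proof.
move=> x W nW.
have cd : {for x, continuous (fun y : M => `|(set_val y).1 - n%:R|)}.
  by apply: for_norm; apply: for_sub; [exact: fst_c|exact: for_cst].
have [h|h] := ltP `|(set_val x).1 - n%:R| 1.
  have n1 : \forall y \near x, `|(set_val y).1 - n%:R| < 1.
    by apply: (near_lt (g := fun=> 1) cd) => //; exact: for_cst.
  have nW' : nbhs ((set_val x).2) W by move: nW; rewrite /leaf_proj h.
  have n2 : \forall y \near x, W (set_val y).2 by exact: snd_c.
  by apply: filterS2 n1 n2 => y y1 Wy; rewrite /leaf_proj /= y1.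
have n1 : \forall y \near x, 2^-1 < `|(set_val y).1 - n%:R|.
  by apply: (near_lt (f := fun=> 2^-1)) => //; [exact: for_cst|lra].
have Wb : W base by move: (nbhs_singleton nW); rewrite /leaf_proj ltNge h.
apply: filterS n1 => y y1; rewrite /leaf_proj /=; case: ifP => // yl.
rewrite (Mset_noninteger (set_valP y) _ yl)//.
by apply: contraTneq y1 => ->; rewrite subrr normr0 -leNgt; lra.
Qed.

Lemma Mcw_AE_ppl (X : topologicalType) n :
  absolute_extensor (Mcw R) X -> absolute_extensor (set_type (@ppl R n)) X.
Proof.
move=> ae; apply: (AE_sub_intro base) => A f cA cf fA.
pose f' x := if pselect (A x) then f x else base.
have f'E x : A x -> f' x = f x by rewrite /f'; case: pselect.
have inM (x : X) : (n%:R, f' x) \in @Mset R.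
  apply: mem_set; right; exists n; split => //=; rewrite /f'.
  by case: pselect => [/fA//|nA] /=; exact: ppl_base_in.
pose F x : M := SigSub (inM x).
have cF : {within A, continuous F}.
  have cn : continuous (fun v : V => (n%:R : R, v)).
    move=> v; have h1 : {for v, continuous (fun v : V => n%:R : R)} by exact: for_cst.
    exact: (for_pair h1 (@for_id _ v)).
  have c := within_comp_cts cf cn.
  apply: within_setType; apply: subspace_eq_continuous c => x /set_mem Ax.
  exact: (congr1 (pair _) (esym (f'E x Ax))).
have [G cG GF] := AE_extend ae cA cF.
exists (fun x => leaf_proj n (G x)); split.
- by move=> x; exact: (for_comp (cG x) (@leaf_proj_continuous n (G x))).
- by move=> x; exact: leaf_proj_in.
- move=> x Ax; rewrite GF// /leaf_proj /= subrr normr0 ltr01.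
  exact: f'E.
Qed.

(* The displacement moving [t] towards [k]: it collapses the interval
   [|t - k| <= h] to the point [k] and is zero for [h = 0] or [|t - k| >= 1/2]. *)
Definition pull (k t h : R) : R :=
  Num.max (- (2 * h * Num.max 0 (1 - 2 * `|t - k|)))
    (Num.min (t - k) (2 * h * Num.max 0 (1 - 2 * `|t - k|))).

Lemma pull_far (k t h : R) : 2^-1 <= `|t - k| -> pull k t h = 0.
Proof.
move=> tk; rewrite /pull.
have -> : Num.max 0 (1 - 2 * `|t - k|) = 0 by apply/max_idPl; lra.
rewrite mulr0 oppr0; apply/max_idPl; rewrite ge_min lexx orbT //.
Qed.

Lemma pull_h0 (k t : R) : pull k t 0 = 0.
Proof.
rewrite /pull mulr0 mul0r oppr0; apply/max_idPl; by rewrite ge_min lexx orbT.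
Qed.

(** For [|t - k| <= 1/4] the tent factor is at least 1/2, so the factor 2 makes the bound at least
    [h] and the displacement is not cut off. *)
Lemma pull_near (k t h : R) : `|t - k| <= h -> h <= 4^-1 -> pull k t h = t - k.
Proof.
move=> tk h4; rewrite /pull.
have -> : Num.max 0 (1 - 2 * `|t - k|) = 1 - 2 * `|t - k| by apply/max_idPr; lra.
set u := t - k in tk *.
have m : `|u| <= 2 * h * (1 - 2 * `|u|).
  have u0 := normr_ge0 u; nra.
move: m; rewrite ler_norml => /andP[m1 m2].
have -> : Num.min u (2 * h * (1 - 2 * `|u|)) = u by apply/min_idPl.
by apply/max_idPr.
Qed.

Lemma pull_between (k t h : R) : 0 <= h -> 0 <= k -> 0 <= t -> 0 <= t - pull k t h.
Proof.
move=> h0 k0 t0; rewrite subr_ge0 /pull ge_max; set m := 2 * h * _.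
have m0 : 0 <= m by rewrite /m !mulr_ge0// le_max lexx.
by apply/andP; split; [lra|rewrite ge_min; apply/orP; left; lra].
Qed.

Lemma for_pull (T : topologicalType) (k : R) (t h : T -> R) x :
  {for x, continuous t} -> {for x, continuous h} ->
  {for x, continuous (fun y => pull k (t y) (h y))}.
Proof.
move=> ct ch.
have cu : {for x, continuous (fun y => t y - k)} by apply: for_sub => //; exact: for_cst.
have cm : {for x, continuous (fun y => 2 * h y * Num.max 0 (1 - 2 * `|t y - k|))}.
  apply: for_mul; first by apply: for_mul => //; exact: for_cst.
  apply: for_max; first exact: for_cst.
  apply: for_sub; first exact: for_cst.
  by apply: for_mul; [exact: for_cst|exact: for_norm].
by apply: for_max; [exact: for_opp|exact: for_min].
Qed.

End CombExtensor.

Section CombExtensor2.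
Variable R : realType.
Local Notation V := 'rV[R]_5.
Local Notation base := (@ppl_base R).
Local Notation M := (Mspace R).

Lemma Mset_base : (0, base) \in @Mset R.
Proof. by apply: mem_set; left; rewrite /= lexx. Qed.

(** The two coordinates cannot be extended independently, since on a tooth the first must be an
    integer exactly. The extended distance [h] from the base point opens an interval around each
    integer: only inside it may the tooth coordinate leave the base point, and there the first
    coordinate is collapsed to the integer. *)
Lemma ppl_AE_Mcw (X : topologicalType) : compact [set: X] -> hausdorff_space X ->
  (forall n, absolute_extensor (set_type (@ppl R n)) X) -> absolute_extensor (Mcw R) X.
Proof.
move=> cX hX ae; apply: AE_intro; first by exists (SigSub Mset_base).
move=> A f cA cf; have nX : normal_space X by exact: compact_normal.
have cptA : compact A by exact: subclosed_compact cA cX _.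
pose i : M -> R * V := set_val.
have ci : continuous i by exact: initial_continuous.
have cif : {within A, continuous (fun x => i (f x))} := within_comp_cts cf ci.
have ct0 : {within A, continuous (fun x => (i (f x)).1)} := within_comp_cts cif (@fst_cts R V).
have cv0 : {within A, continuous (fun x => (i (f x)).2)} := within_comp_cts cif (@snd_cts R V).
have t_ge0 (x : M) : 0 <= (i x).1.
  by case: (set_valP x) => [[]//|[n [-> _]]]; exact: ler0n.
have [b [_ /(_ (b + 1))]] := compact_bounded (compact_within_image ct0 cptA).
rewrite ltrDl ltr01 => /(_ erefl) bt.
have bt' x : A x -> (i (f x)).1 <= b + 1.
  by move=> Ax; apply: le_trans (ler_norm _) _; apply: bt; exists x.
have [|t1 ct1 t1E] := @tietze_R R X nX A _ cA ct0.
  by exists (b + 1) => x Ax; apply: bt; exists x.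
pose t x := Num.max 0 (t1 x).
have ct : continuous t by move=> x; apply: for_max; [exact: for_cst|exact: ct1].
have tE x : A x -> t x = (i (f x)).1.
  by move=> Ax; rewrite /t t1E//; apply/max_idPr; exact: t_ge0.
have t0 x : 0 <= t x by rewrite le_max lexx.
(* The cap 1/4 keeps the intervals around different integers disjoint and meets the hypothesis of
   [pull_near]. *)
pose hv (v : V) : R := Num.min 4^-1 `|v - base|.
have chv : continuous hv.
  move=> v; have k1 : {for v, continuous (fun v : V => `|v - base|)}.
    by apply: for_norm; apply: for_sub; [exact: for_id|exact: for_cst].
  have k2 : {for v, continuous (fun _ : V => 4^-1 : R)} by exact: for_cst.
  exact: (for_min k2 k1).
have hv4 v : 0 <= hv v <= 4^-1.
  by rewrite ge_min lexx andbT le_min normr_ge0 andbT invr_ge0 ler0n.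
have [|h1 [ch1 h1E h101]] := @tietze_clamp R X A (fun x => hv (i (f x)).2) nX cA (within_comp_cts cv0 chv).
  by move=> x _; have := hv4 (i (f x)).2 => /andP[h0 h4]; apply/andP; split => //; lra.
pose h x := Num.min 4^-1 (h1 x).
have ch : continuous h.
  move=> x; have k2 : {for x, continuous (fun _ : X => 4^-1 : R)} by exact: for_cst.
  exact: (for_min k2 (ch1 x)).
have hE x : A x -> h x = hv (i (f x)).2.
  move=> Ax; rewrite /h h1E//; apply/min_idPr; by case/andP: (hv4 (i (f x)).2).
have h0 x : 0 <= h x by rewrite le_min; case/andP: (h101 x) => -> _; rewrite andbT invr_ge0.
have h4 x : h x <= 4^-1 by rewrite ge_min lexx.
(* On [Z n] the coordinate for tooth [n] is to be the base point. This is consistent with [f]: at a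
   point of the tooth other than the base point, [h] is positive while [t] equals [n]. *)
pose Z n := [set x | h x <= `|t x - n%:R|].
have cZ n : closed (Z n).
  rewrite -[Z n]setCK; apply: open_closedC.
  have -> : ~` Z n = [set x | `|t x - n%:R| < h x].
    by apply/seteqP; split => x /=; rewrite ltNge => /negP.
  have cn x : {for x, continuous (fun x => t x - n%:R)} by apply: for_sub; [exact: ct|exact: for_cst].
  by apply: (@open_ltr_fun R X (fun x => `|t x - n%:R|) h) => // x; exact: (for_norm (cn x)).
have leafE n x : A x -> Z n x -> leaf_proj n (f x) = base.
  move=> Ax; rewrite /Z/= tE// hE// => Zx; rewrite /leaf_proj; case: ifP => // tn1.
  have [e|e] := eqVneq (i (f x)).1 n%:R; last first.
    exact: Mset_noninteger (set_valP (f x)) e tn1.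
  move: Zx; rewrite e subrr normr0 /hv ge_min => /orP[|]; first by rewrite leNgt invr_gt0 ltr0n.
  by rewrite normr_le0 subr_eq0 => /eqP.
have /choice[G GP] : forall n, exists G : X -> V,
    [/\ continuous G, forall x, ppl n (G x), forall x, Z n x -> G x = base &
      forall x, A x -> G x = leaf_proj n (f x)].
  move=> n; pose g x := if pselect (Z n x) then base else leaf_proj n (f x).
  have gZ x : Z n x -> g x = base by rewrite /g; case: pselect.
  have gA x : A x -> g x = leaf_proj n (f x).
    by move=> Ax; rewrite /g; case: pselect => //= Zx; rewrite leafE.
  have [|||G [cG GP GE]] := AE_sub (f := g) (A := A `|` Z n) (ae n).
  - exact: closedU.
  - apply: withinU_continuous => //.
    + have c := within_comp_cts cf (@leaf_proj_continuous R n).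
      by apply: subspace_eq_continuous c => x /set_mem Ax; rewrite /from_subspace gA.
    + have c : {within Z n, continuous (fun _ : X => base)}.
        by apply: continuous_subspaceT => x; exact: for_cst.
      by apply: subspace_eq_continuous c => x /set_mem Ax; rewrite /from_subspace gZ.
  - by move=> x [/gA ->|/gZ ->]; [exact: leaf_proj_in|exact: ppl_base_in].
  exists G; split => // x; first by move=> Zx; rewrite GE ?gZ//; right.
  by move=> Ax; rewrite GE ?gA//; left.
(* Compactness of [A] bounds the teeth that [f] reaches; beyond them the extension stays on the
   ray. *)
pose N := (Num.truncn (b + 1)).+1.
(* [(t, h)] is retracted onto a comb; on a tooth, exactly one of the [G k] may
   differ from the base point. *)
pose tau x := t x - \sum_(k < N) pull k%:R (t x) (h x).
pose w x := base + \sum_(k < N) (G k x - base).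
have near1 x (k l : nat) : `|t x - k%:R| < 2^-1 -> k <> l -> 2^-1 <= `|t x - l%:R|.
  move=> tk kl; rewrite leNgt; apply/negP => tl.
  move: tk tl; rewrite !ltr_norml => /andP[h1' h2] /andP[h3 h5].
  have kl1 : (k < l.+1)%N by rewrite -(ltr_nat R) -natr1; lra.
  have lk1 : (l < k.+1)%N by rewrite -(ltr_nat R) -natr1; lra.
  by apply: kl; apply/eqP; rewrite eqn_leq -ltnS kl1 -ltnS.
have in_leaf x (k : 'I_N) : `|t x - k%:R| < h x -> tau x = k%:R /\ w x = G k x.
  move=> tk; have tk2 : `|t x - k%:R| < 2^-1 by have := h4 x; lra.
  have far (j : 'I_N) : j != k -> 2^-1 <= `|t x - j%:R|.
    move=> jk; apply: (near1 x k j tk2) => e; move/eqP: jk; apply; exact: val_inj.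
  split.
    rewrite /tau (bigD1 k)//= big1 => [|j jk]; last by apply: pull_far; exact: far.
    by rewrite addr0 (pull_near (ltW tk) (h4 x)); ring.
  rewrite /w (bigD1 k)//= big1 => [|j jk]; first by rewrite addr0 addrC subrK.
  case: (GP j) => _ _ -> ; first by rewrite subrr.
  by rewrite /Z/=; apply: le_trans (far j jk); apply: le_trans (h4 x) _; lra.
have in_ray x : (forall k : 'I_N, h x <= `|t x - k%:R|) -> w x = base.
  move=> hk; rewrite /w big1 ?addr0// => k _.
  by case: (GP k) => _ _ -> //; rewrite ?subrr//; exact: hk.
have tau_ge0 x : 0 <= tau x.
  rewrite /tau; have [[k tk]|nk] := pselect (exists k : 'I_N, `|t x - k%:R| < 2^-1).
    rewrite (bigD1 k)//= big1 ?addr0; first exact: pull_between.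
    move=> j jk; apply: pull_far; apply: (near1 x k j tk).
    by move=> e; move/eqP: jk; apply; apply: val_inj.
  rewrite big1 ?subr0// => k _; apply: pull_far; rewrite leNgt; apply/negP => tk.
  by apply: nk; exists k.
have inM x : (tau x, w x) \in @Mset R.
  apply: mem_set; have [[k tk]|nk] := pselect (exists k : 'I_N, `|t x - k%:R| < h x).
    have [-> ->] := in_leaf x k tk; right; exists k; split => //.
    by case: (GP k) => _ GPk _ _; exact: GPk.
  left; split => //=; apply: in_ray => k; rewrite leNgt; apply/negP => tk.
  by apply: nk; exists k.
exists (fun x => SigSub (inM x) : M).
  apply: continuous_setType => x.
  have c1 : {for x, continuous tau}.
    apply: for_sub; first exact: ct.
    by apply: continuous_sum_for => k; apply: for_pull; [exact: ct|exact: ch].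
  have c2 : {for x, continuous w}.
    apply: for_add; first exact: for_cst.
    apply: continuous_sum_for => k; apply: for_sub; last exact: for_cst.
    by case: (GP k) => cG _ _ _; exact: cG.
  exact: (for_pair c1 c2).
move=> x Ax; apply: val_inj; rewrite /=.
rewrite [RHS]surjective_pairing.
have [vb|vb] := eqVneq (i (f x)).2 base.
  have hx0 : h x = 0 by rewrite hE// vb /hv subrr normr0; apply/min_idPr; rewrite invr_ge0.
  rewrite in_ray; last by move=> k; rewrite hx0.
  rewrite /tau big1 ?subr0; last by move=> k _; rewrite hx0 pull_h0.
  by rewrite tE// -vb.
have [n fn Pn] : exists2 n : nat, (i (f x)).1 = n%:R & ppl n (i (f x)).2.
  case: (set_valP (f x)) => [[_ e]|[n [e1 e2]]]; last by exists n.
  by move: vb; rewrite /i e eqxx.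
have nN : (n < N)%N.
  rewrite -(ltr_nat R) -fn; apply: le_lt_trans (bt' x Ax) _; exact: truncnS_gt.
have [|-> ->] := in_leaf x (Ordinal nN).
  rewrite /= tE// fn subrr normr0 hE// lt_min invr_gt0 normr_gt0 subr_eq0 vb andbT.
  by rewrite ltr0n.
rewrite /=; case: (GP n) => _ _ _ ->//; rewrite /leaf_proj -/i fn subrr normr0 ltr01.
by rewrite -fn.
Qed.

End CombExtensor2.

(** * Metrizability *)

Section MetricSpaceOf.
Variables (R : realType) (X : choiceType) (d : X -> X -> R).

Record metric_axioms : Prop := MetricAxioms {
  dist_xx : forall x, d x x = 0;
  dist_pos : forall x y, d x y = 0 -> x = y;
  dist_sym : forall x y, d x y = d y x;
  dist_tri : forall y x z, d x z <= d x y + d y z }.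

(** An alias that carries the metric structure while the original type keeps its own topology. *)
Definition metric_of (ax : metric_axioms) : Type := X.

Variable ax : metric_axioms.
HB.instance Definition _ := Choice.on (metric_of ax).
HB.instance Definition _ := @isMetric.Build R (metric_of ax) d
  (dist_xx ax) (dist_pos ax) (dist_sym ax) (dist_tri ax).

End MetricSpaceOf.

Lemma compact_embedding (X Y : topologicalType) (f : X -> Y) : compact [set: X] ->
  hausdorff_space Y -> continuous f -> injective f -> embedding f.
Proof.
move=> cX hY cf fi; split => // U oU.
have cC : closed (f @` ~` U).
  apply: compact_closed => //; apply: continuous_compact; first exact: continuous_subspaceT.
  exact: subclosed_compact (open_closedC oU) cX _.
exists (~` (f @` ~` U)); first exact: closed_openC.
apply/seteqP; split => x /=.
  by move=> h; apply: contrapT => Ux; apply: h; exists x.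
by move=> Ux [y Uy /fi yx]; apply: Uy; rewrite yx.
Qed.

Lemma compact_metrizable (R : realType) (X : topologicalType) (d : X -> X -> R) :
  compact [set: X] -> metric_axioms d ->
  (forall x e, 0 < e -> \forall y \near x, d x y < e) -> metrizable R X.
Proof.
move=> cX ax dn; pose Y : metricType R := metric_of ax.
pose f : X -> Y := id; pose g : Y -> X := id.
have cf : continuous f.
  move=> x W /nbhs_ballP[e /= e0 eW]; have := dn x e e0.
  by apply: filterS => y xy; apply: eW; rewrite ballEmdist.
exists Y, f, g; split => //.
have : {within f @` [set: X], continuous g}.
  apply: quotient_continuous => //.
  - exact: metric_hausdorff.
  - exact: continuous_subspaceT.
  - by apply: continuous_subspaceT => x; exact: cvg_id.
have -> : f @` [set: X] = [set: Y] by apply/seteqP; split => // x _; exists x.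
by move=> h; apply: (continuous_subspace_setT _).2.
Qed.

Section CountableSeparation.
Variables (R : realType) (X : topologicalType) (f : nat -> X -> R).
Hypothesis cX : compact [set: X].
Hypothesis cf : forall n, continuous (f n).
Hypothesis fsep : forall x y, (forall n, f n x = f n y) -> x = y.

(** The weights tend to 0, so that up to a given error only finitely many [f n] contribute to the
    supremum [d], which is therefore continuous. *)
Let a n x y : R := n.+1%:R^-1 * Num.min 1 `|f n x - f n y|.
Let D x y : set R := range (fun n => a n x y).
Let d x y : R := sup (D x y).

Let a_ge0 n x y : 0 <= a n x y.
Proof. by rewrite mulr_ge0 ?invr_ge0// le_min normr_ge0 ler01. Qed.

Let a_le n x y : a n x y <= n.+1%:R^-1.
Proof. by rewrite ler_piMr ?invr_ge0// ge_min lexx. Qed.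

Let a_le1 n x y : a n x y <= 1.
Proof. by apply: le_trans (a_le n x y) _; rewrite invf_le1// ler1n. Qed.

Let a_le_d n x y : a n x y <= d x y.
Proof.
apply: ub_le_sup; last by exists n.
by exists 1 => _ [m _ <-].
Qed.

Let d_le x y c : (forall n, a n x y <= c) -> d x y <= c.
Proof. by move=> h; apply: ge_sup; [exists (a 0 x y), 0%N|move=> _ [n _ <-]]. Qed.

Let d_axioms : metric_axioms d.
Proof.
split.
- move=> x; apply/eqP; rewrite eq_le; apply/andP; split; last exact: le_trans (a_le_d 0 x x).
  apply: d_le => n; rewrite /a subrr normr0.
  by rewrite (_ : Num.min 1 0 = 0) ?mulr0//; apply/min_idPr.
- move=> x y dxy; apply: fsep => n; apply/eqP; rewrite -subr_eq0 -normr_eq0.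
  have : a n x y <= 0 by rewrite -dxy.
  rewrite /a pmulr_rle0 ?invr_gt0// ge_min leNgt ltr01 /=.
  by rewrite normr_le0 normr_eq0.
- move=> x y; rewrite /d /D.
  by have -> : (fun n => a n x y) = (fun n => a n y x) by apply/funext => n; rewrite /a distrC.
- move=> y x z; apply: d_le => n.
  apply: (@le_trans _ _ (a n x y + a n y z)); last exact: lerD.
  rewrite /a -mulrDr ler_wpM2l ?invr_ge0//.
  have := ler_distD (f n y) (f n x) (f n z).
  have := normr_ge0 (f n x - f n y); have := normr_ge0 (f n y - f n z).
  set p := `|_|; set q := `|_|; set r := `|_| => p0 q0 pqr.
  rewrite ge_min; have [h|h] := leP 1 q; have [h'|h'] := leP 1 p; apply/orP.
  - by left; lra.
  - by left; lra.
  - by left; lra.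
  - by right.
Qed.

Let d_near x e : 0 < e -> \forall y \near x, d x y < e.
Proof.
move=> e0.
have nn N : \forall y \near x, forall n, (n < N)%N -> a n x y < e / 2.
  elim: N => [|N IH]; first by apply: filterS filterT.
  have cN : {for x, continuous (fun y => `|f N x - f N y|)}.
    by apply: for_norm; apply: for_sub; [exact: for_cst|exact: cf].
  have : \forall y \near x, `|f N x - f N y| < e / 2.
    apply: (near_lt (g := fun=> e / 2) cN); first exact: for_cst.
    by rewrite subrr normr0 divr_gt0.
  apply: filterS2 IH => y hy hN n; rewrite ltnS leq_eqVlt => /orP[/eqP ->|]; last exact: hy.
  apply: le_lt_trans hN; rewrite /a.
  apply: (@le_trans _ _ (Num.min 1 `|f N x - f N y|)).
    by rewrite ler_piMl ?le_min ?normr_ge0 ?ler01// invf_le1// ler1n.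
  by rewrite ge_min lexx orbT.
(* From this index on the weight alone is at most [e / 2]. *)
pose N := Num.truncn (2 / e).
have := nn N; apply: filterS => y hy.
apply: (@le_lt_trans _ _ (e / 2)); last by rewrite ltr_pdivrMr// ltr_pMr// ltr1n.
apply: d_le => n; have [nN|nN] := ltnP n N; first exact/ltW/hy.
apply: le_trans (a_le n x y) _.
rewrite -[leRHS]invrK lef_pV2 ?posrE ?invr_gt0 ?divr_gt0// invf_div.
apply: ltW; apply: lt_le_trans (truncnS_gt _) _.
by rewrite ler_nat ltnS.
Qed.

Lemma countable_separation_metrizable : metrizable R X.
Proof. exact: compact_metrizable cX d_axioms d_near. Qed.

End CountableSeparation.

Section MetricSeparation.
Variables (R : realType) (Y : metricType R).
Hypothesis cY : compact [set: Y].
Local Notation dist := (@mdist R Y).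

Let dist_continuous (a : Y) : continuous (dist a).
Proof.
move=> x W /nbhs_ballP[e /= e0 eW].
have : \forall y \near x, ball x e y by exact: nbhsx_ballx.
apply: filterS => y; rewrite ballEmdist/= => xy; apply: eW; rewrite -ball_normE/=.
rewrite ltr_norml; have := metric_triangle a x y; have := metric_triangle a y x.
by rewrite (metric_sym y x) => h1 h2; apply/andP; split; lra.
Qed.

(** Distances to the points of finite nets of mesh [1 / (n + 1)], cut off at 1 so that they can
    serve as base functions. The index [(n, k)] means the k-th point of the n-th net, with the zero
    function past its end. *)
Lemma metric_separation : exists f : nat * nat -> Y -> R,
  [/\ forall i, continuous (f i), forall i y, 0 <= f i y <= 1 &
      forall x y, (forall i, f i x = f i y) -> x = y].
Proof.
have /choice[l lP] : forall n : nat, exists l : seq Y,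
    forall y, exists2 a, List.In a l & dist a y < n.+1%:R^-1.
  move=> n; have [||l lP] := @compact_finite_subcover Y [set: Y] Y
    (fun a => interior (ball a (n.+1%:R^-1 : R))) cY.
  - by move=> a; exact: open_interior.
  - by move=> y _; exists y; apply: nbhsx_ballx; rewrite invr_gt0.
  exists l => y; have [a al ay] := lP y I; exists a => //.
  by have := interior_subset ay; rewrite ballEmdist.
pose m a y := Num.min 1 (dist a y).
pose f (i : nat * nat) : Y -> R := nth (fun=> 0) (map m (l i.1)) i.2.
have fl n a : List.In a (l n) -> exists k, f (n, k) = m a.
  rewrite /f/=; elim: (l n) => //= b s IH [->|/IH [k kE]]; first by exists 0%N.
  by exists k.+1.
have fcase i : (exists a, f i = m a) \/ f i = fun=> 0.
  rewrite /f; have [h|h] := ltnP i.2 (size (map m (l i.1))); last by right; rewrite nth_default.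
  by have /mapP[a _ ->] := mem_nth (fun=> 0) h; left; exists a.
exists f; split.
- move=> i; case: (fcase i) => [[a ->]|->] y; last exact: for_cst.
  by apply: for_min; [exact: for_cst|exact: dist_continuous].
- move=> i y; case: (fcase i) => [[a ->]|->]; last by rewrite lexx ler01.
  by rewrite le_min ler01 mdist_ge0 ge_min lexx.
- move=> x y xy; apply: contrapT => /eqP nxy.
  have d0 : 0 < dist x y by rewrite mdist_gt0.
  (* A net point closer than [e] to [x] is farther than [e] from [y]; the bound 1/2 makes this
     survive the cut-off at 1. *)
  pose e := Num.min 2^-1 (dist x y / 2).
  have e0 : 0 < e by rewrite lt_min invr_gt0 ltr0n divr_gt0.
  pose n := Num.truncn e^-1.
  have ne : n.+1%:R^-1 < e.
    by rewrite -[ltRHS]invrK ltf_pV2 ?posrE ?invr_gt0// truncnS_gt.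
  have [a al ax] := lP n x; have [k kE] := fl n a al.
  have {}ax : dist a x < e by exact: lt_trans ax ne.
  have := xy (n, k); rewrite kE /m.
  have e2 : e <= 2^-1 by rewrite ge_min lexx.
  have ed : e <= dist x y / 2 by rewrite ge_min lexx orbT.
  have := metric_triangle x a y; rewrite (metric_sym x a) => tri.
  have -> : Num.min 1 (dist a x) = dist a x by apply/min_idPr; lra.
  have : e <= Num.min 1 (dist a y) by rewrite le_min; apply/andP; split; lra.
  lra.
Qed.

End MetricSeparation.

Fixpoint term_tree (J : countType) (t : term J) : GenTree.tree nat :=
  match t with
  | Tbase j => GenTree.Node 0 [:: GenTree.Leaf (pickle j)]
  | Tcst q => GenTree.Node 1 [:: GenTree.Leaf (pickle q)]
  | Tlin q i j t1 t2 => GenTree.Node 2 [:: GenTree.Leaf (pickle (q, i, j)); term_tree t1; term_tree t2]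
  | Tmax t1 t2 => GenTree.Node 3 [:: term_tree t1; term_tree t2]
  | Tsol n t1 => GenTree.Node 4 [:: GenTree.Leaf n; term_tree t1]
  end.

Lemma term_tree_inj (J : countType) : injective (@term_tree J).
Proof.
have pinj (T : countType) : injective (@pickle T) by exact: (pcan_inj pickleK).
elim=> [j|q|q i j t1 h1 t2 h2|t1 h1 t2 h2|n t h] [j'|q'|q' i' j' t1' t2'|t1' t2'|n' t'] //=.
- by move=> [/pinj ->].
- by move=> [/pinj ->].
- by move=> [/pinj [-> -> ->] /h1 -> /h2 ->].
- by move=> [/h1 -> /h2 ->].
- by move=> [-> /h ->].
Qed.

(** * The universal compactum *)

Section Universal.
Variable R : realType.
Local Notation V := 'rV[R]_5.
Let J : Type := (nat * nat)%type.
Local Notation valid := (@valid R J (@segment R) (fun=> true)).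
Let U := set_type valid.
Let cB : compact (@segment R). Proof. exact: segment_set_compact. Qed.

Lemma universal_metrizable : metrizable R U.
Proof.
pose code (t : term J) := pickle (term_tree t).
have code_inj : injective code.
  by move=> s t /(pcan_inj pickleK); exact: (@term_tree_inj (nat * nat)%type).
pose dec n := xget (Tcst J 0) [set t | code t = n].
have codeK t : dec (code t) = t.
  by rewrite /dec; case: xgetP => [s _ /code_inj//|/(_ t) h]; case: h.
pose f n (u : U) : R :=
  if @unpickle (nat * 'I_5)%type n is Some (m, i) then set_val u (dec m) ord0 i else 0.
apply: (@countable_separation_metrizable R U f).
- exact: U_compact.
- move=> n; rewrite /f; case: unpickle => [[m i]|] u; last exact: for_cst.
  by apply: for_coord; exact: U_eval.
- move=> u v uv; apply: val_inj; apply/funext => t; apply/rowP => i.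
  have := uv (pickle (code t, i)); rewrite /f pickleK codeK; exact.
Qed.

Lemma universal_member : metrizable_compactum R U /\ absolute_extensor (Mcw R) U.
Proof.
split; first by split; [exact: universal_metrizable|exact: U_compact].
apply: ppl_AE_Mcw; [exact: U_compact|exact: U_hausdorff|].
by move=> n; exact: valid_AE.
Qed.

Lemma universal_embeds (X : topologicalType) : metrizable_compactum R X ->
  absolute_extensor (Mcw R) X -> exists f : X -> U, embedding f.
Proof.
move=> [[Y [p [q [cp cq pK qK]]]] cX] ae.
have cY : compact [set: Y].
  have -> : [set: Y] = p @` [set: X].
    by apply/seteqP; split => // y _; exists (q y).
  by apply: continuous_compact => //; exact: continuous_subspaceT.
have [f [cf f01 fsep]] := metric_separation cY.
have [|||F cF FE] := @valid_map R J (@segment R) (fun=> true) X _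
    (fun j x => to_segment (f j (p x))).
- by move=> n _; exact: Mcw_AE_ppl.
- move=> j x; apply: for_segment; exact: (for_comp (cp x) (cf j (p x))).
- by move=> j x; exact: segment_in.
exists F; apply: compact_embedding => //; first exact: U_hausdorff.
move=> x y Fxy; apply: (can_inj pK); apply: fsep => j; apply: to_segment_inj.
by rewrite -!FE Fxy.
Qed.

End Universal.

Lemma Mcw_not_finitely_dominated (R : realType) (K : CWcomplex R) :
  extension_type (Mcw R) K -> ~ finitely_dominated K.
Proof.
move=> [MK KM] dK.
have cht (X : topologicalType) : compact [set: X] -> hausdorff_space X -> tychonoff_space X.
  exact: (@compact_hausdorff_tychonoff R).
have [|m mP] := finitely_dominated_AE dK.
  by move=> X cX hX Xae; apply: MK; [exact: cht|exact: ppl_AE_Mcw].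
(* The plane of degree [p] has index [p.-1], and [m < p] places every index below [m] among those
   solved formally. *)
have [p mp pp] := prime_above m.
have pn : prime p.-1.+1 by rewrite prednK// prime_gt0.
(* Read backwards: the valuations solve the problems of index below [m], so [K] extends over them,
   hence so does the comb, hence its tooth of degree [p], which is impossible. *)
apply: (@valid_not_AE R p.-1 pn); apply: Mcw_AE_ppl.
have cB : compact (@ppl R 0) by exact: ppl_compact.
apply: KM; first by apply: cht; [exact: U_compact|exact: U_hausdorff].
apply: mP; [exact: U_compact|exact: U_hausdorff|].
move=> n nm; apply: valid_AE => //.
by rewrite -ltnS prednK ?prime_gt0// (leq_ltn_trans nm)//.
Qed.

Theorem mainTheorem3 (R : realType) :
  exists M : CWcomplex R,
    [/\ countable_cw M,
        (exists U : topologicalType,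
           universal_space
             (fun X => metrizable_compactum R X /\ absolute_extensor M X) U)
      & ~ (exists2 K : CWcomplex R, extension_type M K & finitely_dominated K)].
Proof.
exists (Mcw R); split; first exact: Mcw_countable.
  exists (set_type (@valid R (nat * nat)%type (@segment R) (fun=> true))); split.
    exact: universal_member.
  by move=> X [mX aeX]; exact: universal_embeds.
by move=> [K MK]; exact: Mcw_not_finitely_dominated.
Qed.
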